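(* Let $T$ be an irreducible triangulation with $n$ vertices endowed with a transversal pair of bipolar orientations. Then \textsc{TransversalDraw}($T$) outputs a straight-line drawing of $T$ on an integer grid whose half-perimeter (width plus height) is $n-1$. The embedded edges satisfy: red edges are oriented from bottom to top and weakly oriented from left to right; blue edges are oriented from left to right and weakly oriented from top to bottom. The algorithm can be implemented to run in linear time.
   Context: An irreducible triangulation is a plane graph with quadrangular outer face (outer vertices $N,E,S,W$ in clockwise order), triangular inner faces, and no separating triangle. A transversal pair of bipolar orientations assigns to each inner edge (edge not on the outer face) a direction and a color red or blue so that: around each inner vertex, the incident edges form in clockwise order nonempty intervals of outgoing red, outgoing blue, ingoing red, ingoing blue edges; all inner edges at $N$, $E$, $S$, $W$ are respectively ingoing red, ingoing blue, outgoing red, outgoing blue. The red-map $T_r$ is obtained by deleting blue edges and orienting the outer edges from $S$ to $N$ ($S\to W\to N$, $S\to E\to N$); the blue-map $T_b$ by deleting red edges and orienting the outer edges from $W$ to $E$ ($W\to N\to E$, $W\to S\to E$). For a vertex $v$, the leftmost outgoing red path starts at $v$ and always follows the leftmost outgoing edge of $T_r$ (ending at $N$); the rightmost ingoing red path starts at $v$ and always follows backward the rightmost ingoing edge of $T_r$ (ending at $S$); their concatenation is the separating red path $\mathcal{P}_r(v)$ from $S$ to $N$. The separating blue path $\mathcal{P}_b(v)$ is defined likewise in $T_b$ from $W$ to $E$. \textsc{TransversalDraw}($T$) gives each vertex $v$ abscissa equal to the number of inner faces of $T_r$ on the left of $\mathcal{P}_r(v)$ and ordinate equal to the number of inner faces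 of $T_b$ on the right of $\mathcal{P}_b(v)$, then joins adjacent vertices by segments. A straight-line drawing is a planar embedding with vertices at integer grid points and edges drawn as segments. *)

(* Defs.v *)
From mathcomp Require Import all_boot all_order all_algebra.

Set Implicit Arguments.
Unset Strict Implicit.
Unset Printing Implicit Defensive.

Import Order.TTheory GRing.Theory Num.Theory.

(** * Plane graphs as rotation systems

    A simple plane graph on [V] is an adjacency relation together with the
    clockwise order of the neighbours of each vertex: [cw v u] is the neighbour
    of [v] that follows [u] clockwise around [v].  A dart is an ordered pair of
    adjacent vertices. *)

Record rmap (V : finType) := RMap { adj : rel V; cw : V -> V -> V }.

Definition darts (V : finType) (M : rmap V) : {set V * V} :=
  [set d | adj M d.1 d.2].

Definition rev_dart (V : finType) (d : V * V) : V * V := (d.2, d.1).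

(* Clockwise rotation from the reversed dart sweeps the face lying on the LEFT
   of the dart, so a face is the cycle of darts having it on their left: inner
   faces are traversed counterclockwise, the outer face clockwise. *)
Definition face_next (V : finType) (M : rmap V) (d : V * V) : V * V :=
  (d.2, cw M d.2 d.1).

Definition face_of (V : finType) (M : rmap V) (d : V * V) : {set V * V} :=
  [set d' | fconnect (face_next M) d d'].

Definition faces (V : finType) (M : rmap V) : {set {set V * V}} :=
  [set face_of M d | d in darts M].

(* Second clause: [cw v] is a single cycle on the neighbours of [v].
   Last clause: genus 0, i.e. #V - #E + #F = 2, doubled. *)
Definition plane_graph (V : finType) (M : rmap V) : Prop :=
  [/\ symmetric (adj M) /\ irreflexive (adj M),
      forall v u w, adj M v u -> fconnect (cw M v) u w = adj M v w,
      forall u v, connect (adj M) u v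
    & 2 * (#|V| + #|faces M|) = #|darts M| + 4].

(* The plane graph obtained by keeping only the edges in [e]. *)
Definition submap (V : finType) (M : rmap V) (e : rel V) : rmap V :=
  RMap e (fun v u => let s := orbit (cw M v) (cw M v u) in
                     nth u s (find (e v) s)).

(** * Irreducible triangulations *)

Record framed_map (V : finType) :=
  FramedMap { fmap :> rmap V; vN : V; vE : V; vS : V; vW : V }.

Definition outer_darts (V : finType) (T : framed_map V) : {set V * V} :=
  [set (vN T, vE T); (vE T, vS T); (vS T, vW T); (vW T, vN T)].

Definition outer_edge (V : finType) (T : framed_map V) : rel V :=
  [rel u v | ((u, v) \in outer_darts T) || ((v, u) \in outer_darts T)].

Definition inner_edge (V : finType) (T : framed_map V) : rel V :=
  [rel u v | adj T u v && ~~ outer_edge T u v].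

Definition inner_vertex (V : finType) (T : framed_map V) (v : V) : bool :=
  v \notin [:: vN T; vE T; vS T; vW T].

(* A 3-cycle whose removal disconnects the graph. *)
Definition separating_triangle (V : finType) (M : rmap V) (a b c : V) : Prop :=
  let off := [pred v | v \notin [:: a; b; c]] in
  [/\ adj M a b, adj M b c, adj M c a
    & exists x y, [/\ off x, off y &
        ~~ connect [rel u v | [&& adj M u v, off u & off v]] x y]].

Definition irreducible_triangulation (V : finType) (T : framed_map V) : Prop :=
  [/\ plane_graph T,
      [/\ uniq [:: vN T; vE T; vS T; vW T], adj T (vN T) (vE T)
        & face_of T (vN T, vE T) = outer_darts T],
      forall F, F \in faces T -> F != outer_darts T -> #|F| = 3
    & forall a b c, ~ separating_triangle T a b c].

(** * Transversal pairs of bipolar orientations *)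

(* [red u v] means that {u, v} is a red edge directed from u to v; the same for
   [blue]. *)
Record bicolor_orientation (V : finType) :=
  BicolorOrientation { red : rel V; blue : rel V }.

Definition transversal_pair (V : finType) (T : framed_map V)
    (X : bicolor_orientation V) : Prop :=
  [/\ forall u v, red X u v || blue X u v -> inner_edge T u v,
      forall u v, inner_edge T u v ->
        (red X u v + red X v u + blue X u v + blue X v u = 1)%N,
      forall v, inner_vertex T v -> exists s1 s2 s3 s4 : seq V,
        let s := s1 ++ s2 ++ s3 ++ s4 in
        [/\ ucycle (frel (cw T v)) s, s =i adj T v,
            [/\ s1 != [::], s2 != [::], s3 != [::] & s4 != [::]]
          & [/\ all (red X v) s1, all (blue X v) s2,
                all (red X ^~ v) s3 & all (blue X ^~ v) s4]]
    & forall u,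
        [/\ inner_edge T u (vN T) -> red X u (vN T),
            inner_edge T u (vE T) -> blue X u (vE T),
            inner_edge T u (vS T) -> red X (vS T) u
          & inner_edge T u (vW T) -> blue X (vW T) u]].

(* Orientations of the red-map and of the blue-map, outer edges included. *)
Definition red_arc (V : finType) (T : framed_map V)
    (X : bicolor_orientation V) : rel V :=
  [rel u v | red X u v ||
    ((u, v) \in [:: (vS T, vW T); (vW T, vN T); (vS T, vE T); (vE T, vN T)])].

Definition blue_arc (V : finType) (T : framed_map V)
    (X : bicolor_orientation V) : rel V :=
  [rel u v | blue X u v ||
    ((u, v) \in [:: (vW T, vN T); (vN T, vE T); (vW T, vS T); (vS T, vE T)])].

(** * Separating paths and the drawing

    Below [o] is one of the two orientations above and [orient_map T o] is the
    corresponding red- or blue-map. *)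

Definition orient_map (V : finType) (T : framed_map V) (o : rel V) : rmap V :=
  submap T [rel u v | o u v || o v u].

(* [u] is the first, clockwise around [v], of the neighbours in [P v]: the
   preceding neighbour is not in [P v], or the corner that precedes [u] is that
   of the outer face (needed at the source and at the sink, whose edges are all
   outgoing, resp. all ingoing). *)
Definition first_cw (V : finType) (T : framed_map V) (M : rmap V) (P : rel V)
    (v u : V) : bool :=
  P v u && (((v, u) \in outer_darts T) ||
            [forall w, adj M v w && (cw M v w == u) ==> ~~ P v w]).

(* Facing along the orientation, clockwise around a vertex the outgoing edges
   are met from left to right and the ingoing edges from right to left. *)
Definition leftmost_out (V : finType) (T : framed_map V) (o : rel V) : rel V :=
  [rel v u | first_cw T (orient_map T o) o v u].

Definition rightmost_in (V : finType) (T : framed_map V) (o : rel V) : rel V :=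
  [rel v u | first_cw T (orient_map T o) [rel b a | o a b] v u].

(* The separating path of [v], as the set of its darts, directed from the
   source to the sink. *)
Definition sep_path (V : finType) (T : framed_map V) (o : rel V) (v : V) :
    {set V * V} :=
  [set d | connect (leftmost_out T o) v d.1 && leftmost_out T o d.1 d.2] :|:
  [set d | connect (rightmost_in T o) v d.2 && rightmost_in T o d.2 d.1].

Definition inner_faces (V : finType) (T : framed_map V) (o : rel V) :
    {set {set V * V}} :=
  faces (orient_map T o) :\ outer_darts T.

Definition adjacent_off (V : finType) (T : framed_map V) (o : rel V)
    (P : {set V * V}) : rel {set V * V} :=
  [rel F F' | [&& F \in inner_faces T o, F' \in inner_faces T o
    & [exists d in F, [&& rev_dart d \in F', d \notin P & rev_dart d \notin P]]]].

(* The inner faces on the left of [P] are those that can be reached, without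
   crossing [P] and without leaving the outer contour, from a face bordering
   [P] on its left. *)
Definition faces_left (V : finType) (T : framed_map V) (o : rel V)
    (P : {set V * V}) : {set {set V * V}} :=
  [set F in inner_faces T o |
    [exists d in P, connect (adjacent_off T o P)
                            (face_of (orient_map T o) d) F]].

Definition faces_right (V : finType) (T : framed_map V) (o : rel V)
    (P : {set V * V}) : {set {set V * V}} :=
  [set F in inner_faces T o |
    [exists d in P, connect (adjacent_off T o P)
                            (face_of (orient_map T o) (rev_dart d)) F]].

Definition abscissa (V : finType) (T : framed_map V)
    (X : bicolor_orientation V) (v : V) : nat :=
  #|faces_left T (red_arc T X) (sep_path T (red_arc T X) v)|.

Definition ordinate (V : finType) (T : framed_map V)
    (X : bicolor_orientation V) (v : V) : nat :=
  #|faces_right T (blue_arc T X) (sep_path T (blue_arc T X) v)|.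

(** * Straight-line drawings *)

Definition grid_point (R : realFieldType) (V : finType) (x y : V -> nat)
    (v : V) : R * R := ((x v)%:R, (y v)%:R)%R.

Definition on_segment (R : realFieldType) (p q z : R * R) : Prop :=
  exists2 t : R, (0 <= t <= 1)%R
    & z = ((1 - t) * p.1 + t * q.1, (1 - t) * p.2 + t * q.2)%R.

Definition cross (R : realFieldType) (o p q : R * R) : R :=
  ((p.1 - o.1) * (q.2 - o.2) - (p.2 - o.2) * (q.1 - o.1))%R.

(* The rays from [o] to [a], [b], [c] are distinct and in clockwise cyclic
   order: at most one of the three clockwise angles that they span, whose sum
   is a full turn, can reach a half turn. *)
Definition clockwise_around (R : realFieldType) (o a b c : R * R) : bool :=
  (2 <= (cross o a b < 0)%R + (cross o b c < 0)%R + (cross o c a < 0)%R)%N.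

(* Twice the signed area of a quadrilateral. *)
Definition area2 (R : realFieldType) (a b c d : R * R) : R :=
  let o := (0, 0)%R in
  (cross o a b + cross o b c + cross o c d + cross o d a)%R.

(* The two last clauses state that the drawing is an embedding of the plane
   graph [T] and not just of the underlying graph: the rotation system is that
   of [T], and the face of [T] chosen as outer is the unbounded one (its
   contour, with the face on the left, turns clockwise). *)
Definition straight_line_drawing (R : realFieldType) (V : finType)
    (T : framed_map V) (x y : V -> nat) : Prop :=
  let p := @grid_point R V x y in
  [/\ injective p,
      forall u v w, adj T u v -> on_segment (p u) (p v) (p w) ->
        w = u \/ w = v,
      forall u v u' v' z, adj T u v -> adj T u' v' ->
        on_segment (p u) (p v) z -> on_segment (p u') (p v') z ->
        [set u; v] = [set u'; v'] \/
        exists2 w, w \in [set u; v] :&: [set u'; v'] & z = p w,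
      forall v a b, adj T v a -> adj T v b -> uniq [:: a; cw T v a; b] ->
        clockwise_around (p v) (p a) (p (cw T v a)) (p b)
    & (area2 (p (vN T)) (p (vE T)) (p (vS T)) (p (vW T)) < 0)%R].

(* [w] and [h] are the width and the height of the bounding box, whose lower
   left corner is the origin. *)
Definition grid_size (V : finType) (x y : V -> nat) (w h : nat) : Prop :=
  [/\ forall v, x v <= w /\ y v <= h,
      (exists v, x v = 0) /\ (exists v, x v = w)
    & (exists v, y v = 0) /\ (exists v, y v = h)].

(** * Word RAM

    Random access machine with finitely many named registers and arrays of
    natural numbers, structured control, unit cost per instruction and per
    test.  The parameter [B] of [exec] is the largest value that fits in a
    word: an instruction whose result exceeds [B] has no execution. *)

Inductive cmd : Type :=
| Skip
| Const of nat & nat          (* Const x c     :  x := c       *)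
| Add of nat & nat & nat      (* Add x y z     :  x := y + z   *)
| Sub of nat & nat & nat      (* Sub x y z     :  x := y - z   *)
| Read of nat & nat & nat     (* Read x A y    :  x := A[y]    *)
| Write of nat & nat & nat    (* Write A x y   :  A[x] := y    *)
| Seq of cmd & cmd
| IfLt of nat & nat & cmd & cmd
| WhileLt of nat & nat & cmd.

Record state := State { reg : nat -> nat; arr : nat -> nat -> nat }.

Definition set_reg (s : state) (x a : nat) : state :=
  State (fun y => if y == x then a else reg s y) (arr s).

Definition set_arr (s : state) (A i a : nat) : state :=
  State (reg s)
    (fun A' j => if (A' == A) && (j == i) then a else arr s A' j).

(* [exec B c s t s'] : from [s], [c] terminates in [s'] after [t] steps. *)
Inductive exec (B : nat) : cmd -> state -> nat -> state -> Prop :=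
| exec_skip s : exec B Skip s 1 s
| exec_const s x c : c <= B -> exec B (Const x c) s 1 (set_reg s x c)
| exec_add s x y z : reg s y + reg s z <= B ->
    exec B (Add x y z) s 1 (set_reg s x (reg s y + reg s z))
| exec_sub s x y z : reg s y - reg s z <= B ->
    exec B (Sub x y z) s 1 (set_reg s x (reg s y - reg s z))
| exec_read s x A y : arr s A (reg s y) <= B ->
    exec B (Read x A y) s 1 (set_reg s x (arr s A (reg s y)))
| exec_write s A x y : reg s y <= B ->
    exec B (Write A x y) s 1 (set_arr s A (reg s x) (reg s y))
| exec_seq c1 c2 s s1 s2 t1 t2 : exec B c1 s t1 s1 -> exec B c2 s1 t2 s2 ->
    exec B (Seq c1 c2) s (t1 + t2) s2
| exec_if_true x y c1 c2 s t s' : reg s x < reg s y -> exec B c1 s t s' ->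
    exec B (IfLt x y c1 c2) s t.+1 s'
| exec_if_false x y c1 c2 s t s' : reg s y <= reg s x -> exec B c2 s t s' ->
    exec B (IfLt x y c1 c2) s t.+1 s'
| exec_while_false x y c s : reg s y <= reg s x ->
    exec B (WhileLt x y c) s 1 s
| exec_while_true x y c s s1 s2 t1 t2 : reg s x < reg s y ->
    exec B c s t1 s1 -> exec B (WhileLt x y c) s1 t2 s2 ->
    exec B (WhileLt x y c) s (t1 + t2).+1 s2.

Definition dart_label (V : finType) (X : bicolor_orientation V)
    (d : V * V) : nat :=
  if red X d.1 d.2 then 1 else if blue X d.1 d.2 then 2
  else if red X d.2 d.1 then 3 else if blue X d.2 d.1 then 4 else 0.

(* The input is the half-edge data structure of [T], for arbitrary numberings
   [nv] of the vertices and [nd] of the darts.  Registers 0-5 hold the number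
   of vertices, the number of darts and the numbers of N, E, S, W; arrays 0-3
   give the origin, the opposite, the clockwise successor around the origin and
   the label of each dart.  The rest of the memory is zero. *)
Definition input_state (V : finType) (T : framed_map V)
    (X : bicolor_orientation V) (nv : V -> nat) (nd : V * V -> nat)
    (s : state) : Prop :=
  [/\ [/\ injective nv, forall v, nv v < #|V|,
          {in darts T &, injective nd} & {in darts T, forall d, nd d < #|darts T|}],
      forall i, reg s i =
        nth 0 [:: #|V|; #|darts T|;
                  nv (vN T); nv (vE T); nv (vS T); nv (vW T)] i,
      {in darts T, forall d,
        [/\ arr s 0 (nd d) = nv d.1, arr s 1 (nd d) = nd (rev_dart d),
            arr s 2 (nd d) = nd (d.1, cw T d.1 d.2)
          & arr s 3 (nd d) = dart_label X d]}
    & forall A i, (3 < A) || (#|darts T| <= i) -> arr s A i = 0].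

(* The coordinates of the vertices are returned in arrays 4 and 5. *)
Definition output_state (V : finType) (T : framed_map V)
    (X : bicolor_orientation V) (nv : V -> nat) (s : state) : Prop :=
  forall v, arr s 4 (nv v) = abscissa T X v /\
            arr s 5 (nv v) = ordinate T X v.

Definition transversal_draw_in_linear_time (c : cmd) : Prop :=
  exists K : nat, forall (V : finType) (T : framed_map V)
    (X : bicolor_orientation V) (nv : V -> nat) (nd : V * V -> nat) (s : state),
    irreducible_triangulation T -> transversal_pair T X ->
    input_state T X nv nd s ->
    exists t s', [/\ exec (K * #|V|) c s t s', t <= K * #|V|
                   & output_state T X nv s'].

(* Main.v *)
Require Import Defs.
From mathcomp Require Import all_boot all_order all_algebra.
From mathcomp Require Import zify ring lra.
From Stdlib Require Import FunctionalExtensionality.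

(** Extend the coloring to the outer edges.  Both colors together give every
    edge one of four classes, whose positions around a vertex are prescribed.
    By Euler's formula every circulation on a plane graph is the coboundary of
    a potential on its faces, so that closed walks and separating paths can be
    handled through potentials, without topology.  This gives the acyclicity
    of each color, and expresses the abscissa of [v] as the number of faces on
    which the potential of the separating path of [v] is 1; along an arc
    the potentials of its two ends are comparable, which gives the monotonicity
    of the coordinates.  The faces of the red map are in bijection with their
    sinks, and counting arcs gives the half-perimeter.

    Monotonicity puts each edge in the closed quadrant of its class, so that all
    inner triangles are positively oriented.  Sweeping along a generic line
    through the bounding box, such triangles leave no room for a crossing.

    For the running time, the differences of abscissas along the leftmost
    outgoing arcs are differences of numbers of sinks met by the contour walk
    of the tree of rightmost ingoing arcs; a second walk, around the tree of
    leftmost outgoing arcs, adds them up.  The ordinates are the abscissas of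
    the map obtained by a quarter turn. *)


Set Implicit Arguments.
Unset Strict Implicit.
Unset Printing Implicit Defensive.

Import Order.TTheory GRing.Theory Num.Theory.

(** * Rotation systems *)

(** Being inside a closed walk is never defined geometrically: a function [g u v] that is constant
    along faces is read as a value on the face to the left of the dart [(u, v)], and a set of faces
    is such a function with boolean values. Acyclicity is an infinite descent on such sets. A closed
    monochromatic walk encloses faces, and from every vertex that they touch an edge of a
    neighbouring class runs through the interior; following these edges gives a closed walk of
    another class, which encloses strictly fewer faces. Genus 0 is given for the triangulation, not
    for the red map; potentials for the latter are therefore built on the triangulation and required
    not to jump across blue edges, and the faces of the red map are handled through [well_rotated].
    The orientation of the triangles is arithmetic modulo 4: reversing an edge adds 2 to its class
    and turning at an inner corner adds 0 or 1, so that exactly two corners of a triangle change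
    class, and each of them makes a strict turn. *)

Definition well_rotated (V : finType) (M : rmap V) : Prop :=
  [/\ symmetric (adj M), forall v u, adj M v u -> adj M v (cw M v u)
    & forall v u w, adj M v u -> adj M v w -> cw M v u = cw M v w -> u = w].

Section Rotation.

Variables (V : finType) (M : rmap V).
Hypothesis wfM : well_rotated M.

Lemma darts_rev (d : V * V) : (rev_dart d \in darts M) = (d \in darts M).
Proof. by case: wfM => adjC _ _; rewrite !inE /= adjC. Qed.

Lemma face_next_darts : {homo face_next M : d / d \in darts M}.
Proof. by case: wfM => adjC cwA _ [u v]; rewrite !inE /= adjC => /cwA. Qed.

Lemma face_next_inj : {in darts M &, injective (face_next M)}.
Proof.
case: wfM => adjC _ cwI [u v] [u' v']; rewrite !inE /= adjC => uv.
by rewrite adjC => uv' [e]; subst v' => /(cwI _ _ _ uv uv') ->.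
Qed.

Lemma mem_face_of (d : V * V) : d \in face_of M d.
Proof. by rewrite inE connect0. Qed.

Lemma fconnect_darts d d' : d \in darts M -> fconnect (face_next M) d d' ->
  d' \in darts M.
Proof.
move=> dM /iter_findex <-; elim: (findex _ _ _) => //= n IH.
exact: face_next_darts.
Qed.

Lemma face_of_darts d d' : d \in darts M -> d' \in face_of M d -> d' \in darts M.
Proof. by move=> dM; rewrite inE; apply: fconnect_darts. Qed.

Lemma face_of_eq d d' : d \in darts M -> d' \in face_of M d ->
  face_of M d' = face_of M d.
Proof.
move=> dM d'F; have d'M := face_of_darts dM d'F.
move: d'F; rewrite inE => dd'; apply/setP=> d''; rewrite !inE.
apply/idP/idP=> [|dd'']; first exact: connect_trans.
apply: connect_trans dd''.
by rewrite (fconnect_sym_in face_next_darts face_next_inj).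
Qed.

Lemma face_of_next d : d \in darts M -> face_of M (face_next M d) = face_of M d.
Proof. by move=> dM; apply: face_of_eq => //; rewrite inE fconnect1. Qed.

Lemma mem_faces d : d \in darts M -> face_of M d \in faces M.
Proof. by move=> dM; apply: imset_f. Qed.

Lemma face_of_mem F d : F \in faces M -> d \in F ->
  d \in darts M /\ F = face_of M d.
Proof.
move=> /imsetP[d0 d0M ->] dF; split; first exact: face_of_darts dF.
by rewrite (face_of_eq d0M dF).
Qed.

Lemma face_constant (A : Type) (g : V -> V -> A) :
    (forall u v, adj M u v -> g v (cw M v u) = g u v) ->
  forall d d', d \in darts M -> d' \in face_of M d -> g d'.1 d'.2 = g d.1 d.2.
Proof.
move=> gI d d' dM; rewrite inE => /iter_findex <-.
elim: (findex _ _ _) => //= n IH; rewrite gI //.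
suff: iter n (face_next M) d \in darts M by rewrite inE.
elim: n {IH} => //= n; exact: face_next_darts.
Qed.

Lemma bij_face_next (R : nmodType) (q : V * V -> R) :
  (\sum_(d in darts M) q (face_next M d) = \sum_(d in darts M) q d)%R.
Proof.
have im : face_next M @: darts M = darts M.
  apply/eqP; rewrite eqEcard card_in_imset ?leqnn ?andbT; last exact: face_next_inj.
  by apply/subsetP=> _ /imsetP[d dM ->]; apply: face_next_darts.
rewrite -[in RHS]im big_imset //; exact: face_next_inj.
Qed.

Lemma sum_card_faces : \sum_(F in faces M) #|F| = #|darts M|.
Proof.
have tI : trivIset (faces M).
  apply/trivIsetP=> A B AF BF; apply: contraNT => /pred0Pn[d /andP[dA dB]].
  by have [_ ->] := face_of_mem AF dA; have [_ <-] := face_of_mem BF dB.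
rewrite (eqP tI); apply: eq_card => d; apply/bigcupP/idP=> [[F FF dF]|dM].
  by have [] := face_of_mem FF dF.
by exists (face_of M d); [apply: mem_faces | apply: mem_face_of].
Qed.

End Rotation.

Section PlaneGraph.

Variables (V : finType) (M : rmap V).
Hypothesis plM : plane_graph M.

Lemma plane_adjC : symmetric (adj M). Proof. by case: plM => -[]. Qed.
Lemma plane_adjI : irreflexive (adj M). Proof. by case: plM => -[]. Qed.

Lemma plane_cwP v u w : adj M v u -> fconnect (cw M v) u w = adj M v w.
Proof. by case: plM => _ cwP _ _; apply: cwP. Qed.

Lemma plane_cw_adj v u : adj M v u -> adj M v (cw M v u).
Proof. by move=> vu; rewrite -(plane_cwP _ vu) fconnect1. Qed.

(** The rotation is onto: going round from [cw M v a] leads back to [a], so that the neighbour just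
    before [a] is a preimage of it. On a finite set this implies injectivity. *)
Lemma plane_cw_inj v u w : adj M v u -> adj M v w -> cw M v u = cw M v w -> u = w.
Proof.
pose A := [set u | adj M v u]; have imA : cw M v @: A = A.
  apply/setP=> a; apply/imsetP/idP=> [[b]|].
    by rewrite !inE => /plane_cw_adj vb ->.
  rewrite inE => va; have /iter_findex : fconnect (cw M v) (cw M v a) a.
    by rewrite plane_cwP // plane_cw_adj.
  set n := findex _ _ _ => e; exists (iter n (cw M v) a).
    by rewrite inE -(plane_cwP _ va) fconnect_iter.
  by rewrite -iterS iterSr.
have /imset_injP injA : #|cw M v @: A| == #|A| by rewrite imA.
by move=> vu vw; apply: injA; rewrite inE.
Qed.

Lemma plane_well_rotated : well_rotated M.
Proof.
split; [exact: plane_adjC | exact: plane_cw_adj | exact: plane_cw_inj].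
Qed.

Lemma plane_rotation_constant (A : Type) (v : V) (g : V -> A) :
    (forall a, adj M v a -> g (cw M v a) = g a) ->
  forall a b, adj M v a -> adj M v b -> g a = g b.
Proof.
move=> gI a b va; rewrite -(plane_cwP _ va) => /iter_findex <-.
elim: (findex _ _ _) => //= n ->; rewrite gI //.
by rewrite -(plane_cwP _ va) fconnect_iter.
Qed.

(** The dual graph is connected because the primal one is: turning around a vertex crosses its edges
    one by one, and each edge leads to the next vertex. A potential without jumps is thus
    constant. *)
Lemma plane_dual_connected (A : Type) (g : V -> V -> A) :
    (forall u v, adj M u v -> g v (cw M v u) = g u v) ->
    (forall u v, adj M u v -> g u v = g v u) ->
  forall u v u' v', adj M u v -> adj M u' v' -> g u v = g u' v'.
Proof.
move=> gI gC u v u' v' uv; have [_ _ conn _] := plM.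
have rot w a b : adj M w a -> adj M w b -> g w a = g w b.
  apply: (plane_rotation_constant (g := g w)) => c wc.
  have cw : adj M c w by rewrite plane_adjC.
  by rewrite (gI _ _ cw) (gC _ _ cw).
have /connectP[p pth ->] := conn u u'.
elim: p u v uv pth => [|w p IH] u v uv /=; first by move=> _; apply: rot.
move=> /andP[uw wp]; rewrite (rot _ _ _ uv uw) (gC _ _ uw).
by apply: IH; rewrite // plane_adjC.
Qed.

(** * Circulations on a plane graph *)

Local Open Scope ring_scope.

(** One dart per edge, the one that goes up in the enumeration of the vertices; it fixes the sign of
    the column of the edge in the two matrices below. *)
Let ori := [set d in darts M | (enum_rank d.1 < enum_rank d.2)%N].

Let sum_ori (R : nmodType) (q : V * V -> R) :
  \sum_(d in ori) (q d + q (rev_dart d)) = \sum_(d in darts M) q d.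
Proof.
rewrite [RHS](bigID (fun d : V * V => enum_rank d.1 < enum_rank d.2)%N) /=.
rewrite big_split /=; congr (_ + _); first by apply: eq_bigl => d; rewrite inE.
have revI : {in ori &, injective (@rev_dart V)}.
  by move=> [a b] [c d] _ _ [-> ->].
rewrite -(big_imset _ revI); apply: eq_bigl => -[u v].
apply/imsetP/andP=> [[[a b]]|[uv]]; rewrite ?inE /=.
  move=> /andP[ab lt] [-> ->]; rewrite plane_adjC; split=> //.
  by rewrite -leqNgt ltnW.
rewrite -leqNgt leq_eqVlt => /orP[/eqP e|lt].
  have /enum_rank_inj e' : enum_rank v = enum_rank u by apply: val_inj.
  by move: uv; rewrite e' inE /= plane_adjI.
by exists (v, u) => //; rewrite !inE /= lt plane_adjC andbT; move: uv; rewrite inE.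
Qed.

Let card_ori : (#|darts M| = 2 * #|ori|)%N.
Proof.
rewrite -sum1_card -(sum_ori (fun=> 1%N : nat)) -sum1_card big_distrr /=.
by apply: eq_bigr.
Qed.

Let nV := #|V|.
Let nF := #|faces M|.
Let m := #|ori|.

Let dart (j : 'I_m) : V * V := enum_val j.
(** [inc] is the signed vertex-edge incidence matrix and [bnd] the signed face-edge one, the face on
    the left of the chosen dart counting positively: up to transposition, the two boundary maps of
    the cell complex. *)
Let inc : 'M[rat]_(nV, m) :=
  \matrix_(i, j) (((dart j).2 == enum_val i)%:R - ((dart j).1 == enum_val i)%:R).
Let bnd : 'M[rat]_(nF, m) :=
  \matrix_(i, j) ((face_of M (dart j) == enum_val i)%:R -
                  (face_of M (rev_dart (dart j)) == enum_val i)%:R).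

Let sum_dart (R : nmodType) (q : V * V -> R) :
  \sum_(j < m) q (dart j) = \sum_(d in ori) q d.
Proof. by rewrite [RHS]big_enum_val. Qed.

Let edge_dart u v : adj M u v ->
  exists j, dart j = (u, v) \/ dart j = (v, u).
Proof.
move=> uv; have [lt|] := boolP (enum_rank u < enum_rank v)%N.
  have h : (u, v) \in ori by rewrite !inE /= uv lt.
  by exists (enum_rank_in h (u, v)); left; rewrite /dart enum_rankK_in.
rewrite -leqNgt leq_eqVlt => /orP[/eqP e|lt].
  have /enum_rank_inj e' : enum_rank v = enum_rank u by apply: val_inj.
  by move: uv; rewrite e' plane_adjI.
have h : (v, u) \in ori by rewrite !inE /= plane_adjC uv lt.
by exists (enum_rank_in h (v, u)); right; rewrite /dart enum_rankK_in.
Qed.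

(** The boundary of a boundary vanishes: a dart of a face that ends at [v] is followed on that face
    by a dart that starts at [v], and [face_next] permutes the darts. *)
Let bnd_inc : bnd *m inc^T = 0.
Proof.
apply/matrixP=> i k; rewrite !mxE.
pose F := enum_val i; pose v := enum_val k.
pose a (d : V * V) : rat := (face_of M d == F)%:R.
pose b (d : V * V) : rat := (d.1 == v)%:R.
pose q d := a d * (b (rev_dart d) - b d).
transitivity (\sum_(d in ori) (q d + q (rev_dart d))).
  rewrite -sum_dart; apply: eq_bigr => j _; rewrite !mxE /q /b /a -/F -/v.
  have -> : rev_dart (rev_dart (dart j)) = dart j by case: (dart j).
  by rewrite /rev_dart /=; ring.
rewrite sum_ori /q; under eq_bigr do rewrite mulrBr; rewrite sumrB.
apply/eqP; rewrite subr_eq0; apply/eqP.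
rewrite -[RHS](bij_face_next plane_well_rotated).
apply: eq_bigr => d dM; rewrite /a /b /=.
by rewrite (face_of_next plane_well_rotated).
Qed.

(** Connectedness enters as a bound on the rank: a left kernel made of constant vectors has
    dimension at most 1. *)
Let ker_rank1 p (A : 'M[rat]_(p, m)) (r : 'rV[rat]_p) :
    (forall q : 'rV_p, q *m A = 0 -> forall i j, q 0 i = q 0 j) ->
  (p - 1 <= \rank A)%N.
Proof.
move=> cst; have : (\rank (kermx A) <= 1)%N.
  case: (posnP p) => [p0|p0].
    by apply: leq_trans (rank_leq_row _) _; rewrite p0.
  apply: leq_trans (rank_leq_row (const_mx 1 : 'rV[rat]_p)).
  apply: mxrankS; apply/row_subP=> i.
  have /cst h : row i (kermx A) *m A = 0 by rewrite -row_mul mulmx_ker row0.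
  have i0 := Ordinal p0.
  have -> : row i (kermx A) = (row i (kermx A)) 0 i0 *: const_mx 1.
    by apply/rowP=> j; rewrite [RHS]mxE [X in _ * X]mxE mulr1; apply: h.
  exact: scalemx_sub.
by rewrite mxrank_ker; lia.
Qed.

Let rank_inc : (nV - 1 <= \rank inc)%N.
Proof.
apply: ker_rank1 => [|q q0 i j]; first exact: 0.
have step u v : adj M u v -> q 0 (enum_rank u) = q 0 (enum_rank v).
  have sum_q w : \sum_k q 0 k * (w == enum_val k)%:R = q 0 (enum_rank w).
    rewrite (bigD1 (enum_rank w)) //= enum_rankK eqxx mulr1 big1 ?addr0 //.
    move=> k; case: (w =P enum_val k) => [->|_ _]; last by rewrite mulr0.
    by rewrite enum_valK eqxx.
  move=> /edge_dart[l dl]; have := congr1 (fun z : 'rV_m => z 0 l) q0.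
  rewrite !mxE; under eq_bigr do rewrite mxE mulrBr; rewrite sumrB !sum_q.
  by move/eqP; rewrite subr_eq0 => /eqP; case: dl => ->.
have [_ _ conn _] := plM.
have cst u v : q 0 (enum_rank u) = q 0 (enum_rank v).
  have /connectP[p pth ->] := conn u v.
  elim: p u pth => //= w p IH u /andP[uw wp]; rewrite (step _ _ uw); exact: IH.
by rewrite -[i]enum_valK -[j]enum_valK.
Qed.

Let sum_face (q : 'rV[rat]_nF) d : d \in darts M ->
  exists2 k : 'I_nF, enum_val k = face_of M d &
    \sum_i q 0 i * (face_of M d == enum_val i)%:R = q 0 k.
Proof.
move=> dM; have FF : face_of M d \in faces M by apply: mem_faces.
move: (face_of M d) FF => F FF; pose k := enum_rank_in FF F.
have kF : enum_val k = F by rewrite enum_rankK_in.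
exists k => //; rewrite (bigD1 k) //= kF eqxx mulr1 big1 ?addr0 // => i.
case: (F =P enum_val i) => [e|_ _]; last by rewrite mulr0.
by move: kF; rewrite e => /enum_val_inj <-; rewrite eqxx.
Qed.

Let potential (q : 'rV[rat]_nF) (u v : V) : rat :=
  \sum_i q 0 i * (face_of M (u, v) == enum_val i)%:R.

Let potential_face q u v : adj M u v -> potential q v (cw M v u) = potential q u v.
Proof.
move=> uv; rewrite /potential.
have -> : face_of M (v, cw M v u) = face_of M (face_next M (u, v)) by [].
by rewrite (face_of_next plane_well_rotated) // inE.
Qed.

Let potential_bnd q j : (q *m bnd) 0 j =
  potential q (dart j).1 (dart j).2 - potential q (dart j).2 (dart j).1.
Proof.
rewrite mxE /potential -sumrB; apply: eq_bigr => i _.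
by rewrite mxE mulrBr -surjective_pairing.
Qed.

Let rank_bnd : (nF - 1 <= \rank bnd)%N.
Proof.
apply: ker_rank1 => [|q q0 i j]; first exact: 0.
have qC u v : adj M u v -> potential q u v = potential q v u.
  move=> /edge_dart[l dl]; have := congr1 (fun z : 'rV_m => z 0 l) q0.
  rewrite potential_bnd [RHS]mxE => /eqP; rewrite subr_eq0 => /eqP.
  by case: dl => ->.
have cst := plane_dual_connected (@potential_face q) qC.
have val (k : 'I_nF) : exists u v, adj M u v /\ q 0 k = potential q u v.
  have /imsetP[[u v] dM e] := enum_valP k; exists u, v; split.
    by move: dM; rewrite inE.
  have [k' ek'] := sum_face q dM; rewrite /potential => ->; congr (q 0 _).
  by apply: enum_val_inj; rewrite e ek'.
have [u [v [uv ->]]] := val i; have [u' [v' [uv' ->]]] := val j.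
exact: cst.
Qed.

(* The boundaries of faces span the circulations, since by Euler's formula the
   two spaces have the same dimension. *)
Lemma circulation_potential (phi : V -> V -> rat) :
    (forall u v, phi v u = - phi u v) ->
    (forall u v, ~~ adj M u v -> phi u v = 0) ->
    (forall v, \sum_u phi v u = 0) ->
  exists g : V -> V -> rat,
    (forall u v, adj M u v -> g v (cw M v u) = g u v) /\
    (forall u v, adj M u v -> g u v - g v u = phi u v).
Proof.
move=> phiN phi0 phiD.
pose f : 'rV[rat]_m := \row_j phi (dart j).1 (dart j).2.
have f_ker : (f <= kermx inc^T)%MS.
  apply/sub_kermxP/rowP=> k; rewrite !mxE; pose v := enum_val k.
  pose q (d : V * V) := - phi d.1 d.2 * (d.1 == v)%:R.
  transitivity (\sum_(d in ori) (q d + q (rev_dart d))).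
    rewrite -sum_dart; apply: eq_bigr => j _; rewrite !mxE /q /= -/v.
    by rewrite (phiN (dart j).1); ring.
  rewrite sum_ori /q (eq_bigl (fun d => adj M d.1 d.2)); last by move=> d; rewrite inE.
  rewrite -(pair_big_dep xpredT (adj M) (fun u w => - phi u w * (u == v)%:R)) /=.
  rewrite (bigD1 v) //= [X in _ + X]big1 ?addr0; last first.
    by move=> u /negPf uv; rewrite big1 // => w _; rewrite uv mulr0.
  rewrite -[RHS]oppr0 -[in RHS](phiD v) [in RHS](bigID (adj M v)) /= addrC.
  rewrite [X in - (X + _)]big1 ?add0r; last by move=> u; apply: phi0.
  by rewrite -sumrN; apply: eq_bigr => w _; rewrite eqxx mulr1.
have bnd_ker : (bnd <= kermx inc^T)%MS by apply/sub_kermxP; exact: bnd_inc.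
have [_ _ _ euler] := plM.
have ker_bnd : (kermx inc^T <= bnd)%MS.
  rewrite -(geq_leqif (mxrank_leqif_sup bnd_ker)) mxrank_ker mxrank_tr.
  have := rank_inc; have := rank_bnd; have := card_ori.
  by move: euler; rewrite -/nV -/nF -/m; lia.
have /submxP[q fq] := submx_trans f_ker ker_bnd.
exists (potential q); split=> [u v|u v uv]; first exact: potential_face.
have [j [e|e]] := edge_dart uv; have := potential_bnd q j;
  rewrite -fq mxE e /= => h; first by rewrite h.
by rewrite phiN h opprB.
Qed.

End PlaneGraph.

(** * Residues modulo 4, monotone predicates along a rotation, flows of walks *)

Lemma mod4_shift k i : k < 4 -> 0 < i < 4 -> ((k + i) %% 4 == k) = false.
Proof. lia. Qed.

Lemma mod4_inj k i j : i < 4 -> j < 4 -> ((k + i) %% 4 == (k + j) %% 4) = (i == j).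
Proof. lia. Qed.

Lemma mod4_add k i j : ((k + i) %% 4 + j) %% 4 = (k + (i + j)) %% 4.
Proof. by rewrite modnDml addnA. Qed.

Section FpathMonotone.

Variables (V : eqType) (c : V -> V) (h : pred V).

(** Applied to the faces of a region met around a vertex: along an interval where the region cannot
    be left, membership propagates clockwise; along one where it cannot be entered, it propagates
    backwards. *)
Lemma fpath_fwd x p : fpath c x p -> {in x :: p, forall a, h a -> h (c a)} ->
  forall a, a \in x :: p -> h a -> h (c (last x p)).
Proof.
elim: p x => [|y p IH] x /=.
  by move=> _ hI a; rewrite inE => /eqP -> hx; apply: hI => //; apply: mem_head.
move=> /andP[/eqP xy yp] hI a.
have hI' : {in y :: p, forall a, h a -> h (c a)}.
  by move=> b yb; apply: hI; rewrite inE yb orbT.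
rewrite inE => /orP[/eqP -> hx|ya ha]; last exact: IH ha.
by apply: (IH _ yp hI' y); rewrite ?mem_head // -xy hI // mem_head.
Qed.

Lemma fpath_fwd_all x p : fpath c x p ->
  {in x :: p, forall a, h a -> h (c a)} -> h x -> all h (x :: p).
Proof.
elim: p x => [|y p IH] x /=; first by rewrite andbT.
move=> /andP[/eqP xy yp] hI hx; rewrite hx /=; apply: IH => //.
  by move=> b yb; apply: hI; rewrite inE yb orbT.
by rewrite -xy hI // mem_head.
Qed.

Lemma fpath_bwd x p : fpath c x p -> {in x :: p, forall a, h (c a) -> h a} ->
  forall a, a \in x :: p -> h a -> h x.
Proof.
elim: p x => [|y p IH] x /=; first by move=> _ _ a; rewrite inE => /eqP ->.
move=> /andP[/eqP xy yp] hI a.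
have hI' : {in y :: p, forall a, h (c a) -> h a}.
  by move=> b yb; apply: hI; rewrite inE yb orbT.
rewrite inE => /orP[/eqP -> //|ya ha]; apply: hI; first exact: mem_head.
by rewrite xy; apply: IH ha.
Qed.

Lemma fpath_bwd_all x p : fpath c x p ->
  {in x :: p, forall a, h (c a) -> h a} -> h (c (last x p)) -> all h (x :: p).
Proof.
elim: p x => [|y p IH] x /=; first by rewrite andbT => _ hI; apply: hI; apply: mem_head.
move=> /andP[/eqP xy yp] hI hl.
have /= : all h (y :: p).
  by apply: IH => // b yb; apply: hI; rewrite inE yb orbT.
move=> hyp; rewrite hyp andbT; apply: hI; rewrite ?mem_head // xy.
by case/andP: hyp.
Qed.

End FpathMonotone.

(* Closed walks are represented as [l a, ..., l b] with [l a = l b]. *)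
Section WalkFlow.

Variables (V : finType) (l : nat -> V).
Local Open Scope ring_scope.

Definition walk_count (a b : nat) (u v : V) : rat :=
  \sum_(a <= t < b) ((l t == u) && (l t.+1 == v))%:R.

Definition walk_flow (a b : nat) (u v : V) : rat :=
  walk_count a b u v - walk_count a b v u.

Lemma walk_count_ge0 a b u v : 0 <= walk_count a b u v.
Proof. by apply: sumr_ge0 => t _; case: (_ && _). Qed.

Lemma walk_count_ge1 a b t : (a <= t < b)%N -> 1 <= walk_count a b (l t) (l t.+1).
Proof.
move=> tab; rewrite /walk_count (bigD1_seq t) /=; last exact: iota_uniq.
  by rewrite !eqxx /= lerDl; apply: sumr_ge0 => i _; case: (_ && _).
by rewrite mem_index_iota.
Qed.

Lemma walk_count_neq0 a b u v : walk_count a b u v != 0 ->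
  exists2 t, (a <= t < b)%N & u = l t /\ v = l t.+1.
Proof.
move=> nz; have [/hasP[t]|/hasPn no] :=
    boolP (has (fun t => (l t == u) && (l t.+1 == v)) (index_iota a b)).
  by rewrite mem_index_iota => tab /andP[/eqP <- /eqP <-]; exists t.
case/eqP: nz; rewrite /walk_count big_seq big1 // => t /no.
by case: (_ && _).
Qed.

Lemma walk_flowN a b u v : walk_flow a b v u = - walk_flow a b u v.
Proof. by rewrite /walk_flow opprB. Qed.

(** The sum telescopes along the walk. It vanishes for a closed walk, whose flow is therefore a
    circulation. *)
Lemma walk_flow_div a b u : (a <= b)%N ->
  \sum_v walk_flow a b u v = (l a == u)%:R - (l b == u)%:R.
Proof.
move=> ab; rewrite /walk_flow sumrB /walk_count.
rewrite exchange_big /= [X in _ - X]exchange_big /= -sumrB.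
rewrite -[RHS]opprB -(telescope_sumr (fun t => (l t == u)%:R) ab) -sumrN.
apply: eq_bigr => t _; rewrite opprB; congr (_ - _).
  rewrite (bigD1 (l t.+1)) //= eqxx andbT big1 ?addr0 // => v.
  by rewrite eq_sym => /negPf ->; rewrite andbF.
rewrite (bigD1 (l t)) //= eqxx /= big1 ?addr0 // => v.
by rewrite eq_sym => /negPf ->.
Qed.

End WalkFlow.

(** * Local structure of a transversal pair *)

Section Transversal.

Variables (V : finType) (T : framed_map V) (X : bicolor_orientation V).
Hypotheses (HT : irreducible_triangulation T) (HX : transversal_pair T X).

Local Notation N := (vN T).
Local Notation E := (vE T).
Local Notation S := (vS T).
Local Notation W := (vW T).
Local Notation cT := (cw (fmap T)).
Local Notation aT := (adj (fmap T)).

Lemma triangulation_plane : plane_graph T. Proof. by case: HT. Qed.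
Let plT := triangulation_plane.
Let wfT := plane_well_rotated plT.
Let aC := plane_adjC plT.

Lemma outer_neq : [&& N != E, N != S, N != W, E != S, E != W & S != W].
Proof.
case: HT => _ [U _ _] _ _; move: U; rewrite /= !inE !negb_or !andbT.
by move=> /andP[/and3P[-> -> ->] /andP[/andP[-> ->] ->]].
Qed.

Let neqs : ((N == E) = false) * ((N == S) = false) * ((N == W) = false) *
  ((E == S) = false) * ((E == W) = false) * ((S == W) = false) *
  ((E == N) = false) * ((S == N) = false) * ((W == N) = false) *
  ((S == E) = false) * ((W == E) = false) * ((W == S) = false).
Proof.
have /and5P[/negPf NE /negPf NS /negPf NW /negPf ES /andP[/negPf EW /negPf SW]] :=
  outer_neq.
rewrite NE NS NW ES EW SW (eq_sym E N) (eq_sym S N) (eq_sym W N) (eq_sym S E).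
by rewrite (eq_sym W E) (eq_sym W S) NE NS NW ES EW SW.
Qed.

Definition outer_neqs := neqs.

Lemma outer_face : face_of T (N, E) = outer_darts T.
Proof. by case: HT => _ []. Qed.

Lemma outer_darts_adj d : d \in outer_darts T -> aT d.1 d.2.
Proof.
have [_ [_ NE _] _ _] := HT; rewrite -outer_face => dF.
suff : d \in darts T by rewrite inE.
by apply: face_of_darts dF => //; rewrite inE.
Qed.

Lemma outer_cw : [/\ cT E N = S, cT S E = W, cT W S = N & cT N W = E].
Proof.
have nx d : d \in outer_darts T -> face_next T d \in outer_darts T.
  rewrite -outer_face !inE => dF; exact: connect_trans dF (fconnect1 _ _).
have h d : d \in outer_darts T -> (d.2, cT d.2 d.1) \in outer_darts T by exact: nx.
split.
- have := h (N, E); rewrite /outer_darts !inE /= !xpair_eqE !eqxx !neqs /=.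
  by rewrite ?andbF ?orbF /= => /(_ isT)/eqP.
- have := h (E, S); rewrite /outer_darts !inE /= !xpair_eqE !eqxx !neqs /=.
  by rewrite ?andbF ?orbF /= => /(_ isT)/eqP.
- have := h (S, W); rewrite /outer_darts !inE /= !xpair_eqE !eqxx !neqs /=.
  by rewrite ?andbF ?orbF /= => /(_ isT)/eqP.
- have := h (W, N); rewrite /outer_darts !inE /= !xpair_eqE !eqxx !neqs /=.
  by rewrite ?andbF ?orbF /= => /(_ isT)/eqP.
Qed.

Lemma outer_dart_mem : [/\ (N, E) \in outer_darts T, (E, S) \in outer_darts T,
  (S, W) \in outer_darts T & (W, N) \in outer_darts T].
Proof. by rewrite /outer_darts !inE !eqxx !orbT. Qed.

Lemma adj_outer : [/\ aT N E, aT E S, aT S W & aT W N] /\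
  [/\ aT E N, aT S E, aT W S & aT N W].
Proof.
have [/outer_darts_adj /= hN /outer_darts_adj /= hE] := outer_dart_mem.
move=> /outer_darts_adj /= hS /outer_darts_adj /= hW.
by rewrite (aC E N) (aC S E) (aC W S) (aC N W) hN hE hS hW.
Qed.

(* Every edge receives one color and one direction: the outer edges are red on
   the vertical sides of the bounding box and blue on the horizontal ones. *)
Definition rd (u v : V) : bool :=
  red X u v || ((u, v) \in [:: (S, W); (E, N)]).
Definition bl (u v : V) : bool :=
  blue X u v || ((u, v) \in [:: (W, N); (S, E)]).

(** The numbering follows the clockwise order of the four intervals: turning to the next neighbour
    adds 0 or 1, and reversing a dart adds 2, modulo 4. The last value means ingoing blue, for
    adjacent vertices. *)
Definition cls (u v : V) : nat :=
  if rd u v then 0 else if bl u v then 1 else if rd v u then 2 else 3.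

Lemma cls_lt u v : cls u v < 4.
Proof. by rewrite /cls; case: ifP => // _; case: ifP => // _; case: ifP. Qed.

Lemma inner_edge_arc u v : inner_edge T u v ->
  [/\ rd u v = red X u v, bl u v = blue X u v, rd v u = red X v u
    & bl v u = blue X v u].
Proof.
rewrite /inner_edge /outer_edge /= negb_or => /andP[_ /andP[]].
rewrite /outer_darts !inE !negb_or /rd /bl !inE.
rewrite -!andbA !xpair_eqE => /and4P[/negPf a1 /negPf a2 /negPf a3 /negPf a4].
move=> /and4P[/negPf b1 /negPf b2 /negPf b3 /negPf b4].
have {}b1 : (u == E) && (v == N) = false by rewrite andbC.
have {}b2 : (u == S) && (v == E) = false by rewrite andbC.
have {}b3 : (u == W) && (v == S) = false by rewrite andbC.
have {}b4 : (u == N) && (v == W) = false by rewrite andbC.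
have c1 : (v == E) && (u == N) = false by rewrite andbC.
have c2 : (v == S) && (u == E) = false by rewrite andbC.
have c3 : (v == W) && (u == S) = false by rewrite andbC.
have c4 : (v == N) && (u == W) = false by rewrite andbC.
have d1 : (v == E) && (u == S) = false by rewrite andbC.
have d2 : (v == S) && (u == W) = false by rewrite andbC.
have d3 : (v == W) && (u == N) = false by rewrite andbC.
have d4 : (v == N) && (u == E) = false by rewrite andbC.
by rewrite ?a1 ?a2 ?a3 ?a4 ?b1 ?b2 ?b3 ?b4 ?c1 ?c2 ?c3 ?c4 ?d1 ?d2 ?d3 ?d4 !orbF.
Qed.

Lemma colored_inner u v : red X u v || blue X u v -> inner_edge T u v.
Proof. by case: HX => + _ _ _; apply. Qed.

Lemma inner_edgeC u v : inner_edge T u v = inner_edge T v u.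
Proof. by rewrite /inner_edge /outer_edge /= aC orbC. Qed.

Lemma outer_colorless u v : outer_edge T u v ->
  [/\ red X u v = false, blue X u v = false, red X v u = false
    & blue X v u = false].
Proof.
move=> o; have i : ~~ inner_edge T u v by rewrite /inner_edge /= o andbF.
split; apply: contraNF i => h; [| |rewrite inner_edgeC..];
  by apply: colored_inner; rewrite h ?orbT.
Qed.

Lemma outer_edgeP u v : outer_edge T u v ->
  (u, v) \in [:: (N, E); (E, S); (S, W); (W, N); (E, N); (S, E); (W, S); (N, W)].
Proof.
rewrite /outer_edge /= /outer_darts !inE !xpair_eqE.
rewrite (andbC (v == N)) (andbC (v == E)) (andbC (v == S)) (andbC (v == W)).
by rewrite -!orbA.
Qed.

Lemma arc_unique u v : aT u v -> rd u v + bl u v + rd v u + bl v u = 1.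
Proof.
move=> uv; have [/[dup]o /outer_edgeP h|o] := boolP (outer_edge T u v); last first.
  have i : inner_edge T u v by rewrite /inner_edge /= uv.
  have [-> -> -> ->] := inner_edge_arc i.
  by case: HX => _ h _ _; rewrite -(h _ _ i); lia.
have [r1 r2 r3 r4] := outer_colorless o.
rewrite /rd /bl r1 r2 r3 r4 /= {o r1 r2 r3 r4 uv}.
move: h; rewrite !inE !xpair_eqE.
by do 7?[case/orP]; move=> /andP[/eqP -> /eqP ->]; rewrite !eqxx !neqs.
Qed.

Lemma arc_adj u v : rd u v || bl u v -> aT u v.
Proof.
have [[a1 a2 a3 a4] [b1 b2 b3 b4]] := adj_outer.
rewrite /rd /bl !inE !xpair_eqE => /orP[/orP[r|]|/orP[b|]].
- by have /colored_inner/andP[] : red X u v || blue X u v by rewrite r.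
- by case/orP=> /andP[/eqP -> /eqP ->].
- by have /colored_inner/andP[] : red X u v || blue X u v by rewrite b orbT.
- by case/orP=> /andP[/eqP -> /eqP ->].
Qed.

Lemma rdE u v : aT u v -> rd u v = (cls u v == 0).
Proof.
move=> /arc_unique; rewrite /cls.
by case: (rd u v) => //; case: (bl u v) => //; case: (rd v u).
Qed.
Lemma blE u v : aT u v -> bl u v = (cls u v == 1).
Proof.
move=> /arc_unique; rewrite /cls.
by case: (rd u v) => //; case: (bl u v) => //; case: (rd v u).
Qed.
Lemma cls_rev u v : aT u v -> cls v u = (cls u v + 2) %% 4.
Proof.
move=> /arc_unique; rewrite /cls.
by case: (rd u v) => //; case: (bl u v) => //; case: (rd v u) => //; case: (bl v u).
Qed.
Lemma cls_rd u v : rd u v -> cls u v = 0.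
Proof. by rewrite /cls => ->. Qed.
Lemma cls_bl u v : bl u v -> cls u v = 1.
Proof.
move=> b; have uv : aT u v by apply: arc_adj; rewrite b orbT.
by apply/eqP; rewrite -blE.
Qed.
Lemma cls_rd_in u v : rd v u -> cls u v = 2.
Proof.
move=> r; have vu : aT v u by apply: arc_adj; rewrite r.
by rewrite (cls_rev vu) cls_rd.
Qed.
Lemma cls_bl_in u v : bl v u -> cls u v = 3.
Proof.
move=> r; have vu : aT v u by apply: arc_adj; rewrite r orbT.
by rewrite (cls_rev vu) cls_bl.
Qed.

Lemma outer_edge_at v a : aT v a ->
  inner_edge T v a \/
  [\/ v = N /\ (a = E \/ a = W), v = E /\ (a = N \/ a = S),
      v = S /\ (a = E \/ a = W) | v = W /\ (a = N \/ a = S)].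
Proof.
move=> va; have [/outer_edgeP|o] := boolP (outer_edge T v a); last first.
  by left; rewrite /inner_edge /= va.
rewrite !inE !xpair_eqE => h; right; move: h.
by do 7?[case/orP]; move=> /andP[/eqP -> /eqP ->];
  [constructor 1; auto | constructor 2; auto | constructor 3; auto
  | constructor 4; auto | constructor 2; auto | constructor 3; auto
  | constructor 4; auto | constructor 1; auto].
Qed.

Lemma outer_arcs : [/\ rd S W, rd E N, bl W N & bl S E].
Proof. by rewrite /rd /bl !inE !eqxx !orbT. Qed.

Lemma cls_N a : aT N a -> cls N a = if a == W then 3 else 2.
Proof.
have [a1 a2 a3 a4] := outer_arcs.
case/outer_edge_at=> [i|[[_ [->|->]]|[]|[]|[]]];
  try by move=> /eqP; rewrite neqs.
- have aW : a != W.
    by apply: contraL i => /eqP ->; rewrite /inner_edge /outer_edge /= !inE !eqxx !orbT andbF.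
  rewrite (negPf aW) cls_rd_in //; case: HX => _ _ _ /(_ a)[h _ _ _].
  by rewrite /rd h // inner_edgeC.
- by rewrite neqs cls_rd_in.
- by rewrite eqxx cls_bl_in.
Qed.
Lemma cls_S a : aT S a -> cls S a = if a == E then 1 else 0.
Proof.
have [a1 a2 a3 a4] := outer_arcs.
case/outer_edge_at=> [i|[[]|[]|[_ [->|->]]|[]]];
  try by move=> /eqP; rewrite neqs.
- have aW : a != E.
    by apply: contraL i => /eqP ->; rewrite /inner_edge /outer_edge /= !inE !eqxx !orbT andbF.
  rewrite (negPf aW) cls_rd //; case: HX => _ _ _ /(_ a)[_ _ h _].
  by rewrite /rd h // inner_edgeC.
- by rewrite eqxx cls_bl.
- by rewrite neqs cls_rd.
Qed.
Lemma cls_E a : aT E a -> cls E a = if a == N then 0 else 3.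
Proof.
have [a1 a2 a3 a4] := outer_arcs.
case/outer_edge_at=> [i|[[]|[_ [->|->]]|[]|[]]];
  try by move=> /eqP; rewrite neqs.
- have aW : a != N.
    by apply: contraL i => /eqP ->; rewrite /inner_edge /outer_edge /= !inE !eqxx !orbT andbF.
  rewrite (negPf aW) cls_bl_in //; case: HX => _ _ _ /(_ a)[_ h _ _].
  by rewrite /bl h // inner_edgeC.
- by rewrite eqxx cls_rd.
- by rewrite neqs cls_bl_in.
Qed.
Lemma cls_W a : aT W a -> cls W a = if a == S then 2 else 1.
Proof.
have [a1 a2 a3 a4] := outer_arcs.
case/outer_edge_at=> [i|[[]|[]|[]|[_ [->|->]]]];
  try by move=> /eqP; rewrite neqs.
- have aW : a != S.
    by apply: contraL i => /eqP ->; rewrite /inner_edge /outer_edge /= !inE !eqxx !orbT andbF.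
  rewrite (negPf aW) cls_bl //; case: HX => _ _ _ /(_ a)[_ _ _ h].
  by rewrite /bl h // inner_edgeC.
- by rewrite neqs cls_bl.
- by rewrite eqxx cls_rd_in.
Qed.

(** The four intervals around an inner vertex, listed from class [k] on: by cyclic symmetry any
    class can be put first. *)
Definition block_at (v : V) (k : nat) (t0 t1 t2 t3 : seq V) : Prop :=
  [/\ ucycle (frel (cT v)) (t0 ++ t1 ++ t2 ++ t3), t0 ++ t1 ++ t2 ++ t3 =i aT v,
      [/\ t0 != [::], t1 != [::], t2 != [::] & t3 != [::]]
    & [/\ all (fun a => cls v a == k %% 4) t0, all (fun a => cls v a == (k + 1) %% 4) t1,
          all (fun a => cls v a == (k + 2) %% 4) t2
        & all (fun a => cls v a == (k + 3) %% 4) t3]].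

Lemma blocks v k : inner_vertex T v ->
  exists t0 t1 t2 t3, block_at v k t0 t1 t2 t3.
Proof.
move=> iv; elim: k => [|k [t0 [t1 [t2 [t3 [uc mem [n0 n1 n2 n3] [c0 c1 c2 c3]]]]]]].
  case: HX => _ _ /(_ v iv)[s1 [s2 [s3 [s4 [uc mem ne [c1 c2 c3 c4]]]]]] _.
  exists s1, s2, s3, s4; split=> //; split; apply/allP=> a ai; apply/eqP.
  - by rewrite cls_rd // /rd (allP c1).
  - by rewrite cls_bl // /bl (allP c2).
  - by rewrite cls_rd_in // /rd (allP c3 _ ai).
  - by rewrite cls_bl_in // /bl (allP c4 _ ai).
exists t1, t2, t3, t0; split=> //.
- have -> : t1 ++ t2 ++ t3 ++ t0 = rot (size t0) (t0 ++ t1 ++ t2 ++ t3).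
    by rewrite rot_size_cat !catA.
  by case/andP: uc => cyc un; rewrite /ucycle rot_cycle rot_uniq cyc.
- by move=> a; rewrite -mem !mem_cat !orbA orbC !orbA.
- split.
  + by rewrite -addn1.
  + by rewrite addn1 -addn2.
  + by rewrite addn2 -addn3.
  + by have -> : (k.+1 + 3) %% 4 = k %% 4 by rewrite addSn -addnS modnDr.
Qed.

Lemma outer_vertexP v : ~~ inner_vertex T v -> [\/ v = N, v = E, v = S | v = W].
Proof.
rewrite negbK !inE => /or4P[]/eqP; first [by constructor 1|by constructor 2
  |by constructor 3|by constructor 4].
Qed.

(** The excluded corners are those of the outer face, where the class goes back by one. All others
    belong to inner triangles. *)
Lemma cls_step v a : aT v a -> (a, v) \notin outer_darts T ->
  cls v (cT v a) = cls v a \/ cls v (cT v a) = (cls v a).+1 %% 4.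
Proof.
move=> va; have vb := plane_cw_adj plT va; have [oN oE oS oW] := outer_dart_mem.
have [iv _|/outer_vertexP[]e av] := boolP (inner_vertex T v).
- have [t0 [t1 [t2 [t3 [/andP[cyc un] mem [n0 n1 n2 n3] [c0 c1 c2 c3]]]]]] := blocks (cls v a) iv.
  set k := cls v a in c0 c1 c2 c3 *; have k4 : k < 4 by apply: cls_lt.
  have : a \in t0 ++ t1 ++ t2 ++ t3 by rewrite mem.
  rewrite !mem_cat => /or4P[at0|at1|at2|at3].
  + case: t0 n0 c0 cyc un mem at0 => [//|x0 p0] _ c0 cyc un mem.
    case: t1 n1 c1 cyc un mem => [//|x1 p1] _ c1 cyc un mem.
    move=> /(nthP a)[i ip ia]; move: cyc; rewrite /= rcons_cat cat_path.
    move=> /andP[p0p /=]; case/andP=> /eqP e _.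
    have [lt|] := ltnP i (size p0).
      left; move/(pathP a)/(_ i lt): p0p => /=; rewrite ia => /eqP ->; apply/eqP.
       have /all_nthP := c0 => /(_ a i.+1 lt).
      by rewrite /= modn_small.
    move=> le; have ei : i = size p0 by apply/eqP; rewrite eqn_leq le andbT; move: ip.
    right; have <- : last x0 p0 = a by rewrite -ia ei -[size p0]/(size (x0 :: p0)).-1 nth_last.
    rewrite e.
    by case/andP: c1 => /eqP -> _; rewrite addn1.
  + by have := allP c1 _ at1; rewrite -/k eq_sym mod4_shift.
  + by have := allP c2 _ at2; rewrite -/k eq_sym mod4_shift.
  + by have := allP c3 _ at3; rewrite -/k eq_sym mod4_shift.
- subst v; rewrite (cls_N va) (cls_N vb); case: (a =P W) av => [->|_ _]; first by rewrite oW.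
  by case: ifP; auto.
- subst v; rewrite (cls_E va) (cls_E vb); case: (a =P N) av => [->|_ _]; first by rewrite oN.
  by case: ifP; auto.
- subst v; rewrite (cls_S va) (cls_S vb); case: (a =P E) av => [->|_ _]; first by rewrite oE.
  by case: ifP; auto.
- subst v; rewrite (cls_W va) (cls_W vb); case: (a =P S) av => [->|_ _]; first by rewrite oS.
  by case: ifP; auto.
Qed.

(** * Acyclicity *)

Section Region.

Variables (k : nat) (K : V -> V -> bool).

Definition outside_step : rel (V * V) :=
  [rel d d' | [&& d \in darts T, ~~ K d.1 d.2, ~~ K d'.1 d'.2
     & (d' == face_next T d) || (d' == rev_dart d)]].

(* A set of inner faces, given by the darts having them on their left, whose
   complement is connected and whose boundary, traversed with the set on its
   left, has the constant class [k]. *)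
Record region : Prop := Region {
  region_lt : k < 4;
  region_face : forall u v, aT u v -> K v (cT v u) = K u v;
  region_outer : forall d, d \in outer_darts T -> K d.1 d.2 = false;
  region_ex : exists u v, aT u v /\ K u v;
  region_bnd : forall u v, aT u v -> K u v -> ~~ K v u -> cls u v = k;
  region_conn : forall u v, aT u v -> ~~ K u v ->
    connect outside_step (N, E) (u, v) }.

Hypothesis RK : region.

(** Turning clockwise past [a] crosses the edge [v a] from the face on its left to the face on its
    right; when this leaves the region, the edge is on the boundary and has class [k]. *)
Lemma region_cross_out v a : aT v a -> K v a -> ~~ K v (cT v a) -> cls v a = k.
Proof.
move=> va; have av : aT a v by rewrite aC.
rewrite (region_face RK av); exact: region_bnd.
Qed.

Lemma region_cross_in v a : aT v a -> ~~ K v a -> K v (cT v a) ->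
  cls v a = (k + 2) %% 4.
Proof.
move=> va; have av : aT a v by rewrite aC.
by rewrite (region_face RK av) => nK Ka; rewrite (cls_rev av) (region_bnd RK av).
Qed.

Lemma region_rot_out v b : aT v b -> ~~ K v b ->
  (forall a, aT v a -> cls v a != k) \/ (forall a, aT v a -> cls v a != (k + 2) %% 4) ->
  forall a, aT v a -> ~~ K v a.
Proof.
move=> vb nb [h|h] a va.
- apply: contra nb => Ka.
  move: vb; rewrite -(plane_cwP plT _ va) => /iter_findex <-.
  elim: (findex _ _ _) => //= n IH; apply: contraT => nK.
  have vn : aT v (iter n (cT v) a) by rewrite -(plane_cwP plT _ va) fconnect_iter.
  by have := h _ vn; rewrite (region_cross_out vn IH nK) eqxx.
- move: va; rewrite -(plane_cwP plT _ vb) => /iter_findex <-.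
  elim: (findex _ _ _) => //= n IH; apply/negP => Kn.
  have vn : aT v (iter n (cT v) b) by rewrite -(plane_cwP plT _ vb) fconnect_iter.
  by have := h _ vn; rewrite (region_cross_in vn IH Kn) eqxx.
Qed.

(** An outer vertex carries only two classes, and consecutive ones, so that [k] or [k + 2] is
    missing there. Turning around it, the region can then not be left, or not be entered, and it
    misses the outer face. *)
Lemma region_outer_vertex v a : ~~ inner_vertex T v -> aT v a -> ~~ K v a.
Proof.
have k4 := region_lt RK.
have [oN oE oS oW] := outer_dart_mem; have [[a1 a2 a3 a4] _] := adj_outer.
have out d (h : d \in outer_darts T) : ~~ K d.1 d.2 by rewrite region_outer.
case/outer_vertexP=> ->.
- apply: (region_rot_out a1 (out _ oN)).
  by case: k k4 => [|[|[|[|]]]] // _; [left|left|right|right] => b vb; rewrite cls_N //;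
    case: ifP.
- apply: (region_rot_out a2 (out _ oE)).
  by case: k k4 => [|[|[|[|]]]] // _; [right|left|left|right] => b vb; rewrite cls_E //;
    case: ifP.
- apply: (region_rot_out a3 (out _ oS)).
  by case: k k4 => [|[|[|[|]]]] // _; [right|right|left|left] => b vb; rewrite cls_S //;
    case: ifP.
- apply: (region_rot_out a4 (out _ oW)).
  by case: k k4 => [|[|[|[|]]]] // _; [left|right|right|left] => b vb; rewrite cls_W //;
    case: ifP.
Qed.

(* Around a vertex, the region is entered through the block [k + 2] and left
   through the block [k], so that it contains the whole block [k + 3]. *)
Lemma region_vertex v a : aT v a -> K v a ->
  (exists2 b, aT v b & cls v b = (k + 3) %% 4 /\ K v b /\ K b v) /\
  (cls v a = (k + 1) %% 4 -> forall b, aT v b -> K v b /\ K b v).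
Proof.
move=> va Ka; have k4 := region_lt RK.
have iv : inner_vertex T v.
  by apply: contraLR Ka => iv; apply: region_outer_vertex.
have [t0 [t1 [t2 [t3 [/andP[cyc un] mem [n0 n1 n2 n3] [c0 c1 c2 c3]]]]]] :=
  blocks k.+1 iv.
have {c0}c0 : all (fun a => cls v a == (k + 1) %% 4) t0 by rewrite addn1.
have {c1}c1 : all (fun a => cls v a == (k + 2) %% 4) t1 by rewrite addn2 -addn1.
have {c2}c2 : all (fun a => cls v a == (k + 3) %% 4) t2 by rewrite addn3 -addn2.
have {c3}c3 : all (fun a => cls v a == k) t3.
  by move: c3; rewrite addSn -addnS modnDr modn_small.
case: t0 n0 c0 cyc un mem => [//|x0 p0] _ c0 cyc un mem.
case: t1 n1 c1 cyc un mem => [//|x1 p1] _ c1 cyc un mem.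
case: t2 n2 c2 cyc un mem => [//|x2 p2] _ c2 cyc un mem.
case: t3 n3 c3 cyc un mem => [//|x3 p3] _ c3 cyc un mem.
have adj0 b : b \in x0 :: p0 -> aT v b.
  by move=> bi; rewrite -[aT v b]mem !mem_cat bi.
have adj1 b : b \in x1 :: p1 -> aT v b.
  by move=> bi; rewrite -[aT v b]mem !mem_cat bi !orbT.
have adj2 b : b \in x2 :: p2 -> aT v b.
  by move=> bi; rewrite -[aT v b]mem !mem_cat bi !orbT.
have adj3 b : b \in x3 :: p3 -> aT v b.
  by move=> bi; rewrite -[aT v b]mem !mem_cat bi !orbT.
move: cyc; rewrite /= !rcons_cat /= rcons_cat /= rcons_cat /=.
rewrite cat_path /= cat_path /= cat_path /= rcons_path.
case/and3P=> q0 /eqP e1 /and3P[q1 /eqP e2 /and3P[q2 /eqP e3 /andP[q3 /eqP e4]]].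
have inc j t : (forall b, b \in t -> aT v b) -> all (fun a => cls v a == j) t ->
    j != k -> {in t, forall b, K v b -> K v (cT v b)}.
  move=> ad cj jk b bt Kb; apply: contraT => nK.
  by move: jk; rewrite -(eqP (allP cj _ bt)) (region_cross_out (ad _ bt) Kb nK) eqxx.
have dec j t : (forall b, b \in t -> aT v b) -> all (fun a => cls v a == j) t ->
    j != (k + 2) %% 4 -> {in t, forall b, K v (cT v b) -> K v b}.
  move=> ad cj jk b bt; apply: contraLR => nK; apply/negP=> Kb.
  by move: jk; rewrite -(eqP (allP cj _ bt)) (region_cross_in (ad _ bt) nK Kb) eqxx.
have i0 := inc _ _ adj0 c0; have i1 := inc _ _ adj1 c1; have i2 := inc _ _ adj2 c2.
have d0 := dec _ _ adj0 c0; have d2 := dec _ _ adj2 c2; have d3 := dec _ _ adj3 c3.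
have {}i0 : {in x0 :: p0, forall b, K v b -> K v (cT v b)} by apply: i0; rewrite mod4_shift.
have {}i1 : {in x1 :: p1, forall b, K v b -> K v (cT v b)} by apply: i1; rewrite mod4_shift.
have {}i2 : {in x2 :: p2, forall b, K v b -> K v (cT v b)} by apply: i2; rewrite mod4_shift.
have {}d0 : {in x0 :: p0, forall b, K v (cT v b) -> K v b} by apply: d0; rewrite mod4_inj.
have {}d2 : {in x2 :: p2, forall b, K v (cT v b) -> K v b} by apply: d2; rewrite mod4_inj.
have {}d3 : {in x3 :: p3, forall b, K v (cT v b) -> K v b} by apply: d3; rewrite eq_sym mod4_shift.
have f0 := fpath_fwd q0 i0; have f1 := fpath_fwd q1 i1.
have g0 := fpath_bwd q0 d0; have g2 := fpath_bwd q2 d2; have g3 := fpath_bwd q3 d3.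
have K12 : K v x1 -> K v x2 by rewrite -e2; apply: f1; apply: mem_head.
have K2 : K v x2.
  have : a \in (x0 :: p0) ++ (x1 :: p1) ++ (x2 :: p2) ++ (x3 :: p3) by rewrite mem.
  rewrite !mem_cat => /or4P[a0|a1|a2|a3].
  - by apply: K12; rewrite -e1; apply: f0 a0 _.
  - by rewrite -e2; apply: f1 a1 _.
  - exact: g2 a2 _.
  - have : K v x3 by apply: g3 a3 _.
    rewrite -e3 => Kl; have /allP := fpath_bwd_all q2 d2 Kl.
    by apply; apply: mem_head.
have x2K : K v (cT v x2) by apply: i2; rewrite ?mem_head.
have v2 := adj2 _ (mem_head _ _).
split.
  exists x2 => //; split; first by apply/eqP; case/andP: c2.
  by split=> //; rewrite -region_face // aC.
move=> ca.
have a0 : a \in x0 :: p0.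
  have : a \in (x0 :: p0) ++ (x1 :: p1) ++ (x2 :: p2) ++ (x3 :: p3) by rewrite mem.
  rewrite !mem_cat => /or4P[//|ai|ai|ai].
  - by have := allP c1 _ ai; rewrite ca mod4_inj.
  - by have := allP c2 _ ai; rewrite ca mod4_inj.
  - by have := allP c3 _ ai; rewrite ca mod4_shift.
have Kx0 : K v x0 by apply: g0 a0 _.
have all0 := fpath_fwd_all q0 i0 Kx0.
have Kx1 : K v x1 by rewrite -e1; apply: f0 (mem_head _ _) Kx0.
have all1 := fpath_fwd_all q1 i1 Kx1.
have all2 := fpath_fwd_all q2 i2 K2.
have all3 : all (K v) (x3 :: p3) by apply: (fpath_bwd_all q3 d3); rewrite e4.
have allK b : aT v b -> K v b.
  move=> vb; have : b \in (x0 :: p0) ++ (x1 :: p1) ++ (x2 :: p2) ++ (x3 :: p3).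
    by rewrite mem.
  by rewrite !mem_cat => /or4P[]; apply/allP.
move=> b vb; split; first exact: allK.
by rewrite -region_face ?allK ?plane_cw_adj // aC.
Qed.

End Region.

(* The outer component of the complement of [{g > 0}] is the complement of a
   region. *)
Lemma potential_region (k : nat) (g : V -> V -> rat) : k < 4 ->
    (forall u v, aT u v -> g v (cT v u) = g u v) -> g N E = 0%R ->
    (exists u v, aT u v /\ (0 < g u v)%R) ->
    (forall u v, aT u v -> (0 < g u v - g v u)%R -> cls u v = k) ->
  exists2 K, region k K & forall k0 K0, region k0 K0 ->
    (forall u v, aT u v -> g u v != g v u -> K0 u v) ->
    forall u v, aT u v -> K u v -> K0 u v.
Proof.
move=> k4 gI g0 [u0 [v0 [uv0 gp]]] gk.
pose P (d : V * V) := (0 < g d.1 d.2)%R.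
pose st : rel (V * V) :=
  [rel d d' | (d \in darts T) && ((d' == face_next T d) || (d' == rev_dart d) && (P d == P d'))].
pose K u v := ~~ connect st (N, E) (u, v).
have [[NE _ _ _] _] := adj_outer.
have rch d : connect st (N, E) d -> d \in darts T /\ P d = false.
  move=> /connectP[p pth ->].
  have : (N, E) \in darts T /\ P (N, E) = false by rewrite inE /P /= g0 ltxx.
  elim: p (N, E) pth => //= d' p IH d1 /andP[/andP[d1M st1] pth] [_ Pd1].
  apply: IH pth _; case/orP: st1 => [/eqP ->|/andP[/eqP -> /eqP <-]].
    split; first exact: face_next_darts.
    by move: Pd1; rewrite /P /= gI //; move: d1M; rewrite inE.
  by rewrite (darts_rev wfT).
have fconn d d' : d \in darts T -> fconnect (face_next T) d d' -> connect st d d'.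
  move=> dM /iter_findex <-; elim: (findex _ _ _) => [|n IH]; first exact: connect0.
  apply: connect_trans IH _; apply: connect1; apply/andP; split; last by rewrite iterS eqxx.
  by elim: n => // n; rewrite iterS; apply: face_next_darts.
have KI u v : aT u v -> K v (cT v u) = K u v.
  move=> uv; have dM : (u, v) \in darts T by rewrite inE.
  have fM : face_next T (u, v) \in darts T by apply: face_next_darts.
  rewrite /K; congr (~~ _); apply/idP/idP=> h; apply: connect_trans h _.
    apply: fconn; first exact: fM.
    by rewrite (fconnect_sym_in (face_next_darts wfT) (face_next_inj wfT)) ?fconnect1.
  by apply: fconn => //; rewrite fconnect1.
exists K.
  split=> //.
  - move=> d; rewrite -outer_face inE /K => dF; apply: negbF.
    by rewrite -surjective_pairing; apply: fconn; rewrite ?inE.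
  - exists u0, v0; split=> //; apply/negP=> /rch[_].
    by rewrite /P /= gp.
  - move=> u v uv Kuv; rewrite negbK => Kvu; apply: gk => //.
    have [dM Pvu] := rch _ Kvu; rewrite subr_gt0.
    have guv : P (u, v).
      apply: contraR Kuv => nP; apply: connect_trans Kvu _; apply: connect1.
      by apply/andP; split=> //; rewrite Pvu (negPf nP) !eqxx orbT.
    apply: le_lt_trans guv; rewrite leNgt; exact: negbT.
  - move=> u v uv; rewrite negbK => /connectP[p pth ->].
    suff gen q d : connect (outside_step K) (N, E) d -> connect st (N, E) d ->
        path st d q -> connect (outside_step K) (N, E) (last d q).
      by apply: gen pth; apply: connect0.
    elim: q d => //= d' q IH d cd cs /andP[sd pth'].
    have cs' : connect st (N, E) d' by apply: connect_trans cs (connect1 _).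
    apply: IH pth' => //; apply: connect_trans cd (connect1 _).
    case/andP: sd => dM sd; apply/and4P; split=> //.
    - by rewrite /K -surjective_pairing negbK.
    - by rewrite /K -surjective_pairing negbK.
    - by case/orP: sd => [->|/andP[-> _]] //; rewrite orbT.
(* The complement of [K0] is connected and [g] has no jump inside it, so that it stays in the
   component of the outer face. *)
move=> k0 K0 R0 gK u v uv; apply: contraLR => nK; rewrite /K negbK.
apply: connect_sub (region_conn R0 uv nK) => d d' /and4P[dM nd nd' /orP[]/eqP e].
  by apply: connect1; apply/andP; split=> //; rewrite e eqxx.
apply: connect1; apply/andP; split=> //; apply/orP; right; rewrite e eqxx andTb.
have adj_d : aT d.1 d.2 by move: dM; rewrite inE.
have -> // : P d == P (rev_dart d).
rewrite /P /=; apply/eqP.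
suff /eqP -> : g d.1 d.2 == g d.2 d.1 by [].
by apply: contraNT nd; apply: gK.
Qed.

(** On a finite set the walk closes up, and the flow of its closed part has a potential, normalized
    to 0 on the outer face. Across an arc of the walk it is not constant: either it is positive on
    the left, which gives a region of class [j], or it is negative on the right, and its opposite
    gives one of class [j + 2]. The last clause encloses this region in any region that contains all
    the faces around the vertices of the walk. *)
Lemma walk_region (j : nat) (f : V -> V) (v0 : V) : j < 4 ->
    (forall t, aT (iter t f v0) (iter t.+1 f v0) /\
               cls (iter t f v0) (iter t.+1 f v0) = j) ->
  exists k K, [/\ region k K, k = j \/ k = (j + 2) %% 4 &
    forall k0 K0, region k0 K0 ->
      (forall t b, aT (iter t f v0) b -> K0 (iter t f v0) b /\ K0 b (iter t f v0)) ->
      forall u v, aT u v -> K u v -> K0 u v].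
Proof.
move=> j4 wk; pose l t := iter t f v0.
have [i [n [lt_in lin]]] : exists i n, i < n /\ l n = l i.
  have /trajectP[i lt e] := looping_order f v0.
  by exists i, (order f v0).
pose phi := walk_flow l i n.
have cnt u v : walk_count l i n u v != 0%R ->
    [/\ exists t, u = l t, exists t, v = l t, aT u v & cls u v = j].
  move=> /walk_count_neq0[t _ [-> ->]]; have [h1 h2] := wk t.
  by split=> //; [exists t | exists t.+1].
have phi_on u v : phi u v != 0%R -> (exists t, u = l t) /\ (exists t, v = l t).
  have [e|/cnt[h1 h2 _ _] _ //] := eqVneq (walk_count l i n u v) 0%R.
  rewrite /phi /walk_flow e sub0r oppr_eq0 => /cnt[h1 h2 _ _].
  by split.
have phi_pos u v : (0 < phi u v)%R -> cls u v = j.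
  have [e|/cnt[]//] := eqVneq (walk_count l i n u v) 0%R.
  by rewrite /phi /walk_flow e sub0r oppr_gt0 ltNge walk_count_ge0.
have phi_neg u v : aT u v -> (phi u v < 0)%R -> cls u v = (j + 2) %% 4.
  move=> uv; rewrite -oppr_gt0 -walk_flowN => /phi_pos <-.
  by rewrite -cls_rev // aC.
have [g [gI gphi]] : exists g : V -> V -> rat,
    (forall u v, aT u v -> g v (cT v u) = g u v) /\
    (forall u v, aT u v -> (g u v - g v u = phi u v)%R).
  apply: (circulation_potential plT) => [u v|u v nuv|v].
  - exact: walk_flowN.
  - rewrite /phi /walk_flow.
    have [-> | /cnt[_ _ uv _]] := eqVneq (walk_count l i n u v) 0%R; last first.
      by rewrite uv in nuv.
    have [-> | /cnt[_ _ uv _]] := eqVneq (walk_count l i n v u) 0%R; last first.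
      by rewrite aC uv in nuv.
    by rewrite subrr.
  - by rewrite walk_flow_div ?(ltnW lt_in) // lin subrr.
pose g' u v := (g u v - g N E)%R.
have g'I u v : aT u v -> g' v (cT v u) = g' u v by move=> uv; rewrite /g' gI.
have g'phi u v : aT u v -> (g' u v - g' v u = phi u v)%R.
  by move=> uv; rewrite -gphi // /g'; ring.
have sub k0 K0 : region k0 K0 ->
      (forall t b, aT (iter t f v0) b -> K0 (iter t f v0) b /\ K0 b (iter t f v0)) ->
    forall u v, aT u v -> phi u v != 0%R -> K0 u v.
  move=> _ on u v uv /phi_on[[t ut] _]; rewrite ut; rewrite ut in uv.
  by have [] := on t v uv.
have [wi _] := wk i.
have phi1 : (0 < phi (l i) (l i.+1))%R.
  have h1 : (1 <= walk_count l i n (l i) (l i.+1))%R.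
    by apply: walk_count_ge1; rewrite leqnn.
  have h2 : walk_count l i n (l i.+1) (l i) = 0%R.
    apply/eqP; apply: contraT => /cnt[_ _ _ c1]; have [_ c2] := wk i.
    by move: c1; rewrite (cls_rev wi) c2 => /eqP; rewrite mod4_shift.
  by rewrite /phi /walk_flow h2 subr0; apply: lt_le_trans h1.
have g'nz : (0 < g' (l i) (l i.+1))%R \/ (g' (l i.+1) (l i) < 0)%R.
  have := g'phi _ _ wi; case: (ltP 0%R (g' (l i) (l i.+1))) => [|le e]; first by left.
  by right; apply: lt_le_trans le; rewrite -subr_gt0 e.
case: g'nz => gnz.
  have [||||K RK Ks] := @potential_region j g' j4.
  - exact: g'I.
  - by rewrite /g' subrr.
  - by exists (l i), (l i.+1).
  - by move=> u v uv; rewrite g'phi //; apply: phi_pos.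
  exists j, K; split; [by [] | by left | move=> k0 K0 R0 on].
  apply: (Ks _ _ R0) => u v uv; rewrite -subr_eq0 g'phi //.
  exact: (sub _ _ R0 on).
have [|||||K RK Ks] := @potential_region ((j + 2) %% 4) (fun u v => - g' u v)%R.
- by rewrite ltn_mod.
- by move=> u v uv; rewrite g'I.
- by rewrite /g' subrr oppr0.
- by exists (l i.+1), (l i); rewrite aC oppr_gt0.
- move=> u v uv; rewrite -opprD oppr_gt0 g'phi //; exact: phi_neg.
exists ((j + 2) %% 4), K; split; [by [] | by right | move=> k0 K0 R0 on].
apply: (Ks _ _ R0) => u v uv; rewrite eqr_opp -subr_eq0 g'phi //.
exact: (sub _ _ R0 on).
Qed.

(** Descent on the number of darts. From every vertex touched by the region an edge of class [k + 3]
    runs through its interior. Following such edges, one arrives at a vertex through an edge that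
    has class [k + 1] seen from there, and then all the faces around this vertex belong to the
    region. So the walk encloses a smaller region, strictly smaller because its class, [k + 3] or
    [k + 1], is not that of the given boundary. *)
Lemma no_region k K : ~ region k K.
Proof.
have [n] := ubnP #|[set d in darts T | K d.1 d.2]|.
elim: n k K => // n IH k K le_n RK; have k4 := region_lt RK.
have [u0 [v0 [uv0 Kuv0]]] := region_ex RK.
pose touched v := [exists a, aT v a && K v a].
pose f v := odflt v [pick a | [&& aT v a, cls v a == (k + 3) %% 4, K v a & K a v]].
have fP v : touched v -> [/\ aT v (f v), cls v (f v) = (k + 3) %% 4, K v (f v) & K (f v) v].
  move=> /existsP[a /andP[va Ka]]; have [[b vb [cb [Kb bK]]] _] := region_vertex RK va Ka.
  rewrite /f; case: pickP => [c /and4P[vc /eqP cc Kc cK] //|/(_ b)].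
  by rewrite vb cb eqxx Kb bK.
have tf v : touched v -> touched (f v).
  by move=> /fP[va _ _ Ka]; apply/existsP; exists v; rewrite aC va.
have t0 : touched u0 by apply/existsP; exists v0; rewrite uv0.
have tt t : touched (iter t f u0) by elim: t => //= t; apply: tf.
(* The walk starts at [f u0], since the faces around [u0] itself need not all lie in the region. *)
have wk t : aT (iter t f (f u0)) (iter t.+1 f (f u0)) /\
               cls (iter t f (f u0)) (iter t.+1 f (f u0)) = (k + 3) %% 4.
  by rewrite -!iterSr; have [h1 h2 _ _] := fP _ (tt t.+1).
have [|k' [K' [RK' k'E sub]]] := walk_region _ wk; first by rewrite ltn_mod.
have {}sub : forall u v, aT u v -> K' u v -> K u v.
  apply: (sub _ _ RK) => t b tb; rewrite -iterSr in tb *.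
  have [h1 h2 h3 h4] := fP _ (tt t).
  have h5 : aT (iter t.+1 f u0) (iter t f u0) by rewrite aC.
  have [_ all_in] := region_vertex RK h5 h4; apply: all_in tb.
  by rewrite (cls_rev h1) h2 mod4_add -(modnDr (k + 1)) -addnA.
have [[u v] /= /and3P[uv Kuv nKvu]] : exists d : V * V, [&& aT d.1 d.2, K d.1 d.2 & ~~ K d.2 d.1].
  apply/existsP; apply: contraT; rewrite negb_exists => /forallP no.
  have KC u v : aT u v -> K u v = K v u.
    move=> uv; have := no (u, v); have := no (v, u).
    by rewrite /= uv aC uv /=; case: (K u v); case: (K v u).
  have [oN _ _ _] := outer_dart_mem; have [[a1 _ _ _] _] := adj_outer.
  have := plane_dual_connected plT (region_face RK) KC uv0 a1.
  by rewrite Kuv0 (region_outer RK oN).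
have dM : (u, v) \in darts T by rewrite inE.
apply: (IH k' K' _ RK'); rewrite ltnS in le_n; apply: leq_trans le_n; apply: proper_card.
apply/properP; split.
  by apply/subsetP=> d; rewrite !inE => /andP[dd /(sub _ _ dd) ->]; rewrite dd.
exists (u, v); rewrite !inE /= ?uv ?Kuv //=; apply/negP=> K'uv.
have nK'vu : ~~ K' v u by apply: contra nKvu; apply: sub; rewrite aC.
move: (region_bnd RK' uv K'uv nK'vu); rewrite (region_bnd RK uv Kuv nKvu).
case: k'E => -> /eqP; first by rewrite eq_sym mod4_shift.
by rewrite mod4_add (_ : k + (3 + 2) = k + 1 + 4) ?modnDr ?(eq_sym k) ?mod4_shift // -addnA.
Qed.

Lemma no_monochromatic_walk (j : nat) (f : V -> V) (v0 : V) :
  ~ (forall t, aT (iter t f v0) (iter t.+1 f v0) /\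
               cls (iter t f v0) (iter t.+1 f v0) = j).
Proof.
move=> wk; have j4 : j < 4 by case: (wk 0) => _ <-; apply: cls_lt.
by have [k [K [RK _ _]]] := walk_region j4 wk; apply: (no_region RK).
Qed.

Lemma rd_acyclic u v : rd u v -> ~~ connect rd v u.
Proof.
move=> uv; apply/negP=> /connectP[p pth lp].
have cyc : cycle rd (v :: p) by rewrite /= rcons_path pth -lp.
have nx w : w \in v :: p -> rd w (next (v :: p) w) /\ next (v :: p) w \in v :: p.
  by move=> wi; split; [apply: next_cycle | rewrite mem_next].
have on t : iter t (next (v :: p)) v \in v :: p.
  by elim: t => [|t IH]; [apply: mem_head | rewrite iterS; have [] := nx _ IH].
apply: (@no_monochromatic_walk 0 (next (v :: p)) v) => t.
have [r _] := nx _ (on t); rewrite iterS cls_rd //; split=> //.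
by apply: arc_adj; rewrite r.
Qed.

End Transversal.

(** * Rotation in the red map *)

#[local] Arguments orient_map : simpl never.

(** The rotation of a submap skips the deleted neighbours. If [t] were at least as long as the
    orbit, it would contain the kept neighbour [y]. *)
Lemma submap_cw (V : finType) (M : rmap V) (e : rel V) v x t y :
    fpath (cw M v) x (rcons t y) -> all (fun a => ~~ e v a) t -> e v y ->
  cw (submap M e) v x = y.
Proof.
set c := cw M v => pth nt ey /=; rewrite -/c.
have /fpathP[m em] := pth; have sz : m = (size t).+1.
  by have := congr1 size em; rewrite size_rcons size_traject.
rewrite {m}sz in em.
have [lt|le] := ltnP (size t) (order c (c x)).
  have -> : orbit c (c x) = rcons t y ++ drop (size t).+1 (orbit c (c x)).
    by rewrite -{1}(cat_take_drop (size t).+1 (orbit c (c x))) em /orbit take_traject.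
  rewrite nth_cat find_cat has_rcons ey /= size_rcons.
  have -> : find (e v) (rcons t y) = size t.
    have /negbTE nh : ~~ has (e v) t by rewrite -all_predC.
    by rewrite -cats1 find_cat nh /= ey addn0.
  by rewrite ltnSn nth_rcons ltnn eqxx.
have yo : y \in orbit c (c x).
  rewrite -fconnect_orbit; have : y \in rcons t y by rewrite mem_rcons mem_head.
  by rewrite em => /trajectP[i _ ->]; apply: fconnect_iter.
have : y \in t.
  have -> : t = take (size t) (rcons t y) by rewrite -cats1 take_size_cat.
  rewrite em take_traject ?leqnSn //.
  have -> : traject c (c x) (size t) = orbit c (c x) ++ drop (order c (c x)) (traject c (c x) (size t)).
    by rewrite -{1}(cat_take_drop (order c (c x)) (traject c (c x) (size t))) take_traject.
  by rewrite mem_cat yo.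
by move=> /(allP nt); rewrite ey.
Qed.

Lemma submap_fpath (V : finType) (M : rmap V) (e : rel V) v x p :
  fpath (cw M v) x p -> all (e v) p -> fpath (cw (submap M e) v) x p.
Proof.
elim: p x => //= y p IH x /andP[xy yp] /andP[ey ep]; rewrite -/(fpath _ _ _) IH // andbT.
by apply/eqP; apply: (submap_cw (t := [::])) => //=; rewrite xy.
Qed.

Lemma orient_map_cw (V : finType) (T : framed_map V) (o : rel V) v x t y :
    fpath (cw T v) x (rcons t y) -> all (fun a => ~~ adj (orient_map T o) v a) t ->
    adj (orient_map T o) v y ->
  cw (orient_map T o) v x = y.
Proof. exact: submap_cw. Qed.

Lemma orient_map_fpath (V : finType) (T : framed_map V) (o : rel V) v x p :
  fpath (cw T v) x p -> all (adj (orient_map T o) v) p ->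
  fpath (cw (orient_map T o) v) x p.
Proof. exact: submap_fpath. Qed.

Section RedMap.

Variables (V : finType) (T : framed_map V) (X : bicolor_orientation V).
Hypotheses (HT : irreducible_triangulation T) (HX : transversal_pair T X).

Local Notation N := (vN T).
Local Notation E := (vE T).
Local Notation S := (vS T).
Local Notation W := (vW T).
Local Notation cT := (cw (fmap T)).
Local Notation aT := (adj (fmap T)).
Local Notation o := (red_arc T X).
Local Notation cM := (cw (orient_map T (red_arc T X))).
Local Notation aM := (adj (orient_map T (red_arc T X))).
Local Notation rdX := (rd T X).
Local Notation blX := (bl T X).
Local Notation cls := (cls T X).

Let plT := triangulation_plane HT.
Let aC := plane_adjC plT.
Let neqs := outer_neqs HT.

Lemma red_arcE u v : o u v = rdX u v || ((u, v) \in [:: (W, N); (S, E)]).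
Proof.
rewrite /red_arc /Defs.red /= /rd /= !inE -!orbA; congr (_ || _).
by do 4!case: (_ == _).
Qed.

Lemma red_mapE u v : aM u v = o u v || o v u. Proof. by []. Qed.

Lemma red_arc_adj u v : o u v -> aT u v.
Proof.
have [[_ _ _ a4] [_ b2 _ _]] := adj_outer HT.
rewrite red_arcE => /orP[r|]; first by apply: (arc_adj HT HX); rewrite r.
by rewrite !inE !xpair_eqE => /orP[]/andP[/eqP -> /eqP ->].
Qed.

Lemma red_map_adj u v : aM u v -> aT u v.
Proof. by rewrite red_mapE => /orP[]/red_arc_adj //; rewrite aC. Qed.

Lemma red_arc_asym u v : o u v -> ~~ o v u.
Proof.
move=> ouv; have uv := red_arc_adj ouv; apply/negP=> ovu.
have au := arc_unique HT HX uv; move: ouv ovu; rewrite !red_arcE.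
have hb a b : (a, b) \in [:: (W, N); (S, E)] -> blX a b by rewrite /bl => ->; rewrite orbT.
move=> /orP[r1|/[dup] m1 /hb b1] /orP[r2|/[dup] m2 /hb b2]; move: au;
  rewrite ?r1 ?r2 ?b1 ?b2 //; by case: (rdX _ _); case: (blX _ _); case: (rdX _ _); case: (blX _ _).
Qed.

Lemma red_arc_N a : o N a = false.
Proof.
apply/negP=> oa; have ad := red_arc_adj oa; move: oa; rewrite red_arcE.
rewrite (rdE HT HX ad) (cls_N HT HX ad) !inE !xpair_eqE !neqs.
by case: ifP.
Qed.

Lemma red_arc_S a : o a S = false.
Proof.
apply/negP=> oa; have := red_arc_adj oa; rewrite aC => ad; move: oa; rewrite red_arcE.
have := cls_rev HT HX ad; rewrite (cls_S HT HX ad) rdE 1?aC // => ->.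
by rewrite !inE !xpair_eqE !neqs !andbF; case: ifP.
Qed.

Lemma red_arc_inner v a : inner_vertex T v -> o v a = rdX v a /\ o a v = rdX a v.
Proof.
rewrite /inner_vertex !inE !negb_or => /and4P[/negPf vN /negPf vE /negPf vS /negPf vW].
by rewrite !red_arcE !inE !xpair_eqE vN vE vS vW !andbF !orbF.
Qed.

Lemma red_arc_outer_S a : aT S a -> o S a.
Proof.
move=> ad; rewrite red_arcE (rdE HT HX ad) (cls_S HT HX ad).
by case: (a =P E) => [->|//]; rewrite !inE eqxx !orbT.
Qed.

Lemma red_arc_outer_N a : aT N a -> o a N.
Proof.
move=> ad; have da : aT a N by rewrite aC.
rewrite red_arcE (rdE HT HX da) (cls_rev HT HX ad) (cls_N HT HX ad).
by case: (a =P W) => [->|//]; rewrite !inE eqxx !orbT.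
Qed.

Lemma red_map_W a : aT W a -> aM W a = (a == N) || (a == S).
Proof.
move=> ad; have da : aT a W by rewrite aC.
rewrite red_mapE !red_arcE (rdE HT HX ad) (rdE HT HX da) (cls_rev HT HX ad).
rewrite (cls_W HT HX ad) !inE !xpair_eqE !eqxx !neqs.
by case: (a =P S) => [->|_]; rewrite ?neqs ?andbF ?orbF ?orbT //=; case: (a == N).
Qed.

Lemma red_map_E a : aT E a -> aM E a = (a == N) || (a == S).
Proof.
move=> ad; have da : aT a E by rewrite aC.
rewrite red_mapE !red_arcE (rdE HT HX ad) (rdE HT HX da) (cls_rev HT HX ad).
rewrite (cls_E HT HX ad) !inE !xpair_eqE !eqxx !neqs.
by case: (a =P N) => [->|_]; rewrite ?neqs ?andbF ?orbF ?orbT //=; case: (a == S).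
Qed.

Lemma red_arcs_outer : [/\ o S W, o W N, o S E & o E N].
Proof. by rewrite /red_arc /= !inE !eqxx !orbT. Qed.

(** Normal form of the rotation of the red map: the outgoing arcs [so] from left to right, then the
    ingoing arcs [si] from right to left, each list being consecutive in the rotation of [T] too.
    The two [rr_blue] fields locate the deleted edges: outgoing blue ones precede [si], ingoing blue
    ones precede [so]. *)
Record red_rotation (v : V) (so si : seq V) : Prop := RedRotation {
  rr_cycle : cycle (frel (cM v)) (so ++ si);
  rr_uniq : uniq (so ++ si);
  rr_so : forall a, (a \in so) = o v a;
  rr_si : forall a, (a \in si) = o a v;
  rr_so_path : forall x p, so = x :: p -> fpath (cT v) x p;
  rr_si_path : forall x p, si = x :: p -> fpath (cT v) x p;
  rr_blue_out : forall a, aT v a -> ~~ aM v a -> cls v a = 1 -> cM v a = head v si;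
  rr_blue_in : forall a, aT v a -> ~~ aM v a -> cls v a = 3 -> cM v a = head v so;
  rr_so0 : v != N -> so != [::];
  rr_si0 : v != S -> si != [::];
  rr_S : v = S -> head v so = W /\ last v so = E;
  rr_N : v = N -> head v si = E /\ last v si = W;
  rr_WE : v = W \/ v = E -> so = [:: N] /\ si = [:: S] }.

Lemma ucycle_orbit v b : aT v b ->
  [/\ fcycle (cT v) (orbit (cT v) b), uniq (orbit (cT v) b)
    & orbit (cT v) b =i aT v].
Proof.
move=> vb; split; last 1 first.
- by move=> a; rewrite -fconnect_orbit (plane_cwP plT) // -topredE.
- apply: (@cycle_orbit_in _ _ (aT v)) => //.
    by move=> a; rewrite -!topredE /=; apply: plane_cw_adj.
  move=> a c; rewrite -!topredE /=; exact: plane_cw_inj.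
- exact: orbit_uniq.
Qed.

Lemma orbit_last v a b : aT v a -> cT v a = b ->
  exists p, [/\ orbit (cT v) b = b :: p, fpath (cT v) b p, last b p = a,
    uniq (b :: p) & b :: p =i aT v].
Proof.
move=> va ab; have vb : aT v b by rewrite -ab plane_cw_adj.
have [cyc un mem] := ucycle_orbit vb.
case eo : (orbit (cT v) b) cyc un mem => [|b' p]; first by have := in_orbit (cT v) b; rewrite eo.
have -> : b' = b by move: eo; rewrite /orbit -orderSpred => -[].
move=> cyc un mem; exists p; move: cyc; rewrite /= rcons_path => /andP[pth /eqP e].
split=> //; apply: (plane_cw_inj plT (v := v)) => //; last by rewrite e ab.
by have := mem (last b p); rewrite mem_last.
Qed.

Lemma rotation_inner v : inner_vertex T v -> exists so si, red_rotation v so si.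
Proof.
move=> iv; have [t0 [t1 [t2 [t3 [/andP[cyc un] mem [n0 n1 n2 n3] [c0 c1 c2 c3]]]]]] :=
  blocks HT HX 0 iv.
move: (iv); rewrite /inner_vertex !inE !negb_or => /and4P[vN vE vS vW].
exists t0, t2.
have ad a : a \in t0 ++ t1 ++ t2 ++ t3 -> aT v a by rewrite mem.
have oE a : aT v a -> (o v a = (cls v a == 0)) * (o a v = (cls v a == 2)).
  move=> va; have [-> ->] := red_arc_inner a iv; have av : aT a v by rewrite aC.
  rewrite (rdE HT HX va) (rdE HT HX av) (cls_rev HT HX va); split=> //.
  by case: (cls v a) (cls_lt T X v a) => [|[|[|[|]]]].
have e0 a : a \in t0 -> aM v a.
  by move=> ai; rewrite red_mapE !oE ?(eqP (allP c0 _ ai)) // ad // mem_cat ai.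
have e2 a : a \in t2 -> aM v a.
  by move=> ai; rewrite red_mapE !oE ?(eqP (allP c2 _ ai)) // ad // !mem_cat ai !orbT.
have e1 a : a \in t1 -> ~~ aM v a.
  by move=> ai; rewrite red_mapE !oE ?(eqP (allP c1 _ ai)) // ad // !mem_cat ai !orbT.
have e3 a : a \in t3 -> ~~ aM v a.
  by move=> ai; rewrite red_mapE !oE ?(eqP (allP c3 _ ai)) // ad // !mem_cat ai !orbT.
have wh a j : aT v a -> cls v a = j -> [/\ j = 0 -> a \in t0, j = 1 -> a \in t1,
    j = 2 -> a \in t2 & j = 3 -> a \in t3].
  move=> va cj; have : a \in t0 ++ t1 ++ t2 ++ t3 by rewrite mem.
  rewrite !mem_cat => /or4P[]ai; [have := allP c0 _ ai|have := allP c1 _ ai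
    |have := allP c2 _ ai|have := allP c3 _ ai]; rewrite cj => /eqP ->; by split.
have mso a : (a \in t0) = o v a.
  apply/idP/idP=> [ai|oa].
    by rewrite oE ?(eqP (allP c0 _ ai)) // ad // mem_cat ai.
  have va := red_arc_adj oa; move: oa; rewrite oE // => /eqP c.
  by have [-> //] := wh _ _ va c.
have msi a : (a \in t2) = o a v.
  apply/idP/idP=> [ai|oa].
    by rewrite oE ?(eqP (allP c2 _ ai)) // ad // !mem_cat ai !orbT.
  have va : aT v a by rewrite aC red_arc_adj.
  move: oa; rewrite oE // => /eqP c; by have [_ _ -> //] := wh _ _ va c.
case: t0 n0 c0 cyc un mem ad e0 wh mso => [//|x0 p0] _ c0 cyc un mem ad e0 wh mso.
case: t1 n1 c1 cyc un mem ad e1 wh => [//|x1 p1] _ c1 cyc un mem ad e1 wh.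
case: t2 n2 c2 cyc un mem ad e2 wh msi => [//|x2 p2] _ c2 cyc un mem ad e2 wh msi.
case: t3 n3 c3 cyc un mem ad e3 wh => [//|x3 p3] _ c3 cyc un mem ad e3 wh.
move: cyc; rewrite /= !rcons_cat /= rcons_cat /= rcons_cat /=.
rewrite cat_path /= cat_path /= cat_path /= rcons_path.
case/and3P=> q0 q01 /and3P[q1 q12 /and3P[q2 q23 /andP[q3 q30]]].
have sub z p q y : fpath (cT v) z p -> q \in z :: p -> cT v (last z p) == y ->
    all (fun a => ~~ aM v a) (z :: p) -> aM v y -> cM v q = y.
  move=> pth qz ly np ey; move: qz; rewrite inE => /predU1P[->|qp].
    apply: (orient_map_cw (t := p)) => //; last by case/andP: np.
    by rewrite rcons_path pth.
  case/splitPr: qp pth ly np => r1 r2; rewrite cat_path /= last_cat /=.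
  move=> /and3P[_ _ pth] ly; rewrite all_cat => /and4P[_ _ _ np].
  by apply: (@orient_map_cw V T o v q r2 y); rewrite ?rcons_path ?pth.
have a1 : all (fun a => ~~ aM v a) (x1 :: p1) by apply/allP=> a; apply: e1.
have a3 : all (fun a => ~~ aM v a) (x3 :: p3) by apply/allP=> a; apply: e3.
have m2 : aM v x2 by apply: e2; apply: mem_head.
have m0 : aM v x0 by apply: e0; apply: mem_head.
have nb1 a : a \in x1 :: p1 -> cM v a = x2 by move=> ai; apply: (sub x1 p1).
have nb3 a : a \in x3 :: p3 -> cM v a = x0 by move=> ai; apply: (sub x3 p3).
split=> //=.
- rewrite rcons_cat /= cat_path /= rcons_path; apply/and3P; split.
  + apply: orient_map_fpath => //; apply/allP=> a ai; apply: e0.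
    by rewrite inE ai orbT.
  + apply/eqP; apply: (orient_map_cw (t := x1 :: p1)) => //=.
    by rewrite q01 rcons_path q1 /= q12.
  apply/andP; split.
  + apply: orient_map_fpath => //; apply/allP=> a ai; apply: e2.
    by rewrite inE ai orbT.
  + apply/eqP; apply: (orient_map_cw (t := x3 :: p3)) => //=.
    by rewrite q23 rcons_path q3 q30.
- apply: (subseq_uniq (s1 := (x0 :: p0) ++ (x2 :: p2)) _ un).
  apply: cat_subseq; first exact: subseq_refl.
  apply: (subseq_trans (y := (x2 :: p2) ++ (x3 :: p3))); first exact: prefix_subseq.
  exact: suffix_subseq.
- by move=> x p [<- <-].
- by move=> x p [<- <-].
- by move=> a va _ ca; apply: nb1; have [_ -> //] := wh _ _ va ca.
- by move=> a va _ ca; apply: nb3; have [_ _ _ -> //] := wh _ _ va ca.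
- by move=> e; rewrite e eqxx in vS.
- by move=> e; rewrite e eqxx in vN.
- by case=> e; [rewrite e eqxx in vW | rewrite e eqxx in vE].
Qed.

Lemma rotation_N : exists so si, red_rotation N so si.
Proof.
have [_ _ _ cN] := outer_cw HT; have [_ [_ _ _ NW]] := adj_outer HT.
have [p [_ pth lp un mem]] := orbit_last NW cN.
exists [::], (E :: p); split=> //.
- rewrite /= rcons_path; apply/andP; split.
    apply: orient_map_fpath => //; apply/allP=> a ai; apply/orP; right.
    by apply: red_arc_outer_N; rewrite -[aT N a]mem inE ai orbT.
  apply/eqP; apply: (orient_map_cw (t := [::])) => //=; first by rewrite lp cN eqxx.
  by have [_ _ _ ->] := red_arcs_outer; rewrite orbT.
- by move=> a; rewrite red_arc_N.
- move=> a; rewrite mem; apply/idP/idP=> [/red_arc_outer_N //|].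
  by move/red_arc_adj; rewrite aC.
- by move=> x q [<- <-].
- by move=> a va /negP[]; rewrite red_mapE red_arc_outer_N ?orbT.
- by move=> a va /negP[]; rewrite red_mapE red_arc_outer_N ?orbT.
- by rewrite eqxx.
- by move/eqP; rewrite neqs.
- by case=> /eqP; rewrite neqs.
Qed.

Lemma rotation_S : exists so si, red_rotation S so si.
Proof.
have [_ cS _ _] := outer_cw HT; have [_ [_ SE _ _]] := adj_outer HT.
have [p [_ pth lp un mem]] := orbit_last SE cS.
exists (W :: p), [::]; split=> //; rewrite ?cats0 //.
- rewrite /= rcons_path; apply/andP; split.
    apply: orient_map_fpath => //; apply/allP=> a ai; apply/orP; left.
    by apply: red_arc_outer_S; rewrite -[aT S a]mem inE ai orbT.
  apply/eqP; apply: (orient_map_cw (t := [::])) => //=; first by rewrite lp cS eqxx.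
  by have [-> _ _ _] := red_arcs_outer.
- move=> a; rewrite mem; apply/idP/idP=> [/red_arc_outer_S //|].
  by move/red_arc_adj.
- by move=> a; rewrite red_arc_S.
- by move=> x q [<- <-].
- by move=> a va /negP[]; rewrite red_mapE red_arc_outer_S.
- by move=> a va /negP[]; rewrite red_mapE red_arc_outer_S.
- by rewrite eqxx.
- by move/eqP; rewrite neqs.
- by case=> /eqP; rewrite neqs.
Qed.

(* At [W] and [E] the red map has the two neighbours [N] and [S]; the other
   neighbours lie between [b] and [a], the latter being followed by [b] in the
   outer face. *)
Lemma rotation_side v a b : aT v a -> cT v a = b -> a != b ->
    (forall c, aT v c -> aM v c = (c == b) || (c == a)) ->
  [/\ cM v a = b, cM v b = a & forall c, aT v c -> ~~ aM v c -> cM v c = a].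
Proof.
move=> va ab nab mE; have [p [_ pth lp un mem]] := orbit_last va ab.
have vb : aT v b by rewrite -ab plane_cw_adj.
case: (lastP p) pth lp un mem => [|q z] pth lp un mem.
  by move: lp nab => /= ->; rewrite eqxx.
rewrite last_rcons in lp; subst z.
have nq : all (fun c => ~~ aM v c) q.
  apply/allP=> c cq; have vc : aT v c.
    by rewrite -[aT v c]mem inE mem_rcons inE cq !orbT.
  rewrite mE // negb_or; move: un; rewrite /= mem_rcons rcons_uniq inE negb_or.
  case/and3P=> /andP[_ bq] aq _; apply/andP; split.
    by apply: contraNneq bq => <-.
  by apply: contraNneq aq => <-.
split.
- have mb : aM v b by rewrite mE ?eqxx.
  by apply: (orient_map_cw (t := [::])); rewrite //= ab eqxx.
- by apply: (orient_map_cw (t := q)) => //; rewrite mE ?eqxx ?orbT.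
- move=> c vc nc; have : c \in b :: rcons q a by rewrite mem.
  rewrite inE mem_rcons inE; move: (nc); rewrite mE // negb_or.
  move=> /andP[/negPf -> /negPf ->] /= cq.
  case/splitPr: cq pth nq => r1 r2; rewrite rcons_cat cat_path /= all_cat /=.
  move=> /and3P[_ _ pth] /and3P[_ _ nr]; apply: (orient_map_cw (t := r2)) => //.
  by rewrite mE ?eqxx ?orbT.
Qed.

Lemma rotation_W : exists so si, red_rotation W so si.
Proof.
have [_ _ cW _] := outer_cw HT; have [_ [_ _ WS _]] := adj_outer HT.
have [oSW oWN oSE oEN] := red_arcs_outer.
have [|//|s1 s2 s3] := rotation_side WS cW; first by rewrite neqs.
  exact: red_map_W.
exists [:: N], [:: S]; split=> //.
- by apply/and3P; split=> //; apply/eqP.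
- by rewrite /= inE neqs.
- move=> a; rewrite !inE; apply/eqP/idP=> [-> //|oa].
  have ad := red_arc_adj oa; have := red_map_W ad; rewrite red_mapE oa /=.
  case: (a =P N) => // _ /esym/eqP e.
  by move: oa; rewrite e red_arc_S.
- move=> a; rewrite !inE; apply/eqP/idP=> [-> //|oa].
  have := red_arc_adj oa; rewrite aC => ad; have := red_map_W ad; rewrite red_mapE oa orbT.
  case: (a =P S) => // _; rewrite orbF => /esym/eqP e.
  by move: oa; rewrite e red_arc_N.
- by move=> x p [_ <-].
- by move=> x p [_ <-].
- by move=> a va na _; apply: s3.
- move=> a va _; rewrite (cls_W HT HX va); by case: ifP.
- by move/eqP; rewrite neqs.
- by move/eqP; rewrite neqs.
Qed.

Lemma rotation_E : exists so si, red_rotation E so si.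
Proof.
have [cE _ _ _] := outer_cw HT; have [_ [EN _ _ _]] := adj_outer HT.
have [oSW oWN oSE oEN] := red_arcs_outer.
have [|c Ec|s1 s2 s3] := rotation_side EN cE; first by rewrite neqs.
  by rewrite red_map_E // orbC.
exists [:: N], [:: S]; split=> //.
- by apply/and3P; split=> //; apply/eqP.
- by rewrite /= inE neqs.
- move=> a; rewrite !inE; apply/eqP/idP=> [-> //|oa].
  have ad := red_arc_adj oa; have := red_map_E ad; rewrite red_mapE oa /=.
  case: (a =P N) => // _ /esym/eqP e.
  by move: oa; rewrite e red_arc_S.
- move=> a; rewrite !inE; apply/eqP/idP=> [-> //|oa].
  have := red_arc_adj oa; rewrite aC => ad; have := red_map_E ad; rewrite red_mapE oa orbT.
  case: (a =P S) => // _; rewrite orbF => /esym/eqP e.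
  by move: oa; rewrite e red_arc_N.
- by move=> x p [_ <-].
- by move=> x p [_ <-].
- move=> a va _; rewrite (cls_E HT HX va); by case: ifP.
- by move=> a va na _; apply: s3.
- by move/eqP; rewrite neqs.
- by move/eqP; rewrite neqs.
Qed.

Lemma red_rotation_ex : exists so si : V -> seq V,
  forall v, red_rotation v (so v) (si v).
Proof.
have [f fP] : exists f : V -> seq V * seq V, forall v, red_rotation v (f v).1 (f v).2.
  apply: (fin_all_exists (P := fun v (p : seq V * seq V) => red_rotation v p.1 p.2)) => v.
  have [so [si h]] : exists so si, red_rotation v so si; last by exists (so, si).
  have [/rotation_inner //|/outer_vertexP[]->] := boolP (inner_vertex T v).
  - exact: rotation_N.
  - exact: rotation_E.
  - exact: rotation_S.
  - exact: rotation_W.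
by exists (fun v => (f v).1), (fun v => (f v).2).
Qed.

(** [S] and [N] receive extreme values because the arcs from [S] to [E] and from [W] to [N] are blue
    in the sense of [bl]: the acyclicity of [rd] does not cover them. *)
Definition red_rank (v : V) : nat :=
  if v == S then 0 else if v == N then #|V| + 2 else #|[set u | connect rdX u v]|.+1.

Lemma red_rank_lt u v : o u v -> red_rank u < red_rank v.
Proof.
move=> ouv; have vS : v != S by apply: contraTneq ouv => ->; rewrite red_arc_S.
have uN : u != N by apply: contraTneq ouv => ->; rewrite red_arc_N.
rewrite /red_rank (negPf vS) (negPf uN).
have [_|uS] := eqVneq u S; first by case: ifP; rewrite ?addn2.
have [_|vN] := eqVneq v N; first by rewrite addn2 !ltnS max_card.
have r : rdX u v.
  move: ouv; rewrite red_arcE !inE !xpair_eqE (negPf uS) (negPf vN).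
  by rewrite andbF /= orbF.
rewrite ltnS; apply: proper_card; apply/properP; split.
  apply/subsetP=> w; rewrite !inE => /connect_trans; apply; exact: connect1.
exists v; rewrite !inE ?connect0 //; exact: (rd_acyclic HT HX).
Qed.

Lemma red_rank_le v : red_rank v <= #|V| + 2.
Proof.
rewrite /red_rank; case: ifP => // _; case: ifP => // _.
by rewrite addn2 ltnS ltnW // ltnS max_card.
Qed.

End RedMap.

(** * Separating paths and their potentials *)

#[local] Arguments cw : simpl never.
#[local] Arguments adj : simpl never.

Lemma fcycle_nth (A : eqType) (f : A -> A) (s : seq A) x i :
  fcycle f s -> i.+1 < size s -> f (nth x s i) = nth x s i.+1.
Proof.
case: s => //= y s; rewrite rcons_path => /andP[/(pathP x) pth _] lt.
by have /eqP := pth i lt.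
Qed.

(** The rank forbids a second visit to a vertex before the end, so that each arc is counted at most
    once. *)
Lemma walk_count_path (V : finType) (f : V -> V) (z : V) (r : V -> nat) :
    f z = z -> (forall a, a != z -> r (f a) < r a) ->
  forall v, exists2 n, iter n f v = z & forall a b,
    walk_count (fun t => iter t f v) 0 n a b =
      ([&& fconnect f v a, a != z & b == f a])%:R%R.
Proof.
move=> fz fr v; have [k] := ubnP (r v); elim: k v => // k IH v le_k.
have [->|vz] := eqVneq v z.
  exists 0 => // a b; rewrite /walk_count big_geq //.
  have fzz n : iter n f z = z by elim: n => //= n ->.
  case: (boolP (fconnect f z a)) => // /iter_findex; rewrite fzz => <-.
  by rewrite eqxx.
have [|n ez cnt] := IH (f v).
  by have := fr _ vz; lia.
have rk w : fconnect f (f v) w -> r w < r v.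
  move=> /iter_findex <-; apply: leq_ltn_trans (fr _ vz).
  elim: (findex _ _ _) => //= m; apply: leq_trans.
  by have [->|/fr/ltnW //] := eqVneq (iter m f (f v)) z; rewrite fz.
exists n.+1 => [|a b]; first by rewrite iterSr.
rewrite /walk_count big_nat_recl //.
rewrite (eq_bigr (fun t => ((iter t f (f v) == a) && (iter t.+1 f (f v) == b))%:R%R));
  last by move=> t _; rewrite -!iterSr.
have := cnt a b; rewrite /walk_count => -> /=; rewrite (fconnect_eqVf f v).
have [<-|va] /= := eqVneq v a; last by rewrite add0r.
have -> : fconnect f (f v) v = false by apply/negP=> /rk; rewrite ltnn.
by rewrite /= vz addr0 eq_sym.
Qed.

Section Potentials.

Variables (V : finType) (T : framed_map V) (X : bicolor_orientation V).
Hypotheses (HT : irreducible_triangulation T) (HX : transversal_pair T X).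

Local Notation N := (vN T).
Local Notation E := (vE T).
Local Notation S := (vS T).
Local Notation W := (vW T).
Local Notation cT := (cw (fmap T)).
Local Notation aT := (adj (fmap T)).
Local Notation o := (red_arc T X).
Local Notation cM := (cw (orient_map T (red_arc T X))).
Local Notation aM := (adj (orient_map T (red_arc T X))).
Local Notation rk := (red_rank T X).

Let plT := triangulation_plane HT.
Let wfT := plane_well_rotated plT.
Let aC := plane_adjC plT.
Let neqs := outer_neqs HT.

Variables (so si : V -> seq V).
Hypothesis rot : forall v, red_rotation T X v (so v) (si v).

(** The default value of [head] makes [N] a fixed point of [lo] and [S] one of [ri], so that the two
    halves of a separating path are plain iterations. *)
Definition lo (v : V) : V := head v (so v).
Definition ri (v : V) : V := head v (si v).

Let memso v a : (a \in so v) = o v a. Proof. exact: rr_so (rot v) a. Qed.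
Let memsi v a : (a \in si v) = o a v. Proof. exact: rr_si (rot v) a. Qed.

Lemma so_uniq v : uniq (so v).
Proof. by have := rr_uniq (rot v); rewrite cat_uniq => /and3P[]. Qed.
Lemma si_uniq v : uniq (si v).
Proof. by have := rr_uniq (rot v); rewrite cat_uniq => /and3P[]. Qed.

Lemma so_N : so N = [::].
Proof.
case e : (so N) => [//|x p]; have := memso N x.
by rewrite e mem_head (red_arc_N HT HX).
Qed.
Lemma si_S : si S = [::].
Proof.
case e : (si S) => [//|x p]; have := memsi S x.
by rewrite e mem_head (red_arc_S HT HX).
Qed.

Lemma lo_N : lo N = N. Proof. by rewrite /lo so_N. Qed.
Lemma ri_S : ri S = S. Proof. by rewrite /ri si_S. Qed.

Lemma so_neq0 v : v != N -> so v != [::]. Proof. exact: rr_so0 (rot v). Qed.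
Lemma si_neq0 v : v != S -> si v != [::]. Proof. exact: rr_si0 (rot v). Qed.

Lemma lo_arc v : v != N -> o v (lo v).
Proof. by move/so_neq0; rewrite -memso /lo; case: (so v) => // x p _; apply: mem_head. Qed.
Lemma ri_arc v : v != S -> o (ri v) v.
Proof. by move/si_neq0; rewrite -memsi /ri; case: (si v) => // x p _; apply: mem_head. Qed.

Lemma arc_neqN u v : o u v -> u != N.
Proof. by apply: contraTneq => ->; rewrite (red_arc_N HT HX). Qed.
Lemma arc_neqS u v : o u v -> v != S.
Proof. by apply: contraTneq => ->; rewrite (red_arc_S HT HX). Qed.

Lemma so_next v i : i.+1 < size (so v) ->
  cM v (nth v (so v) i) = nth v (so v) i.+1.
Proof.
move=> lt; have := @fcycle_nth _ _ _ v i (rr_cycle (rot v)).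
rewrite !nth_cat lt (ltnW lt); apply; rewrite size_cat; exact: ltn_addr.
Qed.

Lemma si_next v i : i.+1 < size (si v) ->
  cM v (nth v (si v) i) = nth v (si v) i.+1.
Proof.
move=> lt; have := @fcycle_nth _ _ _ v (size (so v) + i) (rr_cycle (rot v)).
rewrite -addnS size_cat ltn_add2l => /(_ lt).
by rewrite !nth_cat !ltnNge !leq_addr /= !addKn.
Qed.

Lemma so_si v : v != N -> v != S -> cM v (last v (so v)) = ri v.
Proof.
move=> /so_neq0 vN /si_neq0 vS; have := rr_cycle (rot v); rewrite /ri.
case: (so v) vN => // x p _; case: (si v) vS => // y q _.
by rewrite /= rcons_cat cat_path /= => /and3P[_ /eqP].
Qed.

Lemma si_so v : v != N -> v != S -> cM v (last v (si v)) = lo v.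
Proof.
move=> /so_neq0 vN /si_neq0 vS; have := rr_cycle (rot v); rewrite /lo.
case: (so v) vN => // x p _; case: (si v) vS => // y q _.
by rewrite /= rcons_cat cat_path /= rcons_path => /and3P[_ _ /andP[_ /eqP]].
Qed.

Lemma so_S : lo S = W /\ last S (so S) = E.
Proof. exact: rr_S (rot S) erefl. Qed.
Lemma si_N : ri N = E /\ last N (si N) = W.
Proof. exact: rr_N (rot N) erefl. Qed.
Lemma so_W : so W = [:: N] /\ si W = [:: S].
Proof. by apply: (rr_WE (rot W)); left. Qed.
Lemma so_E : so E = [:: N] /\ si E = [:: S].
Proof. by apply: (rr_WE (rot E)); right. Qed.

Lemma loW : lo W = N. Proof. by rewrite /lo (so_W).1. Qed.
Lemma loE : lo E = N. Proof. by rewrite /lo (so_E).1. Qed.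
Lemma riW : ri W = S. Proof. by rewrite /ri (so_W).2. Qed.
Lemma riE : ri E = S. Proof. by rewrite /ri (so_E).2. Qed.

Lemma outer_cwM : [/\ cM E N = S, cM S E = W, cM W S = N & cM N W = E].
Proof.
split.
- have := so_si (v := E); rewrite !neqs (so_E).1 riE /=; exact.
- have := rr_cycle (rot S); rewrite si_S cats0; have [] := so_S; rewrite /lo.
  have : so S != [::] by apply: so_neq0; rewrite neqs.
  by case: (so S) => //= x p _ -> lp; rewrite rcons_path lp => /andP[_ /eqP].
- have := si_so (v := W); rewrite !neqs (so_W).2 loW /=; exact.
- have := rr_cycle (rot N); rewrite so_N; have [] := si_N; rewrite /ri.
  have : si N != [::] by apply: si_neq0; rewrite neqs.
  by case: (si N) => //= x p _ -> lp; rewrite rcons_path lp => /andP[_ /eqP].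
Qed.

Definition inU v a b := [&& fconnect lo v a, a != N & b == lo a].
Definition inD v a b := [&& fconnect ri v b, b != S & a == ri b].
Definition inP v a b := inU v a b || inD v a b.

Lemma inU_arc v a b : inU v a b -> o a b.
Proof. by case/and3P=> _ aN /eqP ->; apply: lo_arc. Qed.
Lemma inD_arc v a b : inD v a b -> o a b.
Proof. by case/and3P=> _ aN /eqP ->; apply: ri_arc. Qed.
Lemma inP_arc v a b : inP v a b -> o a b.
Proof. by case/orP=> [/inU_arc|/inD_arc]. Qed.

Lemma fconnect_lo_rank v a : fconnect lo v a -> rk v <= rk a.
Proof.
move=> /iter_findex <-; elim: (findex _ _ _) => //= n /leq_trans; apply.
by have [->|/lo_arc/(red_rank_lt HT HX)/ltnW //] := eqVneq (iter n lo v) N; rewrite lo_N.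
Qed.
Lemma fconnect_ri_rank v a : fconnect ri v a -> rk a <= rk v.
Proof.
move=> /iter_findex <-; elim: (findex _ _ _) => //= n; apply: leq_trans.
by have [->|/ri_arc/(red_rank_lt HT HX)/ltnW //] := eqVneq (iter n ri v) S; rewrite ri_S.
Qed.

Lemma so_mem_nth v a : o v a -> exists2 i, i < size (so v) & a = nth v (so v) i.
Proof. by rewrite -memso => /(nthP v)[i lt <-]; exists i. Qed.
Lemma si_mem_nth v a : o a v -> exists2 i, i < size (si v) & a = nth v (si v) i.
Proof. by rewrite -memsi => /(nthP v)[i lt <-]; exists i. Qed.
Lemma so_nth_arc v i : i < size (so v) -> o v (nth v (so v) i).
Proof. by move=> lt; rewrite -memso mem_nth. Qed.
Lemma si_nth_arc v i : i < size (si v) -> o (nth v (si v) i) v.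
Proof. by move=> lt; rewrite -memsi mem_nth. Qed.

Lemma so_nth_lo v i : i < size (so v) -> (nth v (so v) i == lo v) = (i == 0).
Proof.
move=> lt; rewrite /lo -nth0 nth_uniq ?so_uniq //; exact: leq_ltn_trans lt.
Qed.
Lemma si_nth_ri v i : i < size (si v) -> (nth v (si v) i == ri v) = (i == 0).
Proof.
move=> lt; rewrite /ri -nth0 nth_uniq ?si_uniq //; exact: leq_ltn_trans lt.
Qed.

Lemma arc_outer_dart a b : o a b -> (a, b) \in outer_darts T ->
  (a, b) = (S, W) \/ (a, b) = (W, N).
Proof.
move=> oab; rewrite /outer_darts !inE -!orbA => /or4P[] /eqP[e1 e2]; subst a b; auto.
- by rewrite (red_arc_N HT HX) in oab.
- by rewrite (red_arc_S HT HX) in oab.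
Qed.

Lemma rev_arc_outer_dart a b : o a b -> (b, a) \in outer_darts T ->
  (a, b) = (E, N) \/ (a, b) = (S, E).
Proof.
move=> oab; rewrite /outer_darts !inE -!orbA => /or4P[] /eqP[e1 e2]; subst a b; auto.
- by rewrite (red_arc_S HT HX) in oab.
- by rewrite (red_arc_N HT HX) in oab.
Qed.

(** Links the definition of the drawing to the list [so]: the neighbour that precedes its head in
    the red map is not outgoing, except at [S], where all arcs go out and the clause on outer darts
    decides. *)
Lemma leftmost_outE v u : leftmost_out T o v u = (v != N) && (u == lo v).
Proof.
apply/idP/andP=> [/andP[ou h]|[vN /eqP ->]].
  split; first exact: arc_neqN ou.
  have [i lt eu] := so_mem_nth ou; rewrite eu so_nth_lo //.
  case: i lt eu => // i lt eu.
  case/orP: h => [/(arc_outer_dart ou)[]|/forallP/(_ (nth v (so v) i))].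
  - move=> [ev eW]; have [e _] := so_S; subst v.
    by have := so_nth_lo lt; rewrite -eu eW e eqxx.
  - by move=> [ev eN]; move: lt; rewrite ev (so_W).1.
  - rewrite so_next // -eu eqxx andbT red_mapE so_nth_arc; last exact: ltnW.
    by [].
apply/andP; split; first exact: lo_arc.
have [->|vS] := eqVneq v S.
  by have [-> _] := so_S; have [_ _ -> _] := outer_dart_mem T.
apply/orP; right; apply/forallP=> w; apply/implyP=> /andP[_ /eqP cw_w].
apply/negP=> ow; have [i lt ew] := so_mem_nth ow.
have [lt'|le] := ltnP i.+1 (size (so v)).
  by have := so_nth_lo lt'; rewrite -so_next // -ew cw_w eqxx.
have ew' : w = last v (so v).
  by rewrite ew -nth_last; congr nth; apply/eqP; rewrite eqn_leq; case: (so v) lt le => //= x p; lia.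
have := rr_uniq (rot v); rewrite cat_uniq => /and3P[_ /hasP[]].
exists (lo v); last by rewrite /= memso lo_arc.
by rewrite -cw_w ew' so_si // memsi ri_arc.
Qed.

Lemma rightmost_inE v u : rightmost_in T o v u = (v != S) && (u == ri v).
Proof.
apply/idP/andP=> [/andP[/= ou h]|[vN /eqP ->]].
  split; first exact: arc_neqS ou.
  have [i lt eu] := si_mem_nth ou; rewrite eu si_nth_ri //.
  case: i lt eu => // i lt eu.
  case/orP: h => [/(rev_arc_outer_dart ou)[]|/forallP/(_ (nth v (si v) i))].
  - move=> [eE ev]; have [e _] := si_N; subst v.
    by have := si_nth_ri lt; rewrite -eu eE e eqxx.
  - by move=> [eN ev]; move: lt; rewrite ev (so_E).2.
  - rewrite si_next // -eu eqxx andbT red_mapE /= si_nth_arc ?orbT //; exact: ltnW.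
apply/andP; split; first exact: ri_arc.
have [->|vS] := eqVneq v N.
  by have [-> _] := si_N; have [-> _ _ _] := outer_dart_mem T.
apply/orP; right; apply/forallP=> w; apply/implyP=> /andP[_ /eqP cw_w].
apply/negP=> /= ow; have [i lt ew] := si_mem_nth ow.
have [lt'|le] := ltnP i.+1 (size (si v)).
  by have := si_nth_ri lt'; rewrite -si_next // -ew cw_w eqxx.
have ew' : w = last v (si v).
  by rewrite ew -nth_last; congr nth; apply/eqP; rewrite eqn_leq; case: (si v) lt le => //= x p; lia.
have := rr_uniq (rot v); rewrite cat_uniq => /and3P[_ /hasP[]].
exists (ri v); first by rewrite memsi ri_arc.
by rewrite -cw_w ew' si_so //= memso lo_arc.
Qed.

Lemma connect_leftmost v a : connect (leftmost_out T o) v a = fconnect lo v a.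
Proof.
apply/idP/idP; apply: connect_sub => b c; rewrite ?leftmost_outE /=.
  by move=> /andP[_ /eqP ->]; apply: connect1; rewrite /= eqxx.
move=> /eqP <-; have [->|bN] := eqVneq b N; first by rewrite lo_N connect0.
by apply: connect1; rewrite leftmost_outE bN eqxx.
Qed.

Lemma connect_rightmost v a : connect (rightmost_in T o) v a = fconnect ri v a.
Proof.
apply/idP/idP; apply: connect_sub => b c; rewrite ?rightmost_inE /=.
  by move=> /andP[_ /eqP ->]; apply: connect1; rewrite /= eqxx.
move=> /eqP <-; have [->|bN] := eqVneq b S; first by rewrite ri_S connect0.
by apply: connect1; rewrite rightmost_inE bN eqxx.
Qed.

Lemma sep_pathE v a b : ((a, b) \in sep_path T o v) = inP v a b.
Proof.
rewrite !inE /= connect_leftmost connect_rightmost leftmost_outE rightmost_inE.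
by rewrite /inP /inU /inD.
Qed.

Lemma inUD v a b : inU v a b -> ~~ inD v a b.
Proof.
move=> /[dup] /inU_arc oab /and3P[va _ _]; apply/negP=> /and3P[vb _ _].
have := fconnect_lo_rank va; have := fconnect_ri_rank vb.
by have := red_rank_lt HT HX oab; lia.
Qed.

Local Open Scope ring_scope.

Let flow_props (F : V -> V -> rat) (s t : V) (P : V -> V -> bool) :=
  [/\ forall a b, F b a = - F a b, forall a b, ~~ aM a b -> F a b = 0,
      forall u, \sum_b F u b = (u == s)%:R - (u == t)%:R
    & forall a b, o a b -> F a b = (P a b)%:R].

Lemma up_flow v : exists F, flow_props F v N (inU v).
Proof.
have r_lt a : a != N -> (#|V| + 2 - rk (lo a) < #|V| + 2 - rk a)%N.
  move=> aN; have := red_rank_lt HT HX (lo_arc aN).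
  by have := red_rank_le T X (lo a); lia.
have [n en cnt] := walk_count_path lo_N r_lt v.
exists (walk_flow (fun t => iter t lo v) 0 n).
have cU a b : walk_count (fun t => iter t lo v) 0 n a b = (inU v a b)%:R by exact: cnt.
split=> [a b|a b|u|a b oab].
- exact: walk_flowN.
- rewrite red_mapE negb_or /walk_flow !cU => /andP[n1 n2].
  by rewrite (negPf (contra (@inU_arc v a b) n1)) (negPf (contra (@inU_arc v b a) n2)) subrr.
- by rewrite walk_flow_div //= en (eq_sym v) (eq_sym N).
- rewrite /walk_flow !cU.
  by rewrite (negPf (contra (@inU_arc v b a) (red_arc_asym HT HX oab))) subr0.
Qed.

Lemma down_flow v : exists F, flow_props F S v (inD v).
Proof.
have r_lt a : a != S -> (rk (ri a) < rk a)%N.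
  by move=> aN; apply: (red_rank_lt HT HX (ri_arc aN)).
have [n en cnt] := walk_count_path ri_S r_lt v.
exists (fun a b => walk_flow (fun t => iter t ri v) 0 n b a).
have cU a b : walk_count (fun t => iter t ri v) 0 n b a = (inD v a b)%:R by exact: cnt.
split=> [a b|a b|u|a b oab].
- exact: walk_flowN.
- rewrite red_mapE negb_or /walk_flow !cU => /andP[n1 n2].
  by rewrite (negPf (contra (@inD_arc v a b) n1)) (negPf (contra (@inD_arc v b a) n2)) subrr.
- under eq_bigr do rewrite walk_flowN; rewrite sumrN walk_flow_div //= en opprB.
  by rewrite (eq_sym v) (eq_sym S).
- rewrite /walk_flow !cU.
  by rewrite (negPf (contra (@inD_arc v b a) (red_arc_asym HT HX oab))) subr0.
Qed.

Lemma path_flow v : exists F, flow_props F S N (inP v).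
Proof.
have [F1 [n1 z1 d1 j1]] := up_flow v; have [F2 [n2 z2 d2 j2]] := down_flow v.
exists (fun a b => F1 a b + F2 a b); split=> [a b|a b nab|u|a b oab].
- by rewrite n1 n2 opprD.
- by rewrite z1 ?z2 ?addr0.
- by rewrite big_split /= d1 d2; ring.
- rewrite j1 // j2 // /inP; have := @inUD v a b.
  case: (inU v a b) => [/(_ isT)/negPf ->|_]; first by rewrite addr0.
  by rewrite add0r.
Qed.

(** A potential on the faces of the red map, written on the darts of [T]: as it does not jump across
    blue edges, it takes one value on all the triangles that make up a red face. *)
Record face_potential (g : V -> V -> rat) : Prop := FacePotential {
  fp_face : forall u v, aT u v -> g v (cT v u) = g u v;
  fp_blue : forall u v, aT u v -> ~~ aM u v -> g u v = g v u;
  fp_outer : forall d, d \in outer_darts T -> g d.1 d.2 = 0 }.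

Lemma face_potential_ex (phi : V -> V -> rat) :
    (forall a b, phi b a = - phi a b) -> (forall a b, ~~ aM a b -> phi a b = 0) ->
    (forall u, \sum_b phi u b = 0) ->
  exists2 g, face_potential g & forall a b, o a b -> g a b - g b a = phi a b.
Proof.
move=> pN p0 pD; have [||//|g [gI gp]] := circulation_potential plT (phi := phi).
- exact: pN.
- by move=> a b; apply: contraNeq => /eqP p; apply: (red_map_adj HT HX); apply: contraT => /p0.
exists (fun u v => g u v - g N E); last first.
  by move=> a b /(red_arc_adj HT HX)/gp <-; ring.
split=> [u v uv|u v uv nuv|d dO].
- by rewrite gI.
- by congr (_ - _); apply/eqP; rewrite -subr_eq0 gp // p0.
- have [[NE _ _ _] _] := adj_outer HT.
  apply/eqP; rewrite subr_eq0; apply/eqP.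
  apply: (face_constant wfT (d := (N, E)) gI); first by rewrite inE.
  by rewrite (outer_face HT).
Qed.

Lemma fp_cw g u v : face_potential g -> aT u v -> g v (cM v u) = g u v.
Proof.
move=> pg uv; have vu : aT v u by rewrite aC.
set s := orbit (cT v) (cT v u).
have cE : cM v u = nth u s (find (aM v) s) by [].
have vc := plane_cw_adj plT vu.
have mems a : (a \in s) = aT v a by rewrite /s -fconnect_orbit (plane_cwP plT).
have hs : has (aM v) s.
  have [a va] : exists a, aM v a.
    have [->|vN] := eqVneq v N.
      by exists E; rewrite red_mapE; have [_ _ _ ->] := red_arcs_outer T X; rewrite orbT.
    by exists (lo v); rewrite red_mapE lo_arc.
  by apply/hasP; exists a; rewrite // mems (red_map_adj HT HX).
have lt := hs; rewrite has_find in lt.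
rewrite cE; have: (find (aM v) s <= find (aM v) s)%N by [].
move: {1 3}(find (aM v) s) => i; elim: i => [|i IH] le.
  by rewrite /s /orbit -orderSpred /= (fp_face pg).
have lti : (i < size s)%N by apply: leq_trans lt; apply: ltnW.
have ltS : (i.+1 < size s)%N by apply: leq_ltn_trans lt.
have vi : aT v (nth u s i) by rewrite -mems mem_nth.
have iv : aT (nth u s i) v by rewrite aC.
rewrite -IH ?(ltnW le) //.
have sE j : (j < size s)%N -> nth u s j = iter j (cT v) (cT v u).
  move=> ltj; rewrite (set_nth_default (cT v u)) //.
  by move: ltj; rewrite size_orbit => ltj; rewrite /s /orbit nth_traject.
have -> : nth u s i.+1 = cT v (nth u s i) by rewrite !sE.
rewrite (fp_face pg iv) [in RHS](fp_blue pg vi) //.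
by rewrite (before_find u le).
Qed.

Definition leftside a b := ((a, b) == (S, W)) || ((a, b) == (W, N)).
(** The potential of a path should be 1 on the part of the outer face to the left of the path and 0
    on the part to the right. The outer face keeps the single value 0, and [Lf], the value on the
    left of an arc, is corrected along the left side [S W N]; the jump across an arc is then 1 on
    the path and 0 elsewhere. *)
Definition Lf (g : V -> V -> rat) a b := if leftside a b then 1 else g a b.

Record path_potential (v : V) (g : V -> V -> rat) : Prop := PathPotential {
  pp_face : face_potential g;
  pp_jump : forall a b, o a b -> Lf g a b - g b a = (inP v a b)%:R }.

Lemma leftside_outer a b : leftside a b -> (a, b) \in outer_darts T.
Proof. by have [_ _ h1 h2] := outer_dart_mem T; case/orP=> /eqP ->. Qed.

Lemma inP_S a b : o a b -> inP S a b = leftside a b.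
Proof.
move=> oab; have neb := arc_neqS oab; have nea := arc_neqN oab.
have -> : inP S a b = inU S a b.
  rewrite /inP orbC; case: (boolP (inD S a b)) => // /and3P[/iter_findex + bS _].
  have rS n : iter n ri S = S by elim: n => //= n ->; exact: ri_S.
  by rewrite rS => e; rewrite e eqxx in bS.
rewrite /inU nea /leftside !xpair_eqE.
have lN a' : fconnect lo N a' = (a' == N).
  apply/idP/eqP=> [/iter_findex <-|-> //].
  by elim: (findex _ _ _) => //= n ->; exact: lo_N.
have [lS _] := so_S.
rewrite fconnect_eqVf lS fconnect_eqVf loW lN (negPf nea) orbF.
rewrite (eq_sym S) (eq_sym W).
case: (a =P S) => [->|_] /=; first by rewrite lS neqs orbF.
by case: (a =P W) => [->|_] //=; rewrite loW.
Qed.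

(** All separating paths are unit flows from [S] to [N], so that the path of [v] minus the left
    side, which is the path of [S], is a circulation. [Lf] adds the left side back. *)
Lemma path_potential_ex v : exists g, path_potential v g.
Proof.
have [F1 [n1 z1 d1 j1]] := path_flow v; have [F2 [n2 z2 d2 j2]] := path_flow S.
have [||u|g pg jg] := @face_potential_ex (fun a b => F1 a b - F2 a b).
- by move=> a b; rewrite n1 n2; ring.
- by move=> a b nab; rewrite z1 // z2 // subrr.
- by rewrite sumrB d1 d2 subrr.
exists g; split=> // a b oab; rewrite -j1 // /Lf.
have := jg _ _ oab; rewrite j2 // inP_S //.
case: ifP => [ls|_ ->]; last by rewrite subr0.
have -> : g a b = 0 by apply: (fp_outer pg (leftside_outer ls)).
by move=> e; rewrite -[F1 a b](subrK 1%:R) -e; ring.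
Qed.

Section PathPotential.

Variables (g : V -> V -> rat).
Hypothesis pg : face_potential g.

(** The corner between two consecutive outgoing arcs is on the right of the first and on the left of
    the second. The correction in [Lf] is harmless here, the arcs of the left side being leftmost.
    The next lemmas treat the other corners at [v] in the same way. *)
Lemma Lf_so v i : (i.+1 < size (so v))%N ->
  g (nth v (so v) i) v = Lf g v (nth v (so v) i.+1).
Proof.
move=> lt; have ov := so_nth_arc (ltnW lt).
have -> : Lf g v (nth v (so v) i.+1) = g v (nth v (so v) i.+1).
  rewrite /Lf ifF //; apply/negP=> /orP[]/eqP[ev e].
    by have := so_nth_lo lt; rewrite e ev (so_S).1 eqxx.
  by move: lt; rewrite ev (so_W).1.
rewrite -so_next // fp_cw // aC; exact: (red_arc_adj HT HX ov).
Qed.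

Lemma g_si v i : (i.+1 < size (si v))%N ->
  g (nth v (si v) i) v = g v (nth v (si v) i.+1).
Proof.
move=> lt; have ov := si_nth_arc (ltnW lt).
by rewrite -si_next // fp_cw //; apply: (red_arc_adj HT HX ov).
Qed.

Lemma si_leftside v i : (i.+1 < size (si v))%N ->
  leftside (nth v (si v) i) v = false.
Proof.
move=> lt; apply/negP=> /orP[]/eqP[e ev]; subst v.
  by move: lt; rewrite (so_W).2.
have [_ lW] := si_N.
have : nth N (si N) i == nth N (si N) (size (si N)).-1 by rewrite e nth_last lW.
rewrite nth_uniq ?si_uniq //; last by case: (si N) lt.
  by move=> /eqP ei; move: lt; rewrite ei; case: (si N) => //= x p; rewrite ltnn.
exact: ltnW.
Qed.

Lemma Lf_si v i : (i.+1 < size (si v))%N ->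
  Lf g (nth v (si v) i) v = g v (nth v (si v) i.+1).
Proof. by move=> lt; rewrite /Lf si_leftside // g_si. Qed.

Lemma g_up v : v != N -> v != S -> g (last v (si v)) v = g v (lo v).
Proof.
move=> vN vS; rewrite -si_so // fp_cw //; apply: (red_arc_adj HT HX).
by rewrite -memsi; move/si_neq0: vS; case: (si v) => //= x p _; apply: mem_last.
Qed.

Lemma Lf_up v : v != N -> v != S -> Lf g (last v (si v)) v = Lf g v (lo v).
Proof.
move=> vN vS; rewrite /Lf g_up //; congr (if _ then _ else _).
rewrite /leftside !xpair_eqE (negPf vN) (negPf vS) andbF /= orbF.
have [->|vW] := eqVneq v W; last by rewrite andbF.
by rewrite (so_W).2 loW !eqxx.
Qed.

Lemma g_down v : v != N -> v != S -> g (last v (so v)) v = g v (ri v).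
Proof.
move=> vN vS; rewrite -so_si // fp_cw // aC; apply: (red_arc_adj HT HX).
by rewrite -memso; move/so_neq0: vN; case: (so v) => //= x p _; apply: mem_last.
Qed.

End PathPotential.

Lemma nth_descend (A : Type) (x : A) (s : seq A) (P : A -> Prop) :
    (s <> [::] -> P (last x s)) ->
    (forall i, (i.+1 < size s)%N -> P (nth x s i.+1) -> P (nth x s i)) ->
  forall i, (i < size s)%N -> P (nth x s i).
Proof.
move=> Pl Ps i; have [k] := ubnP (size s - i); elim: k i => // k IH i le_k lt.
have [lt'|le] := ltnP i.+1 (size s); first by apply: Ps => //; apply: IH => //; lia.
have -> : i = (size s).-1 by case: (s) lt le => //= y p; lia.
by rewrite nth_last; apply: Pl; case: (s) lt.
Qed.

(* Walking to the left: cross the ingoing arcs of the head one after the other,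
   then move up along its leftmost outgoing arc. *)
Lemma left_ind (P : V -> V -> Prop) : P W N ->
    (forall q i, (i.+1 < size (si q))%N ->
       P (nth q (si q) i.+1) q -> P (nth q (si q) i) q) ->
    (forall q, q != N -> q != S -> P q (lo q) -> P (last q (si q)) q) ->
  forall p q, o p q -> P p q.
Proof.
move=> PWN Ps Pl p q; have [k] := ubnP (#|V| + 2 - rk q).
elim: k p q => // k IH p q le_k opq; have qS := arc_neqS opq.
have [i lt ->] := si_mem_nth opq.
apply: (nth_descend (P := fun a => P a q)) lt => [_|j]; last exact: Ps.
have [->|qN] := eqVneq q N; first by have [_ ->] := si_N.
apply: Pl => //; apply: IH; last exact: lo_arc.
have := red_rank_lt HT HX (lo_arc qN); have := red_rank_le T X (lo q); lia.
Qed.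

(** Mirror image of [left_ind]: the outgoing arcs of the tail are crossed towards the right, then
    the walk moves down along the rightmost ingoing arc, until it reaches the arc from [S] to
    [E]. *)
Lemma right_ind (P : V -> V -> Prop) : P S E ->
    (forall p i, (i.+1 < size (so p))%N ->
       P p (nth p (so p) i.+1) -> P p (nth p (so p) i)) ->
    (forall p, p != N -> p != S -> P (ri p) p -> P p (last p (so p))) ->
  forall p q, o p q -> P p q.
Proof.
move=> PSE Ps Pl p q; have [k] := ubnP (rk p).
elim: k p q => // k IH p q le_k opq; have pN := arc_neqN opq.
have [i lt ->] := so_mem_nth opq.
apply: (nth_descend (P := P p)) lt => [_|j]; last exact: Ps.
have [->|pS] := eqVneq p S; first by have [_ ->] := so_S.
apply: Pl => //; apply: IH; last exact: ri_arc.
by have := red_rank_lt HT HX (ri_arc pS); lia.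
Qed.

End Potentials.

(** * Monotonicity of the abscissa *)


Lemma triangle_face (V : finType) (T : framed_map V) (u v : V) :
    irreducible_triangulation T -> adj T u v -> (u, v) \notin outer_darts T ->
  let c := cw T v u in
  [/\ adj T v c, adj T c u, cw T c v = u, cw T u c = v
    & (v, c) \notin outer_darts T /\ (c, u) \notin outer_darts T].
Proof.
move=> HT uv nO c; have plT := triangulation_plane HT.
have wfT := plane_well_rotated plT; pose f := face_next T; pose d := (u, v).
have dM : d \in darts T by rewrite inE.
have FO : face_of T d != outer_darts T by apply: contraNneq nO => <-; apply: mem_face_of.
have o3 : order f d = 3.
  have [_ _ h _] := HT; rewrite -(h _ (mem_faces dM) FO).
  by rewrite /face_of cardsE.
have it3 : iter 3 f d = d.
  by rewrite -o3 (iter_order_in (face_next_darts wfT) (face_next_inj wfT)).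
have [e1 e2] : cw T c v = u /\ cw T (cw T c v) c = v by case: it3.
have outF d' : d' \in face_of T d -> d' \notin outer_darts T.
  move=> d'F; apply/negP=> d'O; move/negP: FO; apply; apply/eqP.
  rewrite -(face_of_eq wfT dM d'F) -(outer_face HT); apply: (face_of_eq wfT).
    by rewrite inE; have [[]] := adj_outer HT.
  by rewrite (outer_face HT).
have vc : adj T v c by apply: plane_cw_adj; rewrite // plane_adjC.
have cu : adj T c u by rewrite -e1; apply: plane_cw_adj; rewrite // plane_adjC.
split=> //; first by rewrite -{1}e1.
split; apply: outF; rewrite inE; first exact: (fconnect1 f d).
have -> : (c, u) = iter 2 f d by rewrite /= /f /face_next /= -/c e1.
exact: fconnect_iter.
Qed.

Section Abscissa.

Variables (V : finType) (T : framed_map V) (X : bicolor_orientation V).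
Hypotheses (HT : irreducible_triangulation T) (HX : transversal_pair T X).

Local Notation N := (vN T).
Local Notation E := (vE T).
Local Notation S := (vS T).
Local Notation W := (vW T).
Local Notation cT := (cw (fmap T)).
Local Notation aT := (adj (fmap T)).
Local Notation o := (red_arc T X).
Local Notation M := (orient_map T (red_arc T X)).
Local Notation cM := (cw (orient_map T (red_arc T X))).
Local Notation aM := (adj (orient_map T (red_arc T X))).
Local Notation cls := (cls T X).
Local Notation rk := (red_rank T X).

Let plT := triangulation_plane HT.
Let aC := plane_adjC plT.

Variables (so si : V -> seq V).
Hypothesis rot : forall v, red_rotation T X v (so v) (si v).

Local Notation loX := (lo so).
Local Notation ri := (ri si).
Local Notation inPX := (inP T so si).
Local Notation LfX := (Lf T).
Local Notation pp := (path_potential T X so si).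

Local Open Scope ring_scope.

Lemma pp_le v g a b : pp v g -> o a b -> g b a <= LfX g a b.
Proof. by move=> pg oab; rewrite -subr_ge0 (pp_jump pg oab) ler0n. Qed.

(** Starting with 1 on the left side of the box, the value drops by one at each arc of the path that
    is crossed and is otherwise constant. The bound from the other side, [g_ge0], starts with 0 on
    the right side; together they leave only the values 0 and 1. *)
Lemma Lf_le1 v g a b : pp v g -> o a b -> LfX g a b = 1 \/ LfX g a b <= 0.
Proof.
move=> pg; move: a b; apply: (left_ind HT HX rot) => [|q i lt|q qN qS].
- by rewrite /Lf /leftside eqxx orbT; left.
- rewrite (Lf_si HT HX rot (pp_face pg) lt).
  have := pp_jump pg (si_nth_arc rot lt); set x := LfX _ _ _; set y := g _ _.
  move/eqP; rewrite subr_eq addrC -subr_eq => /eqP <-.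
  case: (inPX _ _ _) => /=; last by rewrite subr0.
  by case=> [->|le]; right; rewrite ?subrr // subr_le0 (le_trans le).
- by rewrite (Lf_up HT HX rot (pp_face pg)).
Qed.

Lemma g_ge0 v g a b : pp v g -> o a b -> 0 <= g b a.
Proof.
move=> pg; move: a b; apply: (right_ind HT HX rot) => [|p i lt|p pN pS].
- by have [_ /(fp_outer (pp_face pg)) /= -> _ _] := outer_dart_mem T.
- rewrite (Lf_so HT HX rot (pp_face pg) lt) => /le_trans; apply.
  exact: (pp_le pg (so_nth_arc rot lt)).
- by rewrite (g_down HT HX rot (pp_face pg)).
Qed.

Lemma Lf01 v g a b : pp v g -> o a b -> LfX g a b = 1 \/ LfX g a b = 0.
Proof.
move=> pg oab; have [->|le] := Lf_le1 pg oab; [by left | right].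
apply/eqP; rewrite eq_le le /=; exact: le_trans (g_ge0 pg oab) (pp_le pg oab).
Qed.

Lemma g01 v g a b : pp v g -> o a b ->
  if inPX v a b then LfX g a b = 1 /\ g b a = 0
  else LfX g a b = g b a /\ (g b a = 0 \/ g b a = 1).
Proof.
move=> pg oab; have := pp_jump pg oab; have := Lf01 pg oab.
have := g_ge0 pg oab; set x := LfX _ _ _; set y := g _ _ => y0 xx.
move/eqP; rewrite subr_eq addrC -subr_eq => /eqP ey; rewrite -ey in y0 *.
case: (inPX _ _ _) y0 => /= y0; last by rewrite subr0; split=> //; case: xx; auto.
by case: xx y0 => ->; rewrite ?subrr // sub0r oppr_ge0 ler10.
Qed.

Lemma inP_si v q i : (i.+1 < size (si q))%N -> inPX v (nth q (si q) i.+1) q ->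
  inU T so v (nth q (si q) i.+1) q.
Proof. by move=> lt /orP[//|/and3P[_ _]]; rewrite (si_nth_ri rot). Qed.

Section Compare.

Variables (u v : V) (gu gv : V -> V -> rat).
Hypotheses (pu : pp u gu) (pv : pp v gv).
Hypothesis key : forall a, fconnect loX v a -> a != N -> gu (loX a) a = 0.

(** Walking to the left crosses only ingoing arcs that are not rightmost, so that it meets the path
    of [v] only on its upper half. There [key] gives [gu = 0] on the right of the arc. At any other
    arc [gv] has no jump, so the value 0 continues to the left, and by induction [gu] is 0 there
    too. *)
Lemma Lf_compare p q : o p q -> LfX gu p q <= LfX gv p q.
Proof.
move=> opq; suff h : LfX gv p q = 0 -> LfX gu p q = 0.
  have [->|e] := Lf01 pv opq; last by rewrite e h.
  by have [->|->] := Lf01 pu opq.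
move: p q opq; apply: (left_ind HT HX rot) => [|q i lt|q qN qS].
- by rewrite /Lf /leftside eqxx orbT => /eqP; rewrite oner_eq0.
- rewrite (Lf_si HT HX rot (pp_face pu) lt) (Lf_si HT HX rot (pp_face pv) lt).
  have oi := si_nth_arc rot lt; move=> IH e.
  have := g01 pv oi; case: (boolP (inPX v _ q)) => [ip _|_ [e' _]].
    have /and3P[va aN /eqP eq] := inP_si lt ip.
    by rewrite [X in gu X]eq; apply: key.
  rewrite e in e'; have := IH e'; have := g01 pu oi.
  by case: (inPX u _ q) => [[]//|[-> _]].
- by rewrite (Lf_up HT HX rot (pp_face pu)) // (Lf_up HT HX rot (pp_face pv)).
Qed.

Lemma g_compare p q : o p q -> gu q p <= gv q p.
Proof.
move: p q; apply: (right_ind HT HX rot) => [|p i lt|p pN pS].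
- have [_ oE _ _] := outer_dart_mem T.
  by have /= -> := fp_outer (pp_face pu) oE; have /= -> := fp_outer (pp_face pv) oE.
- rewrite (Lf_so HT HX rot (pp_face pu) lt) (Lf_so HT HX rot (pp_face pv) lt) => _.
  exact: (Lf_compare (so_nth_arc rot lt)).
- by rewrite (g_down HT HX rot (pp_face pu)) ?(g_down HT HX rot (pp_face pv)).
Qed.

End Compare.

Lemma g_around u g z : pp u g -> z != N -> z != S ->
    (forall b, o z b -> ~~ inPX u z b) -> (forall a, o a z -> ~~ inPX u a z) ->
  forall a, o a z -> g z a = g (loX z) z.
Proof.
move=> pg zN zS nout nin a oaz.
have outs i : (i < size (so z))%N -> g (nth z (so z) i) z = g (loX z) z.
  elim: i => [|i IH] lt; first by rewrite nth0.
  have oi := so_nth_arc rot lt; have := g01 pg oi; rewrite (negPf (nout _ oi)) => -[<- _].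
  by rewrite -(Lf_so HT HX rot (pp_face pg) lt) IH // ltnW.
have [i lt ->] := si_mem_nth rot oaz; elim: i lt => [|i IH] lt.
  rewrite nth0 -/(ri z) -(g_down HT HX rot (pp_face pg)) // -nth_last outs //.
  by have := so_neq0 rot zN; case: (so z).
have oi := si_nth_arc rot (ltnW lt).
rewrite -(Lf_si HT HX rot (pp_face pg) lt).
by have := g01 pg oi; rewrite (negPf (nin _ oi)) => -[-> _]; apply: IH; apply: ltnW.
Qed.

Lemma g_outs u g w : pp u g -> u != N -> o u w -> g w u = 0.
Proof.
move=> pg uN /(so_mem_nth rot)[i lt ->]; elim: i lt => [|i IH] lt.
  have ou := lo_arc rot uN; have := g01 pg ou.
  by rewrite {1}/inP /inU connect0 uN eqxx /= nth0 => -[].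
have oi := so_nth_arc rot lt; apply/eqP; rewrite eq_le (g_ge0 pg oi) andbT.
apply: le_trans (pp_le pg oi) _.
by rewrite -(Lf_so HT HX rot (pp_face pg) lt) IH // ltnW.
Qed.

(** At a vertex above [v], either the path of [v] has joined the upper half of the path of [u], and
    [g] is 0 on the right of the common arc; or the path of [u] avoids this vertex, its lower half
    by the rank, and all the faces around it share the value 0 brought by the previous arc. *)
Lemma key_red u v g : pp u g -> o u v ->
  forall a, fconnect loX v a -> a != N -> g (loX a) a = 0.
Proof.
move=> pg ouv a /iter_findex <-; have uN := arc_neqN HT HX ouv.
have ruv := red_rank_lt HT HX ouv.
have onU z : fconnect loX u z -> z != N -> g (loX z) z = 0.
  move=> uz zN; have := g01 pg (lo_arc rot zN).
  by rewrite /inP /inU uz zN eqxx => -[].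
have offP z : fconnect loX v z -> z != N -> z != S -> ~~ fconnect loX u z ->
    forall b, o b z -> g z b = g (loX z) z.
  move=> vz zN zS nuz; have rz : (rk u < rk z)%N.
    exact: leq_trans ruv (fconnect_lo_rank HT HX rot vz).
  have nD y : (rk u < rk y)%N -> fconnect ri u y = false.
    by move=> ry; apply/negP=> /(fconnect_ri_rank HT HX rot); rewrite leqNgt ry.
  apply: (g_around pg) => // b ob; rewrite /inP /inU /inD negb_or.
    rewrite (negPf nuz) nD //; apply: ltn_trans rz _; exact: red_rank_lt.
  rewrite nD // andbT; apply: contra nuz => /and3P[ub _ /eqP ->].
  by apply: connect_trans ub _; apply: fconnect1.
elim: (findex _ _ _) => [|n IH] /= aN.
  have [uz|nuz] := boolP (fconnect loX u v); first exact: onU.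
  rewrite -(offP v _ aN _ nuz u ouv) //; last exact: arc_neqS ouv.
  exact: (g_outs pg uN).
set z := iter n loX v in IH aN *.
have zN : z != N by apply: contraNneq aN => ->; rewrite (lo_N HT HX rot).
have oz := lo_arc rot zN.
have vz : fconnect loX v (loX z) by rewrite -[loX z]/(iter n.+1 loX v) fconnect_iter.
have [uz|nuz] := boolP (fconnect loX u (loX z)); first exact: onU.
rewrite -(offP _ vz aN _ nuz z oz); last exact: arc_neqS oz.
exact: IH.
Qed.

Lemma blue_arcP u v : blue X u v ->
  [/\ inner_edge T u v, aT u v, cls u v = 1%N, cls v u = 3%N
    & ~~ aM u v /\ ~~ aM v u].
Proof.
move=> b; have i : inner_edge T u v by apply: (colored_inner HX); rewrite b orbT.
have uv : aT u v by case/andP: i.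
have buv : bl T X u v by rewrite /bl b.
have c1 := cls_bl HT HX buv; have c3 := cls_bl_in HT HX buv.
have vu : aT v u by rewrite aC.
have nr : ~~ aM u v.
  rewrite red_mapE !(red_arcE T X) (rdE HT HX uv) (rdE HT HX vu) c1 c3 /=.
  case/andP: i => _; rewrite /outer_edge /= !inE !xpair_eqE !negb_or.
  do 8!case: (_ == _) => //.
by split=> //; split=> //; move: nr; rewrite !red_mapE orbC.
Qed.

Lemma blue_ends u v : blue X u v ->
  [/\ v != N, v != S, v != W & [/\ u != N, u != S & u != E]].
Proof.
move=> /blue_arcP[i uv c1 c3 _]; have vu : aT v u by rewrite aC.
have no a b : outer_edge T a b -> (u, v) = (a, b) -> False.
  by move=> oe [eu ev]; case/andP: i; rewrite eu ev oe.
split; first 1 last.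
- by apply: contraTneq vu => ev; apply/negP=> vu; move: c3; rewrite ev cls_S -?ev //; case: ifP.
- by apply: contraTneq vu => ev; apply/negP=> vu; move: c3; rewrite ev cls_W -?ev //; case: ifP.
- split.
  + by apply: contraTneq uv => eu; apply/negP=> uv; move: c1; rewrite eu cls_N -?eu //; case: ifP.
  + apply: contraTneq uv => eu; apply/negP=> uv; move: c1; rewrite eu cls_S -?eu //.
    case: eqP => // ev _; apply: (no S E); last by rewrite eu ev.
    by rewrite /outer_edge /= !inE !eqxx !orbT.
  + by apply: contraTneq uv => eu; apply/negP=> uv; move: c1; rewrite eu cls_E -?eu //; case: ifP.
- apply: contraTneq vu => ev; apply/negP=> vu; move: c3; rewrite ev cls_N -?ev //.
  case: eqP => // eu _; apply: (no W N); last by rewrite eu ev.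
  by rewrite /outer_edge /= !inE !eqxx !orbT.
Qed.

Lemma lo_first v a : aT v a -> ~~ o v a -> o v (cT v a) -> loX v = cT v a.
Proof.
move=> va noa; rewrite -(rr_so (rot v)) /lo.
have := rr_so_path (rot v); have := rr_so (rot v).
case: (so v) => // x p mem /(_ x p erefl) pth; rewrite inE => /predU1P[-> //|cp].
have [z zx e] : exists2 z, z \in x :: p & cT v z = cT v a.
  elim: p x pth cp {mem} => //= y p IH x /andP[/eqP xy yp].
  rewrite inE => /predU1P[->|cp]; first by exists x; rewrite ?mem_head.
  by have [z zy e] := IH _ yp cp; exists z => //; rewrite inE zy orbT.
rewrite mem in zx; move: noa.
by rewrite -(plane_cw_inj plT (red_arc_adj HT HX zx) va e) zx.
Qed.

(** The blue edge lies in one face of the red map, on the right of the arc by which the path of [u]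
    arrives at [u] and on the left of the arc by which the path of [v] leaves [v]. *)
Lemma blue_value u v g : face_potential T X g -> blue X u v ->
  g v (loX v) = g u (ri u) /\ g v (loX v) = g u v.
Proof.
move=> pg /[dup] b /blue_arcP[_ uv c1 c3 [n1 n2]]; have vu : aT v u by rewrite aC.
have e1 : cM v u = loX v by apply: (rr_blue_in (rot v)).
have e2 : cM u v = ri u by apply: (rr_blue_out (rot u)).
have := fp_cw HT HX rot pg uv; have := fp_cw HT HX rot pg vu.
by rewrite e1 e2 => -> ->; rewrite (fp_blue pg uv).
Qed.

(** In the triangle on the left of the blue arc, exactly two corners change class, and the choice of
    the third one gives the cases. Outer edges of class 1 count as arcs of the red map. *)
Lemma blue_triangle u v : blue X u v -> exists c,
  [\/ loX v = c /\ o u c, loX v = c /\ blue X u c | o u c /\ blue X c v].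
Proof.
move=> /[dup] b /blue_arcP[iuv uv c1 c3 [n1 n2]]; have vu : aT v u by rewrite aC.
have [vN vS vW [uN uS uE]] := blue_ends b.
have nO : (u, v) \notin outer_darts T.
  by case/andP: iuv => _; rewrite /outer_edge /= negb_or => /andP[].
have [vc cu e1 e2 [nvc ncu]] := triangle_face HT uv nO; set c := cT v u in vc cu e1 e2 nvc ncu.
have nvu : (v, u) \notin outer_darts T.
  by case/andP: iuv => _; rewrite /outer_edge /= negb_or => /andP[].
have uc : aT u c by rewrite aC.
have s1 := cls_step HT HX vu nO; have s2 := cls_step HT HX uc ncu.
have cv : aT c v by rewrite aC.
have s3 := cls_step HT HX cv nvc.
rewrite -/c c3 in s1; rewrite e2 c1 in s2; rewrite e1 in s3.
have r1 := cls_rev HT HX vc; have r2 := cls_rev HT HX uc.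
have bl_blue a w : aT a w -> cls a w = 1%N -> blue X a w \/ o a w.
  move=> aw /eqP; rewrite -(blE HT HX aw) /bl => /orP[|h]; first by left.
  by right; rewrite red_arcE h orbT.
have rd_o a w : aT a w -> cls a w = 0%N -> o a w.
  by move=> aw /eqP; rewrite -(rdE HT HX aw) red_arcE => ->.
have loc : o v c -> loX v = c.
  move=> ovc; apply: lo_first => //.
  by move: n2; rewrite red_mapE negb_or => /andP[].
have l1 := cls_lt T X v c; have l2 := cls_lt T X u c.
exists c; case: s1 => s1.
- have c0 : cls u c = 0%N by move: s2 s3; rewrite r1 r2 s1; case: (cls u c) l2 => [|[|[|[|]]]] // _ [] // _ [].
  constructor 3; split; first exact: rd_o.
  have [//|oc] : blue X c v \/ o c v by apply: bl_blue; rewrite // r1 s1.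
  have ou := rd_o _ _ uc c0.
  move: oc; rewrite red_arcE => /orP[r|].
    by move: (cls_rd r); rewrite r1 s1.
  rewrite !inE !xpair_eqE (negPf vN) andbF /= => /andP[/eqP ec _].
  by have := arc_neqS HT HX ou; rewrite ec eqxx.
- have ovc : o v c by apply: rd_o; rewrite // s1.
  case: s2 => s2; last first.
    constructor 1; split; [exact: loc | apply: rd_o => //].
    by move: s2; case: (cls u c) l2 => [|[|[|[|]]]].
  have [bc|oc] := bl_blue _ _ uc (esym s2).
    by constructor 2; split; [exact: loc|].
  by constructor 1; split; [exact: loc|].
Qed.

(** Induction from the top, the triangle on the left of the blue arc replacing it by arcs with
    higher ends. If its third vertex [c] is [lo v], it remains to compare [u] with [c]. Otherwise
    [u] to [c] is red and [c] to [v] is blue, and the comparison of [u] with [c] is composed with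
    that of [c] with [v]. *)
Lemma key_blue u v g : blue X u v -> pp u g ->
  forall a, fconnect loX v a -> a != N -> g (loX a) a = 0.
Proof.
have [k] := ubnP ((#|V| + 2 - rk u) + (#|V| + 2 - rk v))%N.
elim: k u v g => // k IH u v g le_k b pg a va aN.
have [vN vS vW [uN uS uE]] := blue_ends b; have := blue_triangle b.
have gv : g (loX v) v = 0.
  have olo := lo_arc rot vN; apply/eqP; rewrite eq_le (g_ge0 pg olo) andbT.
  apply: le_trans (pp_le pg olo) _; rewrite /Lf /leftside !xpair_eqE (negPf vS) (negPf vW) /=.
  have [-> _] := blue_value (pp_face pg) b.
  have := g01 pg (ri_arc rot uS); rewrite /inP /inD connect0 uS eqxx orbT.
  by case=> _ ->.
have rkle := red_rank_le T X.
have split_a c : loX v = c -> (fconnect loX c a -> g (loX a) a = 0) -> g (loX a) a = 0.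
  move=> e h; move: va; rewrite fconnect_eqVf e => /orP[/eqP <- //|]; exact: h.
case=> c [[ec ouc]|[ec buc]|[ouc bcv]].
- apply: (split_a c ec) => ca; exact: (key_red pg ouc).
- apply: (split_a c ec) => ca; apply: (IH u c) => //.
  have := red_rank_lt HT HX (lo_arc rot vN); rewrite ec; move: (rkle c) le_k.
  by clear; lia.
- have [gc pc] := path_potential_ex HT HX rot c.
  have olo := lo_arc rot aN.
  have gc0 : gc (loX a) a = 0.
    apply: (IH c v) => //; have := red_rank_lt HT HX ouc; move: (rkle c) le_k.
    by clear; lia.
  apply/eqP; rewrite eq_le (g_ge0 pg olo) andbT -gc0.
  exact: (g_compare pg pc (key_red pg ouc)).
Qed.

(** * Faces of the red map *)

Lemma red_map_well_rotated : well_rotated M.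
Proof.
have mem v u : aM v u = (u \in so v ++ si v).
  by rewrite mem_cat (rr_so (rot v)) (rr_si (rot v)).
split=> [u v|v u|v u w].
- by rewrite !red_mapE orbC.
- by rewrite !mem; apply: (mem_fcycle (rr_cycle (rot v))).
- by rewrite !mem => mu mw; apply: (inj_cycle (rr_cycle (rot v))).
Qed.
Let wfM := red_map_well_rotated.

Lemma red_outer_face : face_of M (N, E) = outer_darts T.
Proof.
have [c1 c2 c3 c4] := outer_cwM HT HX rot.
have it k : iter k (face_next M) (N, E) \in [:: (N, E); (E, S); (S, W); (W, N)].
  elim: k => [|k]; first exact: mem_head.
  rewrite iterS; move: (iter k _ _) => d; rewrite !inE /face_next => /or4P[]/eqP -> /=;
    by rewrite ?c1 ?c2 ?c3 ?c4 eqxx ?orbT.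
apply/setP=> d; rewrite /outer_darts !inE -!orbA; apply/idP/idP.
  by move=> /iter_findex <-; have := it (findex (face_next M) (N, E) d); rewrite !inE.
have i1 : face_next M (N, E) = (E, S) by rewrite /face_next /= c1.
have i2 : face_next M (E, S) = (S, W) by rewrite /face_next /= c2.
have i3 : face_next M (S, W) = (W, N) by rewrite /face_next /= c3.
case/or4P=> /eqP ->.
- exact: connect0.
- by rewrite -i1 fconnect1.
- by rewrite -i2 -i1; apply: (fconnect_iter _ 2).
- by rewrite -i3 -i2 -i1; apply: (fconnect_iter _ 3).
Qed.

Lemma arc_dart a b : o a b -> (a, b) \in darts M /\ (b, a) \in darts M.
Proof. by move=> oab; rewrite !inE /= !red_mapE oab orbT. Qed.

Lemma inner_faceP d : d \in darts M ->
  (face_of M d \in inner_faces T o) = (d \notin outer_darts T).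
Proof.
move=> dM; rewrite in_setD1 mem_faces // andbT; congr (~~ _).
apply/eqP/idP=> [<-|dO]; first exact: mem_face_of.
rewrite -red_outer_face; apply: (face_of_eq wfM).
  by have [_ _ _ /arc_dart[]] := red_arcs_outer T X.
by rewrite red_outer_face.
Qed.

Lemma fp_face_const g d d' : face_potential T X g -> d \in darts M ->
  d' \in face_of M d -> g d'.1 d'.2 = g d.1 d.2.
Proof.
move=> pg; apply: (face_constant wfM) => u v uv.
by apply: (fp_cw HT HX rot pg); apply: red_map_adj uv.
Qed.

Lemma face_next_arc a b : aM a b -> face_of M (b, cM b a) = face_of M (a, b).
Proof.
move=> ab; rewrite -[(b, _)]/(face_next M (a, b)) face_of_next // inE //.
Qed.

Lemma forward_dart d : d \in darts M -> exists2 d', d' \in face_of M d & o d'.1 d'.2.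
Proof.
case: d => a b; rewrite inE /= red_mapE.
case/orP=> [oab|]; first by exists (a, b); rewrite ?mem_face_of.
have [k] := ubnP (rk b); elim: k a b => // k IH a b le_k oba.
have ab : aM a b by rewrite red_mapE oba orbT.
have cb : aM b (cM b a) by case: wfM => _ h _; apply: h; rewrite red_mapE oba.
rewrite -(face_next_arc ab); move: cb; rewrite red_mapE => /orP[obc|obc].
  by exists (b, cM b a); rewrite ?mem_face_of.
apply: IH => //; have := red_rank_lt HT HX obc; move: le_k; clear; lia.
Qed.

Lemma backward_dart d : d \in darts M -> exists2 d', d' \in face_of M d & o d'.2 d'.1.
Proof.
case: d => a b; rewrite inE /= red_mapE orbC.
case/orP=> [oab|]; first by exists (a, b); rewrite ?mem_face_of.
have [k] := ubnP (#|V| + 2 - rk b)%N; elim: k a b => // k IH a b le_k oba.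
have ab : aM a b by rewrite red_mapE oba.
have cb : aM b (cM b a) by case: wfM => _ h _; apply: h; rewrite red_mapE oba orbT.
rewrite -(face_next_arc ab); move: cb; rewrite red_mapE => /orP[obc|obc]; last first.
  by exists (b, cM b a); rewrite ?mem_face_of.
apply: IH => //; have := red_rank_lt HT HX obc.
by have := red_rank_le T X (cM b a); move: le_k; clear; lia.
Qed.

(* Inner faces of the red map correspond to their sinks, and the sink of a face
   is recorded by the last arc of its left boundary. *)
Definition sink_darts : {set V * V} := [set d | o d.2 d.1 && (d.2 != ri d.1)].

Lemma sink_dartP s u : (s, u) \in sink_darts ->
  exists2 i, (i.+1 < size (si s))%N & u = nth s (si s) i.+1.
Proof.
rewrite inE /= => /andP[ou nri]; have [[|i] lt e] := si_mem_nth rot ou.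
  by move: nri; rewrite e nth0 eqxx.
by exists i.
Qed.

Lemma sink_dart_nth s i : (i.+1 < size (si s))%N ->
  (s, nth s (si s) i.+1) \in sink_darts.
Proof. by move=> lt; rewrite inE /= (si_nth_arc rot lt) (si_nth_ri rot). Qed.

Lemma sink_dart_darts d : d \in sink_darts -> d \in darts M.
Proof. by case: d => s u; rewrite inE => /andP[/arc_dart[]]. Qed.

Lemma sink_dart_inner d : d \in sink_darts -> face_of M d \in inner_faces T o.
Proof.
move=> dS; rewrite inner_faceP ?sink_dart_darts //; case: d dS => s u.
rewrite inE /= => /andP[ou nri]; apply/negP=> /(rev_arc_outer_dart HT HX ou)[][eu es].
  by move: nri; rewrite eu es (si_N rot).1 eqxx.
by move: nri; rewrite eu es (riE rot) eqxx.
Qed.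

(** The right boundary of the face is followed upwards along leftmost outgoing arcs, as far as a
    vertex with an ingoing arc to the left of the arriving one. This vertex is the sink of the face,
    and that ingoing arc ends its left boundary. *)
Lemma sink_dart_face a b : o a b -> (a, b) \notin outer_darts T ->
  exists2 d, d \in sink_darts & face_of M (a, b) = face_of M d.
Proof.
have [k] := ubnP (#|V| + 2 - rk b)%N; elim: k a b => // k IH a b le_k oab nO.
have ab : aM a b by rewrite red_mapE oab.
have bS := arc_neqS HT HX oab; have [i lt e] := si_mem_nth rot oab.
have [lt'|le] := ltnP i.+1 (size (si b)).
  exists (b, nth b (si b) i.+1); first exact: sink_dart_nth.
  by rewrite -(si_next rot lt') -e face_next_arc.
have el : a = last b (si b).
  rewrite e -nth_last; congr nth; apply/eqP; rewrite eqn_leq.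
  by case: (si b) lt le => //= x p; clear; lia.
have [eb|bN] := eqVneq b N.
  by move: nO; rewrite el eb (si_N rot).2; have [_ _ _ ->] := outer_dart_mem T.
have ef : face_of M (a, b) = face_of M (b, loX b).
  by rewrite -(si_so rot bN bS) -el face_next_arc.
rewrite ef; apply: IH; last 1 first.
- have [d1 _] := arc_dart oab; have [d2 _] := arc_dart (lo_arc rot bN).
  by rewrite -inner_faceP // -ef inner_faceP.
- have := red_rank_lt HT HX (lo_arc rot bN); have := red_rank_le T X (loX b).
  by move: le_k; clear; lia.
- exact: lo_arc.
Qed.

(* Uniqueness of the sink: for an arc [u -> s] that is not rightmost, the
   circulation formed by this arc and the two downward paths separates the face
   on its right from everything reached by walking to the left. *)
Lemma sink_order s u : (s, u) \in sink_darts ->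
  exists2 g, face_potential T X g &
    g s u != 0 /\ forall s' u', (s', u') \in sink_darts -> (s', u') != (s, u) ->
      g s' u' != 0 -> (rk s' < rk s)%N || ((s' == s) && (index u' (si s) < index u (si s))%N).
Proof.
move=> dS; have [i0 lt0 eu] := sink_dartP dS.
have ous : o u s by move: dS; rewrite inE => /andP[].
have [F1 [n1 z1 d1 j1]] := down_flow HT HX rot u.
have [F2 [n2 z2 d2 j2]] := down_flow HT HX rot s.
pose ar a b : rat := ((a == u) && (b == s))%:R.
pose phi a b := ar a b - ar b a + F1 a b - F2 a b.
have us : u != s by apply: contraTneq (red_rank_lt HT HX ous) => ->; rewrite ltnn.
have [|||g pg jg] := @face_potential_ex _ _ _ HT HX phi.
- by move=> a b; rewrite /phi n1 n2; ring.
- move=> a b nab; rewrite /phi z1 // z2 // /ar.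
  have -> : (a == u) && (b == s) = false.
    by apply: contraNF nab => /andP[/eqP -> /eqP ->]; rewrite red_mapE ous.
  have -> : (b == u) && (a == s) = false.
    by apply: contraNF nab => /andP[/eqP -> /eqP ->]; rewrite red_mapE ous orbT.
  by ring.
- move=> w; rewrite /phi !(sumrB, big_split) /= d1 d2 /ar.
  have -> : \sum_b ((w == u) && (b == s))%:R = (w == u)%:R :> rat.
    rewrite (bigD1 s) //= eqxx andbT big1 ?addr0 // => b /negPf ->.
    by rewrite andbF.
  have -> : \sum_b ((b == u) && (w == s))%:R = (w == s)%:R :> rat.
    by rewrite (bigD1 u) //= eqxx big1 ?addr0 // => b /negPf ->.
  by ring.
have jmp q i : (i.+1 < size (si q))%N -> let p := nth q (si q) i.+1 in
    g p q - g q p = ((p == u) && (q == s))%:R.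
  move=> lt p; have op := si_nth_arc rot lt; rewrite -/p in op.
  rewrite jg // /phi j1 // j2 // /inD.
  have -> : (p == ri q) = false by rewrite (si_nth_ri rot).
  rewrite !andbF mulr0n subr0 addr0 /ar.
  have -> : (q == u) && (p == s) = false; last by rewrite subr0.
  apply/negP=> /andP[/eqP eq /eqP ep]; have := red_arc_asym HT HX op.
  by rewrite eq ep ous.
pose Q p q := g p q != 0 -> (rk q < rk s)%N || ((q == s) && (index p (si s) < index u (si s))%N).
have idx q i : (i < size (si q))%N -> index (nth q (si q) i) (si q) = i.
  by move=> lt; rewrite index_uniq ?(si_uniq rot).
have iu : index u (si s) = i0.+1 by rewrite eu idx.
have left p q : o p q -> Q p q.
  move: p q; apply: (left_ind HT HX rot) => [|q i lt IH|q qN qS IH].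
  - by rewrite /Q; have [_ _ _ /(fp_outer pg)/= ->] := outer_dart_mem T; rewrite eqxx.
  - rewrite /Q (g_si HT HX rot pg lt) => nz.
    have := jmp q i lt => /=; case: (boolP (_ && _)) => [/andP[/eqP ep /eqP eq] _|nn e].
      apply/orP; right; rewrite eq eqxx /=; subst q.
      by rewrite idx ?(ltnW lt) // -ep idx.
    have {}e : g (nth q (si q) i.+1) q = g q (nth q (si q) i.+1).
      by apply/eqP; rewrite -subr_eq0 e.
    move: IH; rewrite /Q e => /(_ nz) /orP[->//|/andP[/eqP eq]]; subst q.
    rewrite !idx // ?(ltnW lt) // => h; rewrite eqxx /= (ltnW h) orbT //.
  - rewrite /Q (g_up HT HX rot pg) // => /IH.
    have := red_rank_lt HT HX (lo_arc rot qN).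
    by move=> h /orP[/(ltn_trans h) ->//|/andP[/eqP <- _]]; rewrite h.
exists g => //; split.
  have := jmp s i0 lt0; rewrite /= -eu !eqxx /= => e.
  have [g0|/(left _ _ ous)] := eqVneq (g u s) 0; last by rewrite !ltnn andbF.
  by apply: contra_eq_neq e => ->; rewrite subr0 g0 eq_sym oner_eq0.
move=> s' u' dS' ne nz; have [i lt e'] := sink_dartP dS'.
have := jmp s' i lt; rewrite /= -e'.
have -> : (u' == u) && (s' == s) = false.
  by apply: contraNF ne => /andP[/eqP -> /eqP ->].
move=> /eqP; rewrite subr_eq0 => /eqP e; apply: left; last by rewrite e.
by move: dS'; rewrite inE => /andP[].
Qed.

(** Two sink darts on the same face would have nonzero values for both potentials of [sink_order],
    so that each would precede the other in a strict lexicographic order. *)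
Lemma sink_dart_inj : {in sink_darts &, injective (fun d => face_of M d)}.
Proof.
move=> [s u] [s' u'] dS dS' eF; apply/eqP; apply: contraT => ne.
have [g pg [nz h]] := sink_order dS; have [g' pg' [nz' h']] := sink_order dS'.
have m1 : (s', u') \in face_of M (s, u) by rewrite eF mem_face_of.
have m2 : (s, u) \in face_of M (s', u') by rewrite -eF mem_face_of.
have e1 := fp_face_const pg (sink_dart_darts dS) m1.
have e2 := fp_face_const pg' (sink_dart_darts dS') m2.
rewrite /= in e1 e2; have ne' : (s', u') != (s, u) by rewrite eq_sym.
have h1 : g s' u' != 0 by rewrite e1.
have h2 : g' s u != 0 by rewrite e2.
have /orP[l1|/andP[/eqP l1 l1']] := h _ _ dS' ne' h1.
  have := h' _ _ dS ne h2; rewrite ltnNge (ltnW l1) /= => /andP[/eqP es].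
  by move: l1; rewrite es ltnn.
by have := h' _ _ dS ne h2; rewrite l1 ltnn eqxx /= ltnNge (ltnW l1').
Qed.

Lemma sink_dart_image : [set face_of M d | d in sink_darts] = inner_faces T o.
Proof.
apply/setP=> F; apply/imsetP/idP=> [[d dS ->]|FI]; first exact: sink_dart_inner.
have := FI; rewrite in_setD1 => /andP[FO /imsetP[d0 d0M eF]].
have [[a b] d'F /= oab] := forward_dart d0M.
have e := face_of_eq wfM d0M d'F; have [abM _] := arc_dart oab.
have [|d dS ed] := sink_dart_face oab.
  by rewrite -inner_faceP // e -eF.
by exists d; rewrite // eF -e.
Qed.

Lemma card_inner_faces : #|inner_faces T o| = #|sink_darts|.
Proof. by rewrite -sink_dart_image card_in_imset //; apply: sink_dart_inj. Qed.

(** The arcs that give no sink dart are the rightmost ingoing ones, one for each vertex other than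
    [S]. *)
Lemma card_sink_darts : (#|sink_darts| + (#|V| - 1) = #|[set d | o d.1 d.2]|)%N.
Proof.
pose A := [set d : V * V | o d.2 d.1].
have -> : #|[set d : V * V | o d.1 d.2]| = #|A|.
  rewrite -(card_imset _ (f := fun d : V * V => (d.2, d.1))); last first.
    by move=> [a b] [c d] [-> ->].
  apply: eq_card => -[a b]; rewrite [RHS]inE /=; apply/imsetP/idP=> [[[c d]]|oba].
    by rewrite inE /= => ocd [-> ->].
  by exists (b, a); rewrite // inE.
pose B := [set (v, ri v) | v in [set~ S]].
have cB : #|B| = (#|V| - 1)%N.
  rewrite card_imset; last by move=> a b [].
  by rewrite cardsC1 subn1.
rewrite -cB -[in RHS](cardsID B A) addnC; congr (_ + _)%N.
- apply: eq_card => -[s u]; rewrite in_setI andbC.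
  case: (boolP ((s, u) \in B)) => // /imsetP[v]; rewrite !inE => vS [-> ->] /=.
  by rewrite (ri_arc rot vS).
- apply: eq_card => -[s u]; rewrite in_setD !inE /=.
  have [ous|_] := boolP (o u s); rewrite /= ?andbF ?andbT //; congr (~~ _).
  apply/eqP/imsetP=> [->|[v _ [-> ->]] //]; exists s => //.
  by rewrite !inE (arc_neqS HT HX ous).
Qed.

(** Accessibility without crossing the path becomes a condition on the potential, which keeps its
    value when an arc off the path is crossed. *)
Lemma faces_leftE v g : pp v g ->
  faces_left T o (sep_path T o v) =
  [set F in inner_faces T o | [exists d in F, g d.1 d.2 == 1]].
Proof.
move=> pg; have fp := pp_face pg; apply/setP=> F; rewrite [LHS]in_set [RHS]in_set.
case: (boolP (F \in inner_faces T o)) => //= FI; set P := sep_path T o v.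
have dartP a b : ((a, b) \in P) = inPX v a b by exact: sep_pathE.
have valF d : d \in darts M -> [exists d' in face_of M d, g d'.1 d'.2 == 1] = (g d.1 d.2 == 1).
  move=> dM; apply/existsP/idP=> [[d' /andP[d'F]]|gd].
    by rewrite (fp_face_const fp dM d'F).
  by exists d; rewrite mem_face_of.
apply/existsP/idP.
  move=> [[a b] /andP[abP /connectP[p pth eF]]].
  rewrite dartP in abP; have oab := inP_arc rot abP; have [abM baM] := arc_dart oab.
  have start : face_of M (a, b) \in inner_faces T o ->
      [exists d in face_of M (a, b), g d.1 d.2 == 1].
    rewrite inner_faceP // valF //= => nO.
    have := g01 pg oab; rewrite abP /Lf; case: ifP => [ls|_ [-> _] //].
    by rewrite leftside_outer in nO.
  move: FI; rewrite eF; move: (face_of M (a, b)) start pth {eF}.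
  elim: p => //= F2 p IH F1 h /andP[adj12 pth]; apply: IH => // F2I.
  case/and3P: adj12 => F1I _ /existsP[[c d] /and4P[dF1 dF2 nP1 nP2]].
  have [F1M F2M] : F1 \in faces M /\ F2 \in faces M.
    by move: F1I F2I; rewrite !in_setD1 => /andP[_ ->] /andP[_ ->].
  have [cdM e1] := face_of_mem wfM F1M dF1; have [dcM e2] := face_of_mem wfM F2M dF2.
  have := h F1I; rewrite e1 e2 !valF //=; rewrite e1 inner_faceP // in F1I.
  rewrite e2 inner_faceP // in F2I.
  have out a' b' : o a' b' -> (a', b') \notin P -> (b', a') \notin P -> 
      (a', b') \notin outer_darts T -> (b', a') \notin outer_darts T -> g a' b' = g b' a'.
    move=> o' n1 n2 m1 m2; have := g01 pg o'; rewrite -dartP (negPf n1) /Lf.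
    case: ifP => [/leftside_outer|_ [-> _] //]; by rewrite (negPf m1).
  have : aM c d by move: cdM; rewrite inE.
  rewrite red_mapE => /orP[ocd|odc]; first by rewrite (out c d).
  by rewrite (out d c).
have sym : symmetric (adjacent_off T o P).
  have one F1 F2 : adjacent_off T o P F1 F2 -> adjacent_off T o P F2 F1.
    move=> /and3P[i1 i2 /existsP[[c d] /and4P[h1 h2 h3 h4]]]; apply/and3P; split=> //.
    by apply/existsP; exists (d, c); apply/and4P; split.
  by move=> F1 F2; apply/idP/idP; apply: one.
(* Conversely, a face of value 1 is followed towards the right. Since the value is 0 at the right
   side of the box, the path is met on the way. *)
have reach p q : o p q -> g q p = 1 -> exists2 d, d \in P &
    connect (adjacent_off T o P) (face_of M d) (face_of M (q, p)).
  move: p q; apply: (right_ind HT HX rot) => [|p i lt IH e|p pN pS IH e].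
  - by have [_ /(fp_outer fp) /= -> _ _] := outer_dart_mem T => /esym/eqP; rewrite oner_eq0.
  - have oi := so_nth_arc rot (ltnW lt); have oi' := so_nth_arc rot lt.
    set b := nth p (so p) i.+1 in oi' *.
    have ef : face_of M (nth p (so p) i, p) = face_of M (p, b).
      by rewrite /b -(so_next rot lt) face_next_arc // red_mapE oi orbT.
    rewrite (Lf_so HT HX rot fp lt) -/b in e; rewrite ef.
    have [pb|npb] := boolP (inPX v p b).
      by exists (p, b); rewrite ?dartP ?connect0.
    have := g01 pg oi'; rewrite (negPf npb) e => -[e1 _].
    have [d dP cd] := IH (esym e1); exists d => //; apply: connect_trans cd (connect1 _).
    have [pbM bpM] := arc_dart oi'.
    apply/and3P; split; [rewrite inner_faceP //|rewrite inner_faceP //|].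
    + by apply/negP=> /(fp_outer fp)/= /eqP; rewrite -e1 oner_eq0.
    + move: e; rewrite /Lf; case: ifP => [|_ e].
        move=> /orP[]/eqP[ep eb] _.
          by have := so_nth_lo rot lt; rewrite -/b ep eb (so_S rot).1 eqxx.
        by move: lt; rewrite ep (so_W rot).1.
      by apply/negP=> /(fp_outer fp)/= /eqP; rewrite e oner_eq0.
    + apply/existsP; exists (b, p); apply/and4P; split; rewrite ?mem_face_of ?dartP //.
      by apply: contra (red_arc_asym HT HX oi'); apply: inP_arc.
  - have ol : o p (last p (so p)).
      rewrite -(rr_so (rot p)); have := so_neq0 rot pN.
      by case: (so p) => //= x s _; apply: mem_last.
    have -> : face_of M (last p (so p), p) = face_of M (p, ri p).
      by rewrite -(so_si rot pN pS) face_next_arc // red_mapE ol orbT.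
    by apply: IH; rewrite -(g_down HT HX rot fp).
have := FI; rewrite in_setD1 => /andP[_ /imsetP[d0 d0M eF]] gF.
have [[q p] d'F /= opq] := backward_dart d0M.
have e := face_of_eq wfM d0M d'F; have [_ qpM] := arc_dart opq.
have [|d dP cd] := reach p q opq.
  by apply/eqP; rewrite -(valF (q, p)) // e -eF.
by exists d; rewrite dP eF -e.
Qed.

Lemma sink_dart_g01 v g d : pp v g -> d \in sink_darts ->
  g d.1 d.2 = 0 \/ g d.1 d.2 = 1.
Proof.
move=> pg; case: d => s u; rewrite inE /= => /andP[ous _]; have := g01 pg ous.
by case: (inPX v u s) => [[_ ->]|[_ []->]]; auto.
Qed.

(** Sink darts provide one dart per inner face, whatever the vertex, so that two abscissas can be
    compared term by term. *)
Lemma abscissa_sum v g : pp v g ->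
  (abscissa T X v)%:R = \sum_(d in sink_darts) g d.1 d.2 :> rat.
Proof.
move=> pg; rewrite /abscissa (faces_leftE pg).
pose P (F : {set V * V}) := [exists d in F, g d.1 d.2 == 1].
have -> : #|[set F in inner_faces T o | [exists d in F, g d.1 d.2 == 1]]| =
    (\sum_(F in inner_faces T o) P F)%N.
  rewrite -sum1_card -big_mkcondr /=; apply: eq_bigl => F; rewrite inE.
  by rewrite -/(P F).
rewrite natr_sum -sink_dart_image big_imset /=; last exact: sink_dart_inj.
apply: eq_bigr => d dS; have dM := sink_dart_darts dS.
have -> : P (face_of M d) = (g d.1 d.2 == 1).
  apply/existsP/idP=> [[d' /andP[d'F]]|gd].
    by rewrite (fp_face_const (pp_face pg) dM d'F).
  by exists d; rewrite mem_face_of.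
by have [->|->] := sink_dart_g01 pg dS; rewrite ?eqxx // eq_sym oner_eq0.
Qed.

Lemma abscissa_red u v : o u v -> (abscissa T X u <= abscissa T X v)%N.
Proof.
move=> ouv; have [gu pu] := path_potential_ex HT HX rot u.
have [gv pv] := path_potential_ex HT HX rot v.
rewrite -(ler_nat rat) (abscissa_sum pu) (abscissa_sum pv); apply: ler_sum.
move=> [s w]; rewrite inE /= => /andP[ows _].
exact: (g_compare pu pv (key_red pu ouv)).
Qed.

(** Strictness comes from the red face that contains the blue edge: it is on the right of the path
    of [u] and on the left of the path of [v]. *)
Lemma abscissa_blue u v : blue X u v -> (abscissa T X u < abscissa T X v)%N.
Proof.
move=> b; have [gu pu] := path_potential_ex HT HX rot u.
have [gv pv] := path_potential_ex HT HX rot v.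
rewrite -(ltr_nat rat) (abscissa_sum pu) (abscissa_sum pv).
have [vN vS vW [uN uS uE]] := blue_ends b; have ol := lo_arc rot vN.
have nls : leftside T v (loX v) = false.
  by rewrite /leftside !xpair_eqE (negPf vS) (negPf vW).
have nO : (v, loX v) \notin outer_darts T.
  by apply/negP=> /(arc_outer_dart HT HX ol)[][ev]; [rewrite ev eqxx in vS | rewrite ev eqxx in vW].
have [d0 dS ef] := sink_dart_face ol nO.
have [dM _] := arc_dart ol.
have m0 : d0 \in face_of M (v, loX v) by rewrite ef mem_face_of.
have eu : gu d0.1 d0.2 = 0.
  rewrite (fp_face_const (pp_face pu) dM m0) /=.
  have [-> _] := blue_value (pp_face pu) b.
  have := g01 pu (ri_arc rot uS); rewrite /inP /inD connect0 uS eqxx orbT.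
  by case=> _ ->.
have ev : gv d0.1 d0.2 = 1.
  rewrite (fp_face_const (pp_face pv) dM m0) /=.
  have := g01 pv ol; rewrite /inP /inU connect0 vN eqxx /=.
  by rewrite /Lf nls => -[].
rewrite (bigD1 d0) //= [ltRHS](bigD1 d0) //= eu ev.
apply: ltr_leD => //; apply: ler_sum.
move=> [s w]; rewrite inE /= => /andP[/andP[ows _] _].
exact: (g_compare pu pv (key_blue b pu)).
Qed.

Lemma abscissa_le v : (abscissa T X v <= #|sink_darts|)%N.
Proof.
have [g pg] := path_potential_ex HT HX rot v.
rewrite -(ler_nat rat) (abscissa_sum pg) -sum1_card natr_sum; apply: ler_sum.
by move=> d /(sink_dart_g01 pg)[] ->.
Qed.

Lemma abscissa_eq0 v : (forall a b, o a b -> inPX v a b = leftside T a b) ->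
  abscissa T X v = 0%N.
Proof.
move=> h; have pg : pp v (fun _ _ => 0).
  split; first by split.
  by move=> a b oab; rewrite h // /Lf subr0; case: ifP.
by apply/eqP; rewrite -(eqr_nat rat) (abscissa_sum pg) big1.
Qed.

(** The walk to the left crosses no rightmost ingoing arc, so that it never crosses this path, and
    all the inner faces inherit the value of the left side. *)
Lemma abscissa_full v : (forall a b, inPX v a b -> a = ri b) ->
  abscissa T X v = #|sink_darts|.
Proof.
move=> h; have [g pg] := path_potential_ex HT HX rot v.
have one p q : o p q -> LfX g p q = 1.
  move: p q; apply: (left_ind HT HX rot) => [|q i lt|q qN qS].
  - by rewrite /Lf /leftside eqxx orbT.
  - rewrite (Lf_si HT HX rot (pp_face pg) lt) => e.
    have := g01 pg (si_nth_arc rot lt); case: (boolP (inPX v _ _)) => [/h er|_ [<-]//].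
    by have := si_nth_ri rot lt; rewrite er eqxx.
  - by rewrite (Lf_up HT HX rot (pp_face pg)).
apply/eqP; rewrite -(eqr_nat rat) (abscissa_sum pg) -sum1_card natr_sum; apply/eqP.
apply: eq_bigr => -[s u] /sink_dartP[i lt ->] /=.
by rewrite -(Lf_si HT HX rot (pp_face pg) lt) one // (si_nth_arc rot) // ltnW.
Qed.

Let fconnect_fix (f : V -> V) z a : f z = z -> fconnect f z a = (a == z).
Proof.
move=> fz; apply/idP/eqP=> [/iter_findex <-|-> //].
by elim: (findex _ _ _) => //= n ->.
Qed.

Lemma abscissa_corners :
  [/\ abscissa T X S = 0%N, abscissa T X W = 0%N,
      abscissa T X N = #|sink_darts| & abscissa T X E = #|sink_darts|].
Proof.
have loN := lo_N HT HX rot; have riS := ri_S HT HX rot.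
split.
- by apply: abscissa_eq0 => a b; apply: inP_S.
- apply: abscissa_eq0 => a b oab; have aN := arc_neqN HT HX oab; have bS := arc_neqS HT HX oab.
  rewrite /inP /inU /inD aN bS !(fconnect_eqVf _ W) (loW rot) (riW rot).
  rewrite !fconnect_fix // (negPf aN) (negPf bS) !orbF /leftside !xpair_eqE orbC.
  rewrite (eq_sym W a) (eq_sym W b).
  case: (b =P W) => [->|_]; case: (a =P W) => [->|_]; rewrite /= ?(riW rot) ?(loW rot) ?andbT ?andbF ?orbF //.
- by apply: abscissa_full => a b /orP[/and3P[]|/and3P[_ _ /eqP //]]; rewrite fconnect_fix // => ->.
- apply: abscissa_full => a b /orP[/and3P[]|/and3P[_ _ /eqP //]].
  rewrite fconnect_eqVf (loE rot) fconnect_fix // => /orP[/eqP <- _ /eqP ->|->//].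
  by rewrite (loE rot) (si_N rot).1.
Qed.

End Abscissa.

(** * Quarter turn *)


(* A quarter turn exchanges the two colors up to the direction of the arcs, so
   that ordinates become abscissas. *)
Definition turn_map (V : finType) (T : framed_map V) : framed_map V :=
  FramedMap (fmap T) (vW T) (vN T) (vE T) (vS T).

Definition turn_pair (V : finType) (X : bicolor_orientation V) :
    bicolor_orientation V :=
  BicolorOrientation (fun u v => blue X v u) (red X).

Section Turn.

Variables (V : finType) (T : framed_map V) (X : bicolor_orientation V).

Lemma turn_outer_darts : outer_darts (turn_map T) = outer_darts T.
Proof.
apply/setP=> d; rewrite /outer_darts !inE /=.
by do 4!case: (d == _).
Qed.

Lemma turn_outer_edge u v : outer_edge (turn_map T) u v = outer_edge T u v.
Proof. by rewrite /outer_edge /= turn_outer_darts. Qed.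

Lemma turn_inner_edge u v : inner_edge (turn_map T) u v = inner_edge T u v.
Proof. by rewrite /inner_edge /= -turn_outer_edge. Qed.

Lemma turn_inner_vertex v : inner_vertex (turn_map T) v = inner_vertex T v.
Proof.
rewrite /inner_vertex !inE /=; congr (~~ _).
by do 4!case: (v == _).
Qed.

Lemma turn_irreducible : irreducible_triangulation T ->
  irreducible_triangulation (turn_map T).
Proof.
move=> HT; have [[a1 a2 a3 a4] _] := adj_outer HT; have wf := plane_well_rotated (triangulation_plane HT).
case: (HT) => pl [un _ _] tri sep; split=> //.
  split=> //=.
    move: un; rewrite -(rot_uniq 3) /rot /=.
    by [].
  rewrite turn_outer_darts -(outer_face HT); apply: (face_of_eq wf); first by rewrite inE.
  by rewrite (outer_face HT); have [] := outer_dart_mem T.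
by rewrite turn_outer_darts.
Qed.

Lemma turn_transversal : irreducible_triangulation T -> transversal_pair T X ->
  transversal_pair (turn_map T) (turn_pair X).
Proof.
move=> HT [h1 h2 h3 h4]; have iC := inner_edgeC HT.
split=> [u v|u v|v|u] /=.
- rewrite turn_inner_edge => /orP[b|r]; last by apply: h1; rewrite r.
  by rewrite iC; apply: h1; rewrite b orbT.
- by rewrite turn_inner_edge => /h2 <-; ring.
- rewrite turn_inner_vertex => /h3[s1 [s2 [s3 [s4 [uc mem [n1 n2 n3 n4] [c1 c2 c3 c4]]]]]].
  exists s4, s1, s2, s3; split=> //.
  + have -> : s4 ++ s1 ++ s2 ++ s3 = rot (size (s1 ++ s2 ++ s3)) (s1 ++ s2 ++ s3 ++ s4).
      by rewrite !catA rot_size_cat -!catA.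
    by case/andP: uc => cyc un; rewrite /ucycle rot_cycle rot_uniq cyc.
  + by move=> a; rewrite -mem !mem_cat; do 4!case: (a \in _).
- by have [q1 q2 q3 q4] := h4 u; rewrite !turn_inner_edge; split.
Qed.

Lemma turn_red_arc : red_arc (turn_map T) (turn_pair X) =
  (fun u v => blue_arc T X v u) :> rel V.
Proof.
apply: functional_extensionality => u; apply: functional_extensionality => v.
rewrite /red_arc /blue_arc /= !inE !xpair_eqE /=; congr (_ || _).
rewrite (andbC (v == vW T)) (andbC (v == vN T)) (andbC (v == vW T)) (andbC (v == vS T)).
by do 4!case: (_ && _).
Qed.

Lemma turn_orient_map : orient_map (turn_map T) (fun u v => blue_arc T X v u) =
  orient_map T (blue_arc T X).
Proof.
rewrite /orient_map; congr submap.
apply: functional_extensionality => u; apply: functional_extensionality => v.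
by rewrite /= orbC.
Qed.

Lemma turn_sep_path v a b :
  ((a, b) \in sep_path (turn_map T) (fun u v => blue_arc T X v u) v) =
  ((b, a) \in sep_path T (blue_arc T X) v).
Proof.
have e1 : leftmost_out (turn_map T) (fun u v => blue_arc T X v u) =2
    rightmost_in T (blue_arc T X).
  by move=> w u; rewrite /leftmost_out /rightmost_in /= /first_cw turn_outer_darts turn_orient_map.
have e2 : rightmost_in (turn_map T) (fun u v => blue_arc T X v u) =2
    leftmost_out T (blue_arc T X).
  by move=> w u; rewrite /leftmost_out /rightmost_in /= /first_cw turn_outer_darts turn_orient_map.
by rewrite !in_setU !in_set (eq_connect e1) (eq_connect e2) e1 e2 orbC.
Qed.

(** Reversing the blue arcs exchanges leftmost outgoing and rightmost ingoing arcs: the separating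
    path is the same, run backwards, and its right becomes its left. *)
Lemma turn_ordinate v :
  ordinate T X v = abscissa (turn_map T) (turn_pair X) v.
Proof.
rewrite /ordinate /abscissa turn_red_arc.
set o := fun u v => blue_arc T X v u; set b := blue_arc T X.
set P := sep_path T b v; set P' := sep_path _ o v.
have PP d : (d \in P') = (rev_dart d \in P) by case: d => x y; apply: turn_sep_path.
have inn : inner_faces (turn_map T) o = inner_faces T b.
  by rewrite /inner_faces turn_outer_darts turn_orient_map.
have adjE : adjacent_off (turn_map T) o P' =2 adjacent_off T b P.
  move=> F F'; rewrite /adjacent_off /= inn; congr [&& _, _ & _].
  apply: eq_existsb => -[x y]; rewrite !PP /rev_dart /=.
  by congr (_ && _); congr (_ && _); rewrite andbC.
apply: eq_card => F; rewrite [LHS]in_set [RHS]in_set inn turn_orient_map; congr (_ && _).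
apply/existsP/existsP=> -[[x y] /andP[dP c]]; exists (y, x).
  by rewrite PP dP (eq_connect adjE).
by rewrite -[_ \in P]/(rev_dart (x, y) \in P) -PP dP -(eq_connect adjE).
Qed.

End Turn.

(** * Number of arcs *)

Section Counting.

Variables (V : finType) (T : framed_map V) (X : bicolor_orientation V).
Hypotheses (HT : irreducible_triangulation T) (HX : transversal_pair T X).

Let plT := triangulation_plane HT.
Let neqs := outer_neqs HT.

Lemma card_outer_darts : #|outer_darts T| = 4.
Proof.
rewrite /outer_darts -!setUA !cardsU1 cards1 !inE !xpair_eqE.
by rewrite !neqs !andbF.
Qed.

(** Euler's formula with triangles and one quadrangle: there are [3 * #|V| - 7] edges. *)
Lemma card_darts : #|darts T| + 14 = 6 * #|V|.
Proof.
have [_ [_ NE fO] tri _] := HT; have [_ _ _ euler] := plT.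
have oF : outer_darts T \in faces T by rewrite -fO mem_faces // inE.
have := sum_card_faces (plane_well_rotated plT).
rewrite (bigD1 (outer_darts T)) //= card_outer_darts.
rewrite (eq_bigr (fun=> 3)); last by move=> F /andP[FF FO]; apply: tri.
rewrite sum_nat_const.
have -> : #|(fun F => (F \in faces T) && (F != outer_darts T))| = #|faces T| - 1.
  rewrite (cardsD1 (outer_darts T) (faces T)) oF add1n subn1 /=.
  by apply: eq_card => F; rewrite !inE andbC.
have : 0 < #|faces T| by apply/card_gt0P; exists (outer_darts T).
by move: euler; move: #|V| #|faces T| #|darts T| => a b c; lia.
Qed.

Lemma card_red_arc : #|[set d : V * V | red_arc T X d.1 d.2]| =
  #|[set d : V * V | rd T X d.1 d.2]| + 2.
Proof.
have [_ _ b1 b2] := outer_arcs T X.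
have nrd a b : bl T X a b -> rd T X a b = false.
  move=> ab; have ad : adj T a b by apply: (arc_adj HT HX); rewrite ab orbT.
  by rewrite (rdE HT HX ad) (cls_bl HT HX ab).
have -> : [set d : V * V | red_arc T X d.1 d.2] =
    (vW T, vN T) |: ((vS T, vE T) |: [set d | rd T X d.1 d.2]).
  by apply/setP=> -[a b]; rewrite !inE red_arcE /= !inE orbC orbA.
rewrite !cardsU1 !inE /= !nrd // !xpair_eqE !neqs /= !add1n !addn2 //.
Qed.

Lemma card_rd_bl : #|darts T| =
  2 * (#|[set d : V * V | rd T X d.1 d.2]| + #|[set d : V * V | bl T X d.1 d.2]|).
Proof.
have wf := plane_well_rotated plT.
pose c (P : rel V) := \sum_(d in darts T) P d.1 d.2 : nat.
have cE (P : rel V) : (forall u v, P u v -> adj T u v) -> c P = #|[set d : V * V | P d.1 d.2]|.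
  move=> h; rewrite /c -big_mkcondr /= -sum1_card; apply: eq_bigl => d; rewrite !inE.
  by case: (boolP (P d.1 d.2)) => [/h ->|]; rewrite ?andbF.
have cR (P : rel V) : (forall u v, P u v -> adj T u v) ->
    c (fun u v => P v u) = #|[set d : V * V | P d.1 d.2]|.
  move=> h; rewrite cE; last by move=> u v /h; rewrite (plane_adjC plT).
  rewrite -[RHS](card_imset _ (f := fun d : V * V => (d.2, d.1))); last first.
    by move=> [a b] [x y] [-> ->].
  apply: eq_card => -[a b]; rewrite inE /=; apply/idP/imsetP=> [p|[[x y]]].
    by exists (b, a); rewrite ?inE.
  by rewrite inE /= => p [-> ->].
have ar u v : rd T X u v -> adj T u v by move=> r; apply: (arc_adj HT HX); rewrite r.
have ab u v : bl T X u v -> adj T u v by move=> r; apply: (arc_adj HT HX); rewrite r orbT.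
transitivity (c (rd T X) + c (bl T X) + c (fun u v => rd T X v u) + c (fun u v => bl T X v u)).
  rewrite /c -!big_split /= -sum1_card; apply: eq_bigr => d; rewrite inE => dd.
  by rewrite -(arc_unique HT HX dd).
by rewrite (cR _ ar) (cR _ ab) !cE //; lia.
Qed.

End Counting.

(** * Size of the bounding box *)

Section Drawing.

Variables (V : finType) (T : framed_map V) (X : bicolor_orientation V).
Hypotheses (HT : irreducible_triangulation T) (HX : transversal_pair T X).

Let HT' := turn_irreducible HT.
Let HX' := turn_transversal HT HX.

Lemma turn_rd u v : rd (turn_map T) (turn_pair X) u v = bl T X v u.
Proof.
rewrite /rd /bl /= !inE !xpair_eqE; congr (_ || _); rewrite orbC.
by rewrite (andbC (v == vW T)) (andbC (v == vS T)).
Qed.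

Definition box_width := #|inner_faces T (red_arc T X)|.
Definition box_height :=
  #|inner_faces (turn_map T) (red_arc (turn_map T) (turn_pair X))|.

(** Let [r] and [b] count the pairs in [rd] and [bl], with [r + b = 3 * #|V| - 7]. The red and the
    blue map each have two further arcs, the outer ones of the other color, so that the numbers of
    sinks add up to [(r + 2) + (b + 2) - 2 * (#|V| - 1)]. *)
Lemma box_size : box_width + box_height = #|V| - 1.
Proof.
have [so [si rot]] := red_rotation_ex HT HX.
have [so' [si' rot']] := red_rotation_ex HT' HX'.
rewrite /box_width /box_height (card_inner_faces HT HX rot) (card_inner_faces HT' HX' rot').
have := card_sink_darts HT HX rot; have := card_sink_darts HT' HX' rot'.
rewrite (card_red_arc HT HX) (card_red_arc HT' HX').
have -> : #|[set d : V * V | rd (turn_map T) (turn_pair X) d.1 d.2]| =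
    #|[set d : V * V | bl T X d.1 d.2]|.
  rewrite -[RHS](card_imset _ (f := fun d : V * V => (d.2, d.1))); last first.
    by move=> [a b] [x y] [-> ->].
  apply: eq_card => -[a b]; rewrite inE turn_rd /=; apply/idP/imsetP=> [p|[[x y]]].
    by exists (b, a); rewrite ?inE.
  by rewrite inE /= => p [-> ->].
have := card_darts HT; rewrite (card_rd_bl HT HX).
move: #|V| #|sink_darts _ _ _| #|sink_darts _ _ _| => n w h.
by move: #|[set d : V * V | rd T X d.1 d.2]| #|[set d : V * V | bl T X d.1 d.2]| => a b; lia.
Qed.

Lemma abscissa_rd u v : rd T X u v -> abscissa T X u <= abscissa T X v.
Proof.
have [so [si rot]] := red_rotation_ex HT HX.
by move=> r; apply: (abscissa_red HT HX rot); rewrite red_arcE r.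
Qed.

Lemma abscissa_bound v : abscissa T X v <= box_width.
Proof.
have [so [si rot]] := red_rotation_ex HT HX.
by rewrite /box_width (card_inner_faces HT HX rot); apply: (abscissa_le HT HX rot).
Qed.

Lemma abscissa_outer :
  [/\ abscissa T X (vS T) = 0, abscissa T X (vW T) = 0,
      abscissa T X (vN T) = box_width & abscissa T X (vE T) = box_width].
Proof.
have [so [si rot]] := red_rotation_ex HT HX.
rewrite /box_width (card_inner_faces HT HX rot); exact: (abscissa_corners HT HX rot).
Qed.

Lemma box_width_gt0 : 0 < box_width.
Proof.
have [so [si rot]] := red_rotation_ex HT HX.
rewrite /box_width (card_inner_faces HT HX rot); apply/card_gt0P.
exists (vN T, vW T); rewrite inE /=; have [_ -> _ _] := red_arcs_outer T X.
by rewrite (si_N rot).1 eq_sym (outer_neqs HT).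
Qed.

Lemma abscissa_bl u v : bl T X u v -> abscissa T X u < abscissa T X v.
Proof.
have [so [si rot]] := red_rotation_ex HT HX.
have [x1 x2 x3 x4] := abscissa_outer; have w0 := box_width_gt0.
rewrite /bl !inE !xpair_eqE => /orP[b|/orP[]/andP[/eqP -> /eqP ->]].
- exact: (abscissa_blue HT HX rot).
- by rewrite x2 x3.
- by rewrite x1 x4.
Qed.

End Drawing.

(** * Planarity of the drawing *)


Local Open Scope ring_scope.

(* Sweeping along the line [f = 0], which avoids all vertices, [s] being a
   coordinate along it: the edges crossed by the line are visited one after the
   other through the triangles that it meets. *)
Section Sweep.

Variables (R : realFieldType) (V : finType) (T : framed_map V).
Hypothesis HT : irreducible_triangulation T.
Local Notation cT := (cw (fmap T)).
Local Notation aT := (adj (fmap T)).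
Let plT := triangulation_plane HT.
Let aC := plane_adjC plT.

Variables (f s : V -> R).
Hypothesis f_neq0 : forall v, f v != 0.
Hypothesis positive : forall u v, aT u v -> (u, v) \notin outer_darts T ->
  0 < (f v - f u) * (s (cT v u) - s u) - (s v - s u) * (f (cT v u) - f u).
Hypothesis parallelogram : f (vN T) + f (vS T) = f (vE T) + f (vW T).

Definition crossing (d : V * V) := [&& aT d.1 d.2, f d.1 < 0 & 0 < f d.2].

(** Linear interpolation: the coordinate [s] of the point where the edge meets the line [f = 0]. *)
Definition height (d : V * V) : R :=
  (f d.2 * s d.1 - f d.1 * s d.2) / (f d.2 - f d.1).

(** The line enters the triangle on the left of [d] through [d]; it leaves it through the side
    obtained by replacing the end of [d] that lies on the same side of the line as the third
    vertex. *)
Definition sweep_next (d : V * V) : V * V :=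
  let c := cT d.2 d.1 in if 0 < f c then (d.1, c) else (c, d.2).

Definition sweep_step : rel (V * V) :=
  [rel d d' | [&& crossing d, d \notin outer_darts T & d' == sweep_next d]].

Lemma sweep_next_crossing d : crossing d -> d \notin outer_darts T ->
  crossing (sweep_next d) /\ height d < height (sweep_next d).
Proof.
case: d => u v /and3P[/= uv fu fv] nO; have := positive uv nO.
have [vc cu _ _ _] := triangle_face HT uv nO; rewrite /sweep_next /=.
set c := cT v u in vc cu *; rewrite /height /crossing => pos.
have uc : aT u c by rewrite aC.
have cv : aT c v by rewrite aC.
have duv : 0 < f v - f u by lra.
case: (ltP 0 (f c)) => fc /=.
  split; first by rewrite uc fu fc.
  have duc : 0 < f c - f u by lra.
  rewrite ltr_pdivrMr // mulrAC ltr_pdivlMr // -subr_gt0.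
  have -> : (f c * s u - f u * s c) * (f v - f u) - (f v * s u - f u * s v) * (f c - f u) =
    (- f u) * ((f v - f u) * (s c - s u) - (s v - s u) * (f c - f u)) by ring.
  by apply: mulr_gt0 => //; rewrite oppr_gt0.
have {}fc : f c < 0 by rewrite lt_neqAle fc f_neq0.
split; first by rewrite cv fc fv.
have dcv : 0 < f v - f c by lra.
rewrite ltr_pdivrMr // mulrAC ltr_pdivlMr // -subr_gt0.
have -> : (f v * s c - f c * s v) * (f v - f u) - (f v * s u - f u * s v) * (f v - f c) =
  f v * ((f v - f u) * (s c - s u) - (s v - s u) * (f c - f u)) by ring.
exact: mulr_gt0.
Qed.

Lemma sweep_prev d : crossing d -> rev_dart d \notin outer_darts T ->
  exists2 e, crossing e & sweep_step e d.
Proof.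
case: d => u v /and3P[/= uv fu fv] nO; have vu : aT v u by rewrite aC.
have [uc cv e1 e2 [n1 n2]] := triangle_face HT vu nO.
set c := cT u v in uc cv e1 e2 n1 n2.
case: (ltP 0 (f c)) => fc.
  have cr : crossing (u, c) by rewrite /crossing /= uc fu fc.
  by exists (u, c) => //; apply/and3P; split=> //; rewrite /sweep_next /= e1 fv.
have {}fc : f c < 0 by rewrite lt_neqAle fc f_neq0.
have cr : crossing (c, v) by rewrite /crossing /= cv fc fv.
exists (c, v) => //; apply/and3P; split=> //; rewrite /sweep_next /= e2.
by rewrite ltNge (ltW fu).
Qed.

(** The line enters the outer quadrangle only once: entering through two sides would give [f] one
    sign at [N] and [S] and the other at [E] and [W], against [parallelogram]. *)
Lemma sweep_start d d' : crossing d -> crossing d' ->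
  rev_dart d \in outer_darts T -> rev_dart d' \in outer_darts T -> d = d'.
Proof.
case: d => u v; case: d' => u' v' /and3P[_ /= fu fv] /and3P[_ /= fu' fv'].
have par := parallelogram.
rewrite /outer_darts !inE /rev_dart /= !xpair_eqE -!orbA.
move=> /or4P[]/andP[/eqP e1 /eqP e2] /or4P[]/andP[/eqP e1' /eqP e2'];
  rewrite e1 e2 in fu fv *; rewrite e1' e2' in fu' fv' *; first [by [] | by exfalso; lra].
Qed.

Lemma sweep_mono d d' : connect sweep_step d d' -> d = d' \/ height d < height d'.
Proof.
move=> /connectP[p pth ->]; elim: p d pth => [|e p IH] d /=; first by left.
case/andP=> /and3P[cr nO /eqP ->] /IH h; right.
have [_ lt] := sweep_next_crossing cr nO.
by case: h => [<- //|]; apply: lt_trans.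
Qed.

(** Stepping back lowers the height and can stop only at the outer face, hence at the unique
    starting edge: all the crossed edges form a single chain. *)
Lemma sweep_total d d' : crossing d -> crossing d' ->
  connect sweep_step d d' || connect sweep_step d' d.
Proof.
pose below d := [set e | crossing e && (height e < height d)].
have lt_below e e' : crossing e -> sweep_step e e' -> (#|below e| < #|below e'|)%N.
  move=> cr /and3P[_ nO /eqP ->]; have [_ lt] := sweep_next_crossing cr nO.
  apply: proper_card; apply/properP; split.
    by apply/subsetP=> x; rewrite !inE => /andP[-> /lt_trans]; apply.
  by exists e; rewrite !inE ?ltxx ?andbF // cr lt.
have [k] := ubnP (#|below d| + #|below d'|)%N.
elim: k d d' => // k IH d d' le_k cr cr'.
have half e e' : (#|below e| + #|below e'| < k.+1)%N -> crossing e -> crossing e' ->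
    rev_dart e' \notin outer_darts T ->
    connect sweep_step e e' || connect sweep_step e' e.
  move=> le ce ce' nO; have [e0 ce0 st] := sweep_prev ce' nO.
  have lt := lt_below _ _ ce0 st.
  have /orP[h|] : connect sweep_step e e0 || connect sweep_step e0 e.
    by apply: IH => //; move: le lt; clear; lia.
    by rewrite (connect_trans h (connect1 st)).
  move=> /connectP[[|e1 p] /=]; first by move=> _ ->; rewrite (connect1 st).
  case/andP=> /and3P[_ _ /eqP e1E] pth eE; case/and3P: st => _ _ /eqP e'E.
  by rewrite e1E -e'E in pth eE; rewrite [X in _ || X](introT connectP) ?orbT //; exists p.
have [o1|n1] := boolP (rev_dart d' \in outer_darts T); last exact: half.
have [o2|n2] := boolP (rev_dart d \in outer_darts T).
  by rewrite (sweep_start cr cr' o2 o1) connect0.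
by rewrite orbC half // addnC.
Qed.

Lemma height_inj d d' : crossing d -> crossing d' -> height d = height d' -> d = d'.
Proof.
move=> cr cr' e; case/orP: (sweep_total cr cr') => /sweep_mono[//|].
- by rewrite e ltxx.
- by rewrite e ltxx.
Qed.

Lemma height_between d e : crossing d -> crossing e -> e \notin outer_darts T ->
  ~ (height e < height d < height (sweep_next e)).
Proof.
move=> cr cre nO /andP[l1 l2]; case/orP: (sweep_total cr cre) => [/sweep_mono|].
  by case=> [ed|lt]; [rewrite ed ltxx in l1 | rewrite (lt_gtF l1) in lt].
move=> /connectP[[|e1 p] /=]; first by move=> _ ed; rewrite ed ltxx in l1.
case/andP=> /and3P[_ _ /eqP ->] pth de.
have /sweep_mono : connect sweep_step (sweep_next e) d by apply/connectP; exists p.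
by case=> [ed|lt]; [rewrite ed ltxx in l2 | rewrite (lt_gtF l2) in lt].
Qed.

(* The origin lies in the interior of the triangle on the left of [(a, w)]. *)
Lemma no_crossing_inside a w d : aT a w -> (a, w) \notin outer_darts T ->
    let b := cT w a in
    0 < f a * s w - s a * f w -> 0 < f w * s b - s w * f b ->
    0 < f b * s a - s b * f a ->
  crossing d -> height d <> 0.
Proof.
move=> aw nO b p1 p2 p3 cr h0.
have [wb ba e1 e2 [n1 n2]] := triangle_face HT aw nO; rewrite -/b in wb ba e1 e2 n1 n2.
have inside u v c : aT u v -> (u, v) \notin outer_darts T -> cT v u = c ->
    f u < 0 -> 0 < f v ->
    0 < f u * s v - s u * f v -> 0 < f v * s c - s v * f c -> 0 < f c * s u - s c * f u ->
    False.
  move=> uv nuv ec fu fv q1 q2 q3.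
  have cruv : crossing (u, v) by rewrite /crossing /= uv fu fv.
  apply: (height_between cr cruv nuv); rewrite h0.
  have duv : 0 < f v - f u by lra.
  rewrite /sweep_next /= ec /height /= pmulr_llt0 ?invr_gt0 //.
  apply/andP; split; first by lra.
  have fc0 := f_neq0 c.
  case: (ltP 0 (f c)) => fc /=.
    by rewrite divr_gt0 //; lra.
  have {}fc : f c < 0 by rewrite lt_neqAle fc fc0.
  by rewrite divr_gt0 //; lra.
have fa0 := f_neq0 a; have fw0 := f_neq0 w; have fb0 := f_neq0 b.
have [fa|fa|/eqP] := ltgtP (f a) 0; last by rewrite (negPf fa0).
  have [fw|fw|/eqP] := ltgtP (f w) 0; last by rewrite (negPf fw0).
    have [fb|fb|/eqP] := ltgtP (f b) 0; last by rewrite (negPf fb0).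
      by nra.
    exact: (inside w b a).
  exact: (inside a w b).
have [fw|fw|/eqP] := ltgtP (f w) 0; last by rewrite (negPf fw0).
  have [fb|fb|/eqP] := ltgtP (f b) 0; last by rewrite (negPf fb0).
    exact: (inside b a w).
  exact: (inside w b a).
have [fb|fb|/eqP] := ltgtP (f b) 0; last by rewrite (negPf fb0).
  exact: (inside b a w).
by nra.
Qed.

End Sweep.

(** * Edges through a common point *)

Section StraightLine.

Variables (R : realFieldType) (V : finType) (T : framed_map V).
Hypothesis HT : irreducible_triangulation T.
Local Notation cT := (cw (fmap T)).
Local Notation aT := (adj (fmap T)).
Let plT := triangulation_plane HT.
Let aC := plane_adjC plT.

Variables (px py : V -> R).
Hypothesis positive : forall u v, aT u v -> (u, v) \notin outer_darts T ->
  0 < (px v - px u) * (py (cT v u) - py u) - (py v - py u) * (px (cT v u) - px u).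
Hypothesis parallelogram_x : px (vN T) + px (vS T) = px (vE T) + px (vW T).
Hypothesis parallelogram_y : py (vN T) + py (vS T) = py (vE T) + py (vW T).
Hypothesis edge_neq : forall u v, aT u v -> (px u, py u) != (px v, py v).

Definition on_edge (u v : V) (zx zy : R) := exists2 t : R, 0 <= t <= 1 &
  zx = (1 - t) * px u + t * px v /\ zy = (1 - t) * py u + t * py v.

Lemma avoid_values (l : seq R) : exists r : R, 0 < r /\ {in l, forall a, `|a| < r}.
Proof.
have ge0 (l' : seq R) : 0 <= \sum_(b <- l') `|b| by apply: sumr_ge0.
exists (1 + \sum_(a <- l) `|a|); split; first by apply: ltr_wpDr.
move=> a al; rewrite (big_rem a al) /= addrCA ltrDl ltr_pwDl //.
Qed.

Lemma small_value (l : seq R) (e0 : R) : 0 < e0 -> exists2 e : R, 0 < e < e0 & e \notin l.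
Proof.
move=> e00; have [r [r0 rl]] := avoid_values (e0^-1 :: [seq a^-1 | a <- l]).
have re0 : e0^-1 < r.
  by have := rl _ (mem_head _ _); rewrite ger0_norm // invr_ge0 ltW.
exists r^-1.
  by rewrite invr_gt0 r0 /= -[e0]invrK ltf_pV2 ?qualifE //= invr_gt0.
apply/negP=> /(map_f (fun a => a^-1)); rewrite /= invrK => rin.
have : `|r| < r by apply: rl; rewrite inE rin orbT.
by rewrite ger0_norm ?ltxx // ltW.
Qed.

Section Line.

Variables (zx zy B : R).
(** Coordinates centered at the point [(zx, zy)], obtained by a similarity of determinant
    [1 + B ^+ 2], which preserves orientations. The line [f = 0] runs over all lines through this
    point but one. *)
Let f v := (px v - zx) + B * (py v - zy).
Let s v := (py v - zy) - B * (px v - zx).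
Hypothesis f_neq0 : forall v, f v != 0.

Let pos' u v : aT u v -> (u, v) \notin outer_darts T ->
  0 < (f v - f u) * (s (cT v u) - s u) - (s v - s u) * (f (cT v u) - f u).
Proof.
move=> uv nO; have := positive uv nO; set c := cT v u => pos.
have -> : (f v - f u) * (s c - s u) - (s v - s u) * (f c - f u) =
  (1 + B ^+ 2) * ((px v - px u) * (py c - py u) - (py v - py u) * (px c - px u)).
  by rewrite /f /s; ring.
by apply: mulr_gt0 => //; rewrite ltr_wpDr // sqr_ge0.
Qed.

Let par' : f (vN T) + f (vS T) = f (vE T) + f (vW T).
Proof.
rewrite /f; have e1 := parallelogram_x; have e2 := parallelogram_y.
have -> : px (vN T) = px (vE T) + px (vW T) - px (vS T) by rewrite -e1 addrK.
have -> : py (vN T) = py (vE T) + py (vW T) - py (vS T) by rewrite -e2 addrK.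
by ring.
Qed.

Lemma on_edge_crossing u v : aT u v -> on_edge u v zx zy ->
  exists2 d, crossing T f d & height f s d = 0 /\ (d = (u, v) \/ d = (v, u)).
Proof.
move=> uv [t /andP[t0 t1] [ex ey]].
have ef : (1 - t) * f u + t * f v = 0 by rewrite /f [in LHS]ex [in LHS]ey; ring.
have es : (1 - t) * s u + t * s v = 0 by rewrite /s [in LHS]ex [in LHS]ey; ring.
have fu0 := f_neq0 u; have fv0 := f_neq0 v.
have tn0 : t != 0.
  by apply: contraNneq fu0 => e; move: ef; rewrite e subr0 mul1r mul0r addr0 => ->.
have tn1 : 1 - t != 0.
  by apply: contraNneq fv0 => e; move: ef; rewrite e (_ : t = 1) ?mul0r ?mul1r ?add0r => [->|] //; lra.
have tp : 0 < t by rewrite lt_neqAle eq_sym tn0.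
have tp' : 0 < 1 - t by rewrite lt_neqAle eq_sym tn1 subr_ge0.
have num : f v * s u - f u * s v = 0.
  have e1 : f v = - ((1 - t) * f u) / t.
    apply: (mulIf tn0); rewrite mulfVK // mulrC; apply/eqP.
    by rewrite -addr_eq0 addrC ef.
  have e2 : s v = - ((1 - t) * s u) / t.
    apply: (mulIf tn0); rewrite mulfVK // mulrC; apply/eqP.
    by rewrite -addr_eq0 addrC es.
  by rewrite e1 e2; field.
have [fu|fu|/eqP] := ltgtP (f u) 0; last by rewrite (negPf fu0).
- exists (u, v); last by rewrite /height /= num mul0r; split; [|left].
  by rewrite /crossing /= uv fu /= ; nra.
- exists (v, u); last first.
    rewrite /height /=; split; last by right.
    by rewrite -[f u * s v - _]opprB num oppr0 mul0r.
  by rewrite /crossing /= aC uv fu andbT /=; nra.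
Qed.

Lemma line_edge_inj u v u' v' : aT u v -> aT u' v' ->
  on_edge u v zx zy -> on_edge u' v' zx zy -> [set u; v] = [set u'; v'].
Proof.
move=> uv uv' /(on_edge_crossing uv)[d cr [h0 dE]] /(on_edge_crossing uv')[d' cr' [h0' dE']].
have e : d = d' by apply: (height_inj HT f_neq0 pos' par' cr cr'); rewrite h0 h0'.
move: dE'; rewrite -e; case: dE => -> [][-> ->] //; by rewrite setUC.
Qed.

Lemma line_triangle_empty a w u v : aT a w -> (a, w) \notin outer_darts T ->
    let b := cT w a in
    0 < (px a - zx) * (py w - zy) - (py a - zy) * (px w - zx) ->
    0 < (px w - zx) * (py b - zy) - (py w - zy) * (px b - zx) ->
    0 < (px b - zx) * (py a - zy) - (py b - zy) * (px a - zx) ->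
  aT u v -> ~ on_edge u v zx zy.
Proof.
move=> aw nO b p1 p2 p3 uv /(on_edge_crossing uv)[d cr [h0 _]].
have B2 : 0 < 1 + B ^+ 2 by rewrite ltr_wpDr // sqr_ge0.
have fs c e : f c * s e - s c * f e =
    (1 + B ^+ 2) * ((px c - zx) * (py e - zy) - (py c - zy) * (px e - zx)).
  by rewrite /f /s; ring.
apply: (no_crossing_inside HT f_neq0 pos' par' aw nO _ _ _ cr h0);
  rewrite -/b fs; exact: mulr_gt0.
Qed.

End Line.

Lemma line_ex zx zy : (forall v, (px v, py v) != (zx, zy)) ->
  exists B : R, forall v, (px v - zx) + B * (py v - zy) != 0.
Proof.
move=> nz; have [r [r0 rl]] := avoid_values [seq - ((px v - zx) / (py v - zy)) | v <- enum V].
exists r => v; have := nz v; rewrite xpair_eqE -subr_eq0 -[X in _ && X]subr_eq0.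
have [e _|ny _] := eqVneq (py v - zy) 0.
  by rewrite e mulr0 addr0; move: (nz v); rewrite xpair_eqE -[py v == zy]subr_eq0 e eqxx andbT subr_eq0.
apply/eqP=> e; have : `|r| < r.
  apply: rl; apply/mapP; exists v; first by rewrite mem_enum.
  apply: (mulIf ny); rewrite mulNr mulfVK //; apply/eqP; rewrite -addr_eq0 addrC.
  by rewrite e.
by rewrite ger0_norm ?ltxx // ltW.
Qed.

Lemma edge_inj zx zy u v u' v' : (forall w, (px w, py w) != (zx, zy)) ->
    aT u v -> aT u' v' -> on_edge u v zx zy -> on_edge u' v' zx zy ->
  [set u; v] = [set u'; v'].
Proof.
by move=> /line_ex[B nz] uv uv'; apply: (line_edge_inj nz).
Qed.

Lemma avoid_vertices zx zy dx dy e0 : (dx, dy) != (0, 0) -> 0 < e0 ->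
  exists2 e : R, 0 < e < e0 & forall w, (px w, py w) != (zx + e * dx, zy + e * dy).
Proof.
move=> nd e00.
pose l := [seq (px w - zx) / dx | w <- enum V] ++ [seq (py w - zy) / dy | w <- enum V].
have [e ee el] := small_value l e00; exists e => // w; apply: contraNneq el => -[ex ey].
rewrite mem_cat; move: nd; rewrite xpair_eqE negb_and => /orP[n0|n0]; apply/orP; [left|right].
  apply/mapP; exists w; rewrite ?mem_enum // ex.
  by rewrite addrAC subrr add0r mulfK.
apply/mapP; exists w; rewrite ?mem_enum // ey.
by rewrite addrAC subrr add0r mulfK.
Qed.

Lemma on_edge_toward u v zx zy e : on_edge u v zx zy -> 0 <= e <= 1 ->
  on_edge u v (zx + e * (px v - zx)) (zy + e * (py v - zy)).
Proof.
move=> [t /andP[t0 t1] [-> ->]] /andP[e0 e1]; exists (t + e * (1 - t)).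
  by apply/andP; split; nra.
by split; ring.
Qed.

(** Close to [w] the two edges share a point that is not a vertex, and [edge_inj] applies to it. *)
Lemma overlap w a u v l : aT w a -> aT u v -> on_edge u v (px w) (py w) -> 0 < l ->
    px v - px w = l * (px a - px w) -> py v - py w = l * (py a - py w) ->
  [set u; v] = [set w; a].
Proof.
move=> wa uv ew l0 ex ey; set dx := px v - px w in ex; set dy := py v - py w in ey.
have nd : (dx, dy) != (0, 0).
  have := edge_neq wa; apply: contraNneq => -[]; rewrite ex ey.
  move=> /eqP; rewrite mulf_eq0 gt_eqF //= subr_eq0 => /eqP ->.
  by move=> /eqP; rewrite mulf_eq0 gt_eqF //= subr_eq0 => /eqP ->.
(* The point is at the fraction [e] of the way from [w] to [v] and at the fraction [e * l] of the
   edge [w a]; the bound keeps both below 1. *)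
have e00 : 0 < (1 + l)^-1 by rewrite invr_gt0; lra.
have [e /andP[e0 e1] nv] := avoid_vertices (px w) (py w) nd e00.
have el : e * (1 + l) < 1 by rewrite -ltr_pdivlMr ?mul1r //; lra.
have l1 : 0 < 1 + l by lra.
apply: (edge_inj nv uv wa).
  by apply: on_edge_toward => //; apply/andP; split; nra.
exists (e * l); first by apply/andP; split; nra.
by rewrite ex ey; split; ring.
Qed.

(** An edge leaving [w] along a side of the corner overlaps that side. Strictly inside the corner it
    would enter the triangle, and a point of it that is not a vertex would contradict
    [line_triangle_empty]. *)
Lemma near w a u v l m : aT w a -> (a, w) \notin outer_darts T ->
    aT u v -> on_edge u v (px w) (py w) -> (px v, py v) != (px w, py w) ->
    0 <= l -> 0 <= m ->
    px v - px w = l * (px a - px w) + m * (px (cT w a) - px w) ->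
    py v - py w = l * (py a - py w) + m * (py (cT w a) - py w) ->
  [set u; v] = [set w; a] \/ [set u; v] = [set w; cT w a].
Proof.
move=> wa nO uv ew nvw l0 m0 ex ey; have aw : aT a w by rewrite aC.
have wb : aT w (cT w a) by apply: plane_cw_adj.
have [el|ln0] := eqVneq l 0.
  right; apply: (overlap wb uv ew (l := m)); last 2 first.
  - by rewrite ex el mul0r add0r.
  - by rewrite ey el mul0r add0r.
  rewrite lt_neqAle m0 andbT; apply: contraNneq nvw => em.
  by rewrite -[px v](subrK (px w)) -[py v](subrK (py w)) ex ey el -em !mul0r !add0r.
have lp : 0 < l by rewrite lt_neqAle eq_sym ln0.
have [em|mn0] := eqVneq m 0.
  by left; apply: (overlap wa uv ew lp); rewrite ?ex ?ey em mul0r addr0.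
have mp : 0 < m by rewrite lt_neqAle eq_sym mn0.
have nd : (px v - px w, py v - py w) != (0, 0).
  by move: nvw; rewrite !xpair_eqE !subr_eq0.
(* The chosen point has barycentric coordinates [e * l], [e * m] and [1 - e * l - e * m] in the
   triangle; the bound makes the last one positive. *)
have e00 : 0 < (1 + l + m)^-1 by rewrite invr_gt0; lra.
have [e /andP[e0 e1] nv] := avoid_vertices (px w) (py w) nd e00.
have lm1 : 0 < 1 + l + m by lra.
have elm : e * (1 + l + m) < 1 by rewrite -ltr_pdivlMr ?mul1r.
have [B nz] := line_ex nv.
have pos := positive aw nO; set b := cT w a in ex ey wb pos *.
exfalso; apply: (line_triangle_empty nz aw nO _ _ _ uv); last first.
- by apply: on_edge_toward => //; apply/andP; split; nra.
all: rewrite -/b ex ey.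
- have -> : forall x1 y1 x2 y2 x3 y3 : R, 
    (x3 - (x2 + e * (l * (x1 - x2) + m * (x3 - x2)))) * (y1 - (y2 + e * (l * (y1 - y2) + m * (y3 - y2)))) -
    (y3 - (y2 + e * (l * (y1 - y2) + m * (y3 - y2)))) * (x1 - (x2 + e * (l * (x1 - x2) + m * (x3 - x2)))) =
    (1 - e * l - e * m) * ((x2 - x1) * (y3 - y1) - (y2 - y1) * (x3 - x1)) by move=> *; ring.
  by apply: mulr_gt0 => //; lra.
- have -> : forall x1 y1 x2 y2 x3 y3 : R, 
    (x2 - (x2 + e * (l * (x1 - x2) + m * (x3 - x2)))) * (y3 - (y2 + e * (l * (y1 - y2) + m * (y3 - y2)))) -
    (y2 - (y2 + e * (l * (y1 - y2) + m * (y3 - y2)))) * (x3 - (x2 + e * (l * (x1 - x2) + m * (x3 - x2)))) =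
    (e * l) * ((x2 - x1) * (y3 - y1) - (y2 - y1) * (x3 - x1)) by move=> *; ring.
  by apply: mulr_gt0 => //; apply: mulr_gt0.
- have -> : forall x1 y1 x2 y2 x3 y3 : R, 
    (x1 - (x2 + e * (l * (x1 - x2) + m * (x3 - x2)))) * (y2 - (y2 + e * (l * (y1 - y2) + m * (y3 - y2)))) -
    (y1 - (y2 + e * (l * (y1 - y2) + m * (y3 - y2)))) * (x2 - (x2 + e * (l * (x1 - x2) + m * (x3 - x2)))) =
    (e * m) * ((x2 - x1) * (y3 - y1) - (y2 - y1) * (x3 - x1)) by move=> *; ring.
  by apply: mulr_gt0 => //; apply: mulr_gt0.
Qed.

End StraightLine.

Local Close Scope ring_scope.

(** * Drawings in which every edge lies in the quadrant of its class *)

Section BoxDrawing.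

Variables (R : realFieldType) (V : finType) (T : framed_map V).
Variable X : bicolor_orientation V.
Hypotheses (HT : irreducible_triangulation T) (HX : transversal_pair T X).

Local Notation N := (vN T).
Local Notation E := (vE T).
Local Notation S := (vS T).
Local Notation W := (vW T).
Local Notation cT := (cw (fmap T)).
Local Notation aT := (adj (fmap T)).
Local Notation clsX := (cls T X).

Let plT := triangulation_plane HT.
Let aC := plane_adjC plT.

Local Open Scope ring_scope.

Variables (px py : V -> R) (w h : R).
Hypothesis rd_box : forall u v, rd T X u v -> px u <= px v /\ py u < py v.
Hypothesis bl_box : forall u v, bl T X u v -> px u < px v /\ py v <= py u.
Hypothesis draw_corners : [/\ px S = 0, py S = 0, px W = 0 & py W = h] /\
  [/\ px N = w, py N = h, px E = w & py E = 0].
Hypothesis draw_box : forall v, [/\ 0 <= px v, px v <= w, 0 <= py v & py v <= h].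
Hypotheses (w_gt0 : 0 < w) (h_gt0 : 0 < h).

(** Half-open quadrants in clockwise order. They partition the nonzero vectors, and being half-open
    they make the turn from a quadrant to the next one strictly clockwise. *)
Definition quad (k : nat) (dx dy : R) : bool :=
  match k with
  | 0 => (0 <= dx) && (0 < dy)
  | 1 => (0 < dx) && (dy <= 0)
  | 2 => (dx <= 0) && (dy < 0)
  | _ => (dx < 0) && (0 <= dy)
  end.

Lemma quad_step k dx dy ex ey : (k < 4)%N -> quad k dx dy ->
  quad (k.+1 %% 4) ex ey -> dx * ey - dy * ex < 0.
Proof.
by case: k => [|[|[|[|]]]] //= _ /andP[h1 h2] /andP[h3 h4]; nra.
Qed.

Lemma quad_ex dx dy : (dx, dy) != (0, 0) -> exists2 k, (k < 4)%N & quad k dx dy.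
Proof.
move=> nz; have [y0|y0|y0] := ltgtP dy 0.
- have [x0|x0] := ltP 0 dx; first by exists 1%N; rewrite //= x0 ltW.
  by exists 2%N; rewrite //= x0.
- have [x0|x0] := ltP dx 0; first by exists 3%N; rewrite //= x0 ltW.
  by exists 0%N; rewrite //= x0.
- have [x0|x0|x0] := ltgtP dx 0.
  + by exists 3%N; rewrite //= x0 y0 lexx.
  + by exists 1%N; rewrite //= x0 y0 lexx.
  + by move: nz; rewrite x0 y0 eqxx.
Qed.

Lemma cls_quad v a : aT v a -> quad (clsX v a) (px a - px v) (py a - py v).
Proof.
move=> va; have := arc_unique HT HX va; rewrite /cls.
have [/rd_box[h1 h2] _|_] := boolP (rd T X v a).
  by rewrite /= subr_ge0 subr_gt0 h1 h2.
have [/bl_box[h1 h2] _|_] := boolP (bl T X v a).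
  by rewrite /= subr_gt0 subr_le0 h1 h2.
have [/rd_box[h1 h2] _|_] := boolP (rd T X a v).
  by rewrite /= subr_le0 subr_lt0 h1 h2.
case: (boolP (bl T X a v)) => // /bl_box[h1 h2] _.
by rewrite /= subr_lt0 subr_ge0 h1 h2.
Qed.

(** The class cannot stay the same at both of the corners at [v] and at [c], by addition modulo 4
    around the triangle. Where it changes, the two sides lie in consecutive quadrants, and this
    determines the orientation. *)
Lemma draw_positive u v : aT u v -> (u, v) \notin outer_darts T ->
  0 < (px v - px u) * (py (cT v u) - py u) - (py v - py u) * (px (cT v u) - px u).
Proof.
move=> uv nO; have vu : aT v u by rewrite aC.
have [vc cu e1 e2 [n1 n2]] := triangle_face HT uv nO; set c := cT v u in vc cu e1 e2 n1 n2 *.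
have cv : aT c v by rewrite aC.
have uc : aT u c by rewrite aC.
have s1 := cls_step HT HX vu nO; have s2 := cls_step HT HX cv n1.
have s3 := cls_step HT HX uc n2; rewrite -/c in s1; rewrite e1 in s2; rewrite e2 in s3.
have r1 := cls_rev HT HX vc; have r2 := cls_rev HT HX cu; have r3 := cls_rev HT HX uv.
case: s1 => [s1|s1]; last first.
  have := quad_step (cls_lt T X v u) (cls_quad vu); rewrite -s1 => /(_ _ _ (cls_quad vc)).
  by rewrite -oppr_gt0; congr (0 < _); ring.
case: s2 => [s2|s2]; last first.
  have := quad_step (cls_lt T X c v) (cls_quad cv); rewrite -s2 => /(_ _ _ (cls_quad cu)).
  by rewrite -oppr_gt0; congr (0 < _); ring.
exfalso; move: s3; rewrite r2 s2 r1 s1 r3.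
by move: (clsX u v) (cls_lt T X u v); case=> [|[|[|[|]]]] //= _ [].
Qed.

Lemma draw_par_x : px N + px S = px E + px W.
Proof. by have [[-> _ -> _] [-> _ -> _]] := draw_corners. Qed.
Lemma draw_par_y : py N + py S = py E + py W.
Proof. by have [[_ -> _ ->] [_ -> _ ->]] := draw_corners; rewrite addrC. Qed.

Lemma draw_edge_neq u v : aT u v -> (px u, py u) != (px v, py v).
Proof.
move=> uv; apply: contraTneq (cls_quad uv) => -[-> ->]; rewrite !subrr.
by case: (clsX u v) => [|[|[|]]]; rewrite /= ltxx ?andbF.
Qed.

Let nearX := near HT draw_positive draw_par_x draw_par_y draw_edge_neq.
Let overlapX := overlap HT draw_positive draw_par_x draw_par_y draw_edge_neq.
Let edge_injX := edge_inj HT draw_positive draw_par_x draw_par_y.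
Local Notation on_edge := (on_edge px py).

Section Cone.

Variables (v : V) (dx dy : R).
Let cr a := (px a - px v) * dy - (py a - py v) * dx.

Lemma cone_coords a : aT v a -> (a, v) \notin outer_darts T -> cr a <= 0 ->
    0 <= cr (cT v a) -> exists l m, [/\ 0 <= l, 0 <= m,
    dx = l * (px a - px v) + m * (px (cT v a) - px v) &
    dy = l * (py a - py v) + m * (py (cT v a) - py v)].
Proof.
move=> va nO c1 c2; have av : aT a v by rewrite aC.
have := draw_positive av nO; set b := cT v a in c2 *.
set K := _ - _ => K0; have Kn0 : K != 0 by rewrite gt_eqF.
exists (cr b / K), (- cr a / K); split.
- by rewrite divr_ge0 // ltW.
- by rewrite divr_ge0 ?oppr_ge0 // ltW.
- apply: (mulIf Kn0); rewrite mulrDl [X in _ = X + _]mulrAC [X in _ = _ + X]mulrAC.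
  by rewrite !divfK // /cr /K; ring.
- apply: (mulIf Kn0); rewrite mulrDl [X in _ = X + _]mulrAC [X in _ = _ + X]mulrAC.
  by rewrite !divfK // /cr /K; ring.
Qed.

Definition in_cone := exists a l m, [/\ aT v a, (a, v) \notin outer_darts T,
  0 <= l, 0 <= m & dx = l * (px a - px v) + m * (px (cT v a) - px v) /\
                   dy = l * (py a - py v) + m * (py (cT v a) - py v)].

Lemma cone_at a : aT v a -> (a, v) \notin outer_darts T -> cr a <= 0 -> 0 <= cr (cT v a) ->
  in_cone.
Proof.
by move=> va nO c1 c2; have [l [m [l0 m0 ex ey]]] := cone_coords va nO c1 c2; exists a, l, m.
Qed.

(** The first neighbour after [b0] with a positive [cr] closes the corner that contains the
    direction [(dx, dy)]. *)
Lemma cone_transition b0 b1 : aT v b0 -> aT v b1 -> cr b0 <= 0 -> 0 < cr b1 ->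
    (forall j, (j < findex (cT v) b0 b1)%N -> (iter j (cT v) b0, v) \notin outer_darts T) ->
  in_cone.
Proof.
move=> v0 v1 c0 c1 nO.
have fc : fconnect (cT v) b0 b1 by rewrite (plane_cwP plT).
have ex : exists j, 0 < cr (iter j (cT v) b0) by exists (findex (cT v) b0 b1); rewrite iter_findex.
case: (ex_minnP ex) => -[|j] cj min; first by rewrite ltNge c0 in cj.
have jf : (j.+1 <= findex (cT v) b0 b1)%N by apply: min; rewrite iter_findex.
apply: (@cone_at (iter j (cT v) b0)).
- by rewrite -(plane_cwP plT _ v0) fconnect_iter.
- exact: nO.
- by rewrite leNgt; apply/negP=> /min; rewrite ltnn.
- exact: ltW.
Qed.

(** For a direction in the quadrant [k], the neighbours of class [k + 3] and of class [k + 1], which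
    exist at an inner vertex, lie on either side of it. *)
Lemma inner_cone : inner_vertex T v -> (dx, dy) != (0, 0) -> in_cone.
Proof.
move=> iv /quad_ex[k k4 qk].
have [t0 [t1 [t2 [t3 [_ mem [n0 n1 n2 n3] [c0 c1 c2 c3]]]]]] := blocks HT HX k iv.
case: t1 n1 c1 mem => [//|b1 p1] _ /andP[/eqP k1 _] mem.
case: t3 n3 c3 mem => [//|b3 p3] _ /andP[/eqP k3 _] mem.
have v1 : aT v b1 by rewrite -[aT v b1]mem !mem_cat mem_head !orbT.
have v3 : aT v b3 by rewrite -[aT v b3]mem !mem_cat mem_head !orbT.
apply: (cone_transition v3 v1).
- have k34 : (((k + 3) %% 4).+1 %% 4 = k)%N by rewrite -addn1 mod4_add modnDr modn_small.
  have q3 := cls_quad v3; rewrite k3 in q3.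
  have := quad_step (ltn_pmod _ _) q3; rewrite k34 => /(_ _ _ isT qk).
  by rewrite /cr => /ltW.
- have q1 := cls_quad v1; rewrite k1 addn1 in q1; have := quad_step k4 qk q1.
  by rewrite /cr -oppr_gt0; congr (0 < _); ring.
- move=> j _; apply: contraL iv; rewrite /outer_darts !inE !xpair_eqE -!orbA negbK !inE.
  by case/or4P=> /andP[_ ->]; rewrite ?orbT.
Qed.

Lemma outer_cone b0 b1 : aT v b0 -> aT v b1 -> cr b0 <= 0 -> 0 <= cr b1 ->
    (forall a, (a, v) \in outer_darts T -> a = b1) ->
  in_cone \/ cr b1 = 0.
Proof.
move=> v0 v1 c0 c1 out; have [e|ne] := eqVneq (cr b1) 0; [by right | left].
apply: (cone_transition v0 v1 c0); first by rewrite lt_neqAle eq_sym ne.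
move=> j lt; apply/negP=> /out ej.
have fc : fconnect (cT v) b0 b1 by rewrite (plane_cwP plT).
have := findex_iter (ltn_trans lt (findex_max fc)); rewrite ej => e.
by rewrite e ltnn in lt.
Qed.

End Cone.

Lemma outer_head v : ~~ inner_vertex T v -> exists b0 b1,
  [/\ aT v b0, aT v b1, cT v b1 = b0 & forall a, (a, v) \in outer_darts T -> a = b1].
Proof.
have [c1 c2 c3 c4] := outer_cw HT; have [[a1 a2 a3 a4] [b1 b2 b3 b4]] := adj_outer HT.
have ne := outer_neqs HT.
have out a u : (a, u) \in outer_darts T -> [\/ u = E /\ a = N, u = S /\ a = E, u = W /\ a = S | u = N /\ a = W].
  by rewrite /outer_darts !inE -!orbA => /or4P[]/eqP[-> ->];
    [constructor 1|constructor 2|constructor 3|constructor 4].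
case/outer_vertexP=> ->; [exists E, W|exists S, N|exists W, E|exists N, S]; split=> // a /out[][]//;
  by move=> /eqP; rewrite ne.
Qed.

(* The vectors from a corner of the box to its two outer neighbours are axis
   parallel, and they enclose the box. *)
Lemma corner_box v b0 b1 q : ~~ inner_vertex T v -> aT v b1 -> cT v b1 = b0 ->
    (forall a, (a, v) \in outer_darts T -> a = b1) ->
  let cr a b := (px a - px v) * (py b - py v) - (py a - py v) * (px b - px v) in
  let dot a b := (px a - px v) * (px b - px v) + (py a - py v) * (py b - py v) in
  [/\ cr b0 q <= 0, 0 <= cr b1 q, 0 <= dot b0 q, 0 <= dot b1 q &
      (px q, py q) != (px v, py v) -> (cr b0 q = 0 -> 0 < dot b0 q) /\ (cr b1 q = 0 -> 0 < dot b1 q)].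
Proof.
move=> ov v1 e out; have [c1 c2 c3 c4] := outer_cw HT.
have [oN oE oS oW] := outer_dart_mem T.
have [[xS yS xW yW] [xN yN xE yE]] := draw_corners.
have [q1 q2 q3 q4] := draw_box q; have w0 := w_gt0; have h0 := h_gt0.
have pos (x y : R) : (x, y) != (0, 0) -> 0 <= x -> 0 <= y -> (x = 0 -> 0 < y) /\ (y = 0 -> 0 < x).
  move=> nz x0 y0; split=> z0; rewrite z0 ?eqxx xpair_eqE eqxx ?andbT ?andTb /= in nz.
    by rewrite lt_neqAle eq_sym nz.
  by rewrite lt_neqAle eq_sym nz.
case/outer_vertexP: ov v1 e out => -> v1 e out /=.
- have eb := out _ oW; subst b1; rewrite c4 in e; subst b0.
  rewrite xN yN xE yE xW yW; split; [nra|nra|nra|nra|] => nz.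
  have [|||p1 p2] := pos (w - px q) (h - py q); [|lra|lra|].
    by apply: contraNneq nz => -[n1 n2]; apply/eqP; congr pair; lra.
  split=> z0.
    have z1 : w - px q = 0 by nra.
    by have := p1 z1; nra.
  have z1 : h - py q = 0 by nra.
  by have := p2 z1; nra.
- have eb := out _ oN; subst b1; rewrite c1 in e; subst b0.
  rewrite xN yN xE yE xS yS; split; [nra|nra|nra|nra|] => nz.
  have [|||p1 p2] := pos (w - px q) (py q); [|lra|lra|].
    by apply: contraNneq nz => -[n1 n2]; apply/eqP; congr pair; lra.
  split=> z0.
    have z1 : py q = 0 by nra.
    by have := p2 z1; nra.
  have z1 : w - px q = 0 by nra.
  by have := p1 z1; nra.
- have eb := out _ oE; subst b1; rewrite c2 in e; subst b0.
  rewrite xW yW xE yE xS yS; split; [nra|nra|nra|nra|] => nz.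
  have [|||p1 p2] := pos (px q) (py q); [|lra|lra|].
    by apply: contraNneq nz => -[n1 n2]; apply/eqP; congr pair; lra.
  split=> z0.
    have z1 : px q = 0 by nra.
    by have := p1 z1; nra.
  have z1 : py q = 0 by nra.
  by have := p2 z1; nra.
- have eb := out _ oS; subst b1; rewrite c3 in e; subst b0.
  rewrite xW yW xN yN xS yS; split; [nra|nra|nra|nra|] => nz.
  have [|||p1 p2] := pos (px q) (h - py q); [|lra|lra|].
    by apply: contraNneq nz => -[n1 n2]; apply/eqP; congr pair; lra.
  split=> z0.
    have z1 : h - py q = 0 by nra.
    by have := p2 z1; nra.
  have z1 : px q = 0 by nra.
  by have := p1 z1; nra.
Qed.

Lemma collinear_scale (ax ay bx b_y : R) : ax * b_y - ay * bx = 0 -> 0 < ax * bx + ay * b_y ->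
  exists l : R, [/\ 0 < l, bx = l * ax & b_y = l * ay].
Proof.
move=> c0 d0; have n0 : 0 < ax ^+ 2 + ay ^+ 2.
  rewrite lt_neqAle addr_ge0 ?sqr_ge0 // andbT eq_sym paddr_eq0 ?sqr_ge0 // !sqrf_eq0.
  by apply: contraTN d0 => /andP[/eqP -> /eqP ->]; rewrite !mul0r addr0 ltxx.
have nn := gt_eqF n0.
exists ((ax * bx + ay * b_y) / (ax ^+ 2 + ay ^+ 2)); split.
- exact: divr_gt0.
- apply: (mulIf (negbT nn)); rewrite mulrAC divfK ?nn //; apply/eqP; rewrite -subr_eq0; apply/eqP.
  transitivity (- ay * (ax * b_y - ay * bx)); first by ring.
  by rewrite c0 mulr0.
- apply: (mulIf (negbT nn)); rewrite mulrAC divfK ?nn //; apply/eqP; rewrite -subr_eq0; apply/eqP.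
  transitivity (ax * (ax * b_y - ay * bx)); first by ring.
  by rewrite c0 mulr0.
Qed.

(** The direction from [q] to [v] lies in an inner corner at [q], or along the outer neighbour that
    precedes the outer corner. In both cases the edge coincides with an edge at [q]. *)
Lemma toward u v q : aT u v -> on_edge u v (px q) (py q) -> (px v, py v) != (px q, py q) ->
  q \in [set u; v].
Proof.
move=> uv oq nvq.
have nz : (px v - px q, py v - py q) != (0, 0) by move: nvq; rewrite !xpair_eqE !subr_eq0.
have from_cone : in_cone q (px v - px q) (py v - py q) -> q \in [set u; v].
  move=> [a [l [m [qa nO l0 m0 [ex ey]]]]].
  by have [->|->] := nearX qa nO uv oq nvq l0 m0 ex ey; rewrite !inE eqxx.
have [iq|oqq] := boolP (inner_vertex T q); first by apply: from_cone; apply: inner_cone.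
have [b0 [b1 [q0 q1 e out]]] := outer_head oqq.
have [k1 k2 _ _ /(_ nvq)[_ k3]] := corner_box v oqq q1 e out.
have [/from_cone //|z0] := outer_cone q0 q1 k1 k2 out.
have [l [l0 ex ey]] := collinear_scale z0 (k3 z0).
by have -> := overlapX q1 uv oq l0 ex ey; rewrite !inE eqxx.
Qed.

Lemma on_edge_sym u v zx zy : on_edge u v zx zy -> on_edge v u zx zy.
Proof.
move=> [t /andP[t0 t1] [-> ->]]; exists (1 - t); first by apply/andP; split; lra.
by split; ring.
Qed.

Lemma vertex_on_edge u v q : aT u v -> on_edge u v (px q) (py q) -> q \in [set u; v].
Proof.
move=> uv oq; have [e|nv] := eqVneq (px v, py v) (px q, py q); last exact: toward.
have vu : aT v u by rewrite aC.
rewrite setUC; apply: (toward vu (on_edge_sym oq)).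
by rewrite -e; apply: draw_edge_neq.
Qed.

Lemma no_overlap v a b : aT v a -> aT v b -> a != b ->
    0 < (px a - px v) * (px b - px v) + (py a - py v) * (py b - py v) ->
  (px a - px v) * (py b - py v) - (py a - py v) * (px b - px v) != 0.
Proof.
move=> va vb ab d0; apply: contraNneq ab => c0.
have [l [l0 ex ey]] := collinear_scale c0 d0.
have ov : on_edge v b (px v) (py v).
  by exists 0; rewrite ?lexx ?ler01 //; split; ring.
have := overlapX va vb ov l0 ex ey => /setP/(_ a).
rewrite !inE eqxx orbT => /orP[/eqP av|//].
by move: va; rewrite av (plane_adjI plT).
Qed.

(** At the outer corner the two outer neighbours enclose the box, and [b] lies strictly between
    them. At another corner the triangle gives one clockwise turn; without a second one, [b] would
    lie in the cone of the corner, against [near]. *)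
Lemma draw_rotation v a b : aT v a -> aT v b -> uniq [:: a; cT v a; b] ->
  clockwise_around (px v, py v) (px a, py a) (px (cT v a), py (cT v a)) (px b, py b).
Proof.
move=> va vb; rewrite /= !inE negb_or andbT => /andP[/andP[aa' ab] a'b].
have va' : aT v (cT v a) by apply: plane_cw_adj.
have av : aT a v by rewrite aC.
rewrite /clockwise_around /cross /=; set a' := cT v a in aa' a'b va' *.
have [oa|na] := boolP ((a, v) \in outer_darts T).
  have ov : ~~ inner_vertex T v.
    move: oa; rewrite negbK /outer_darts !inE !xpair_eqE -!orbA.
    by case/or4P=> /andP[_ ->]; rewrite ?orbT.
  have [b0 [b1 [q0 q1 e out]]] := outer_head ov.
  have ea := out _ oa; subst b1; rewrite -/a' in e; subst b0.
  have nbv : (px b, py b) != (px v, py v) by rewrite eq_sym draw_edge_neq.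
  have [k1 k2 k3 k4 /(_ nbv)[k5 k6]] := corner_box b ov va erefl out.
  rewrite -/a' in k1 k2 k3 k4 k5 k6.
  set A := (px a' - px v) * (py b - py v) - _ in k1 k5 *.
  set B := (px a - px v) * (py b - py v) - _ in k2 k6.
  have A0 : A < 0.
    rewrite lt_neqAle k1 andbT; have [z|//] := eqVneq A 0.
    by have := no_overlap va' vb a'b (k5 z); rewrite -/A z eqxx.
  have B0 : 0 < B.
    rewrite lt_neqAle k2 andbT eq_sym; have [z|//] := eqVneq B 0.
    by have := no_overlap va vb ab (k6 z); rewrite -/B z eqxx.
  rewrite A0; have -> : (px b - px v) * (py a - py v) - (py b - py v) * (px a - px v) < 0.
    by rewrite -oppr_gt0; move: B0; rewrite /B; congr (0 < _); ring.
  by rewrite /= addn1 !addnS.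
have := draw_positive av na; rewrite -/a' => pos.
have -> : (px a - px v) * (py a' - py v) - (py a - py v) * (px a' - px v) < 0.
  by rewrite -oppr_gt0; move: pos; congr (0 < _); ring.
case: ltP => c1; first by case: (_ < 0).
case: ltP => c2 //; exfalso.
have [||l [m [l0 m0 ex ey]]] := @cone_coords v (px b - px v) (py b - py v) a va na.
- by rewrite -oppr_ge0; move: c2; congr (0 <= _); ring.
- by rewrite -/a'.
have ov : on_edge v b (px v) (py v).
  by exists 0; rewrite ?lexx ?ler01 //; split; ring.
have nbv : (px b, py b) != (px v, py v) by rewrite eq_sym draw_edge_neq.
have bv : b != v by apply: contraTneq vb => ->; rewrite (plane_adjI plT).
have [/setP/(_ b)|/setP/(_ b)] := nearX va na vb ov nbv l0 m0 ex ey;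
  rewrite !inE eqxx orbT (negPf bv) /=.
- by rewrite eq_sym (negPf ab).
- by rewrite eq_sym (negPf a'b).
Qed.

Lemma draw_inj : injective (fun v => (px v, py v)).
Proof.
move=> u v e; apply/eqP; apply: contraT => uv.
have [a ua] : exists a, aT u a.
  have [_ _ /(_ u v)/connectP[[|a q] /= pth el] _] := plT; first by rewrite el eqxx in uv.
  by exists a; case/andP: pth.
have : v \in [set u; a].
  apply: vertex_on_edge => //; case: e => <- <-.
  by exists 0; rewrite ?lexx ?ler01 //; split; ring.
rewrite !inE eq_sym (negPf uv) /= => /eqP va.
by have := draw_edge_neq ua; rewrite -va e eqxx.
Qed.

Lemma draw_crossing u v u' v' zx zy : aT u v -> aT u' v' ->
    on_edge u v zx zy -> on_edge u' v' zx zy ->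
  [set u; v] = [set u'; v'] \/
  exists2 q, q \in [set u; v] :&: [set u'; v'] & (zx, zy) = (px q, py q).
Proof.
move=> uv uv' oe oe'; have [/existsP[q /eqP eq]|/existsPn nv] :=
  boolP [exists q, (px q, py q) == (zx, zy)]; last by left; apply: (edge_injX nv).
case: eq => ex ey; rewrite -ex -ey in oe oe' *; right; exists q => //.
by rewrite in_setI !vertex_on_edge.
Qed.

End BoxDrawing.

(** * The drawing given by abscissas and ordinates *)

Section TransversalDraw.

Variables (V : finType) (T : framed_map V) (X : bicolor_orientation V).
Hypotheses (HT : irreducible_triangulation T) (HX : transversal_pair T X).

Let HT' := turn_irreducible HT.
Let HX' := turn_transversal HT HX.

Lemma ordinate_rd u v : rd T X u v -> ordinate T X u < ordinate T X v.
Proof. by move=> r; rewrite !turn_ordinate; apply: (abscissa_bl HT' HX'). Qed.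

Lemma ordinate_bl u v : bl T X u v -> ordinate T X v <= ordinate T X u.
Proof.
by move=> b; rewrite !turn_ordinate; apply: (abscissa_rd HT' HX'); rewrite turn_rd.
Qed.

Lemma ordinate_bound v : ordinate T X v <= box_height T X.
Proof. by rewrite turn_ordinate; apply: (abscissa_bound HT' HX'). Qed.

Lemma box_height_gt0 : 0 < box_height T X.
Proof. exact: (box_width_gt0 HT' HX'). Qed.

Lemma ordinate_outer :
  [/\ ordinate T X (vS T) = 0, ordinate T X (vE T) = 0,
      ordinate T X (vN T) = box_height T X & ordinate T X (vW T) = box_height T X].
Proof.
by have [h1 h2 h3 h4] := abscissa_outer HT' HX'; split; rewrite turn_ordinate;
  [exact: h2 | exact: h1 | exact: h4 | exact: h3].
Qed.

Lemma drawing_grid_size :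
  grid_size (abscissa T X) (ordinate T X) (box_width T X) (box_height T X).
Proof.
have [x1 x2 x3 x4] := abscissa_outer HT HX; have [y1 y2 y3 y4] := ordinate_outer.
split.
- by move=> v; split; [apply: abscissa_bound | apply: ordinate_bound].
- by split; [exists (vS T) | exists (vN T)].
- by split; [exists (vS T) | exists (vN T)].
Qed.

Lemma drawing_straight_line (R : realFieldType) :
  straight_line_drawing R T (abscissa T X) (ordinate T X).
Proof.
pose px v : R := (abscissa T X v)%:R%R; pose py v : R := (ordinate T X v)%:R%R.
pose w : R := (box_width T X)%:R%R; pose h : R := (box_height T X)%:R%R.
have rb u v : rd T X u v -> (px u <= px v)%R /\ (py u < py v)%R.
  by move=> r; rewrite ler_nat ltr_nat (abscissa_rd HT HX) ?ordinate_rd.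
have bb u v : bl T X u v -> (px u < px v)%R /\ (py v <= py u)%R.
  by move=> r; rewrite ler_nat ltr_nat (abscissa_bl HT HX) ?ordinate_bl.
have [x1 x2 x3 x4] := abscissa_outer HT HX; have [y1 y2 y3 y4] := ordinate_outer.
have co : [/\ px (vS T) = 0, py (vS T) = 0, px (vW T) = 0 & py (vW T) = h]%R /\
    [/\ px (vN T) = w, py (vN T) = h, px (vE T) = w & py (vE T) = 0]%R.
  by rewrite /px /py x1 x2 x3 x4 y1 y2 y3 y4.
have bx v : [/\ 0 <= px v, px v <= w, 0 <= py v & py v <= h]%R.
  by split; rewrite ?ler0n // ler_nat; [apply: abscissa_bound | apply: ordinate_bound].
have w0 : (0 < w)%R by rewrite ltr0n box_width_gt0.
have h0 : (0 < h)%R by rewrite ltr0n box_height_gt0.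
split.
- exact: (draw_inj HT HX rb bb co bx w0 h0).
- move=> u v q uv [t t01 [ex ey]].
  have : q \in [set u; v].
    by apply: (vertex_on_edge HT HX rb bb co bx w0 h0 uv); exists t.
  by rewrite !inE => /orP[]/eqP ->; auto.
- move=> u v u' v' [zx zy] uv uv' [t t01 [ex ey]] [t' t01' [ex' ey']].
  have oe : on_edge px py u v zx zy := ex_intro2 _ _ t t01 (conj ex ey).
  have oe' : on_edge px py u' v' zx zy := ex_intro2 _ _ t' t01' (conj ex' ey').
  exact: (draw_crossing HT HX rb bb co bx w0 h0 uv uv' oe oe').
- exact: (draw_rotation HT HX rb bb co bx w0 h0).
- rewrite /grid_point x1 x2 x3 x4 y1 y2 y3 y4 -/w -/h /area2 /cross; cbn [fst snd].
  move: w h w0 h0 {rb bb co bx} => w h w0 h0.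
  have := mulr_gt0 (ltr0Sn R 1) (mulr_gt0 w0 h0); rewrite -oppr_lt0.
  by congr (_ < 0)%R; ring.
Qed.

End TransversalDraw.

(** * Contour walks *)


(* Clockwise walk around a spanning tree, given by its parent function. *)
Section Contour.

Variables (V : finType) (T : framed_map V).
Hypothesis HT : irreducible_triangulation T.
Local Notation cT := (cw (fmap T)).
Local Notation aT := (adj (fmap T)).
Let plT := triangulation_plane HT.
Let aC := plane_adjC plT.

Variables (par : V -> V) (root : V) (r : V -> nat).
Hypothesis par_adj : forall v, v != root -> aT v (par v).
Hypothesis par_rank : forall v, v != root -> r (par v) < r v.

Definition parent_dart (d : V * V) := (d.1 != root) && (d.2 == par d.1).
Definition tree_dart (d : V * V) := parent_dart d || parent_dart (rev_dart d).
(** A tree edge is followed, any other edge is passed over by turning around the origin. The face on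
    the left therefore changes only when a non-tree edge is passed over. *)
Definition contour (d : V * V) :=
  if tree_dart d then (d.2, cT d.2 d.1) else (d.1, cT d.1 d.2).

Lemma tree_dart_rev d : tree_dart (rev_dart d) = tree_dart d.
Proof. by rewrite /tree_dart orbC; case: d. Qed.

Lemma contour_darts : {homo contour : d / d \in darts T}.
Proof.
move=> [a b]; rewrite /contour; case: ifP => _; rewrite !inE /= => ab.
  by apply: plane_cw_adj; rewrite // aC.
exact: plane_cw_adj.
Qed.

Variable start : V * V.
Hypotheses (start_dart : start \in darts T) (start_root : start.1 = root).

Local Notation reached d := (fconnect contour start d).

Lemma contour_step d : reached d -> reached (contour d).
Proof. by move=> h; apply: connect_trans h (fconnect1 _ _). Qed.

Lemma contour_rotate v a0 : aT v a0 -> reached (v, a0) ->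
    (forall a, aT v a -> reached (v, a) -> reached (v, cT v a)) ->
  forall a, aT v a -> reached (v, a).
Proof.
move=> va0 h0 hS a; rewrite -(plane_cwP plT _ va0) => /iter_findex <-.
elim: (findex _ _ _) => //= n; apply: hS.
by rewrite -(plane_cwP plT _ va0) fconnect_iter.
Qed.

(** Induction from the leaves: an excursion into a child ends with the dart from the child back to
    [v], after which the turn around [v] goes on. *)
Lemma contour_child v : v != root -> reached (par v, v) ->
  forall a, aT v a -> reached (v, a).
Proof.
have [k] := ubnP (\max_(w : V) r w - r v); elim: k v => // k IH v le_k vr h0.
have vp := par_adj vr.
have t1 : tree_dart (par v, v) by rewrite /tree_dart /parent_dart /= vr eqxx orbT.
have h1 : reached (v, cT v (par v)) by have := contour_step h0; rewrite /contour t1.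
apply: (contour_rotate (plane_cw_adj plT vp) h1) => a va ha.
have [e|nap] := eqVneq a (par v); first by rewrite e.
have [ta|nta] := boolP (tree_dart (v, a)); last first.
  by have := contour_step ha; rewrite /contour (negPf nta).
move: (ta); rewrite /tree_dart /parent_dart /= vr (negPf nap) /= => /andP[ar /eqP ev].
have hb : reached (a, v).
  apply: IH => //; rewrite -?ev //; last by rewrite aC.
  have := par_rank ar; rewrite -ev; have := leq_bigmax (F := r) a.
  by move: le_k; clear; lia.
by have := contour_step hb; rewrite /contour -[(a, v)]/(rev_dart (v, a)) tree_dart_rev ta.
Qed.

Lemma contour_cover d : d \in darts T -> reached d.
Proof.
have all_root a : aT root a -> reached (root, a).
  have s0 : aT root start.2 by move: start_dart; rewrite inE start_root.
  apply: (contour_rotate s0); first by rewrite -start_root -surjective_pairing connect0.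
  move=> b rb hb; have [tb|ntb] := boolP (tree_dart (root, b)); last first.
    by have := contour_step hb; rewrite /contour (negPf ntb).
  move: (tb); rewrite /tree_dart /parent_dart /= eqxx /= => /andP[br /eqP er].
  have hc : reached (b, root).
    by apply: (contour_child br); rewrite -?er // aC.
  by have := contour_step hc; rewrite /contour -[(b, root)]/(rev_dart (root, b)) tree_dart_rev tb.
case: d => v a; rewrite inE /=; have [k] := ubnP (r v); elim: k v a => // k IH v a le_k va.
have [e|vr] := eqVneq v root; first by rewrite e; apply: all_root; rewrite -e.
apply: (contour_child vr) => //; apply: IH.
  by have := par_rank vr; move: le_k; clear; lia.
by rewrite aC par_adj.
Qed.

Definition contour_at (k : nat) := iter k contour start.
Definition contour_time (d : V * V) := findex contour start d.

(** Since it reaches every dart, the walk has full period: each dart has its time, and sums over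
    darts become sums over times. *)
Lemma contour_order : order contour start = #|darts T|.
Proof.
rewrite /order; apply: eq_card => d; rewrite -[LHS]topredE /=.
apply/idP/idP=> [|/contour_cover //].
move=> /iter_findex <-; elim: (findex _ _ _) => //= n; exact: contour_darts.
Qed.

Lemma contour_at_darts k : contour_at k \in darts T.
Proof. by elim: k => //= k; apply: contour_darts. Qed.

Lemma contour_timeK d : d \in darts T -> contour_at (contour_time d) = d.
Proof. by move=> /contour_cover/iter_findex. Qed.

Lemma contour_time_lt d : d \in darts T -> contour_time d < #|darts T|.
Proof. by move=> /contour_cover/findex_max; rewrite contour_order. Qed.

Lemma contour_atK k : k < #|darts T| -> contour_time (contour_at k) = k.
Proof. by rewrite -contour_order => /findex_iter. Qed.

Lemma sum_contour (A : nmodType) (F : V * V -> A) :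
  (\sum_(d in darts T) F d = \sum_(0 <= k < #|darts T|) F (contour_at k))%R.
Proof.
rewrite (eq_bigl (fun d => d \in orbit contour start)); last first.
  move=> d; rewrite -fconnect_orbit; apply/idP/idP=> [/contour_cover //|].
  by move=> /iter_findex <-; apply: contour_at_darts.
rewrite -big_uniq ?orbit_uniq //= (big_nth start) size_orbit contour_order.
apply: eq_big_nat => k /andP[_ lt]; rewrite /orbit nth_traject //.
by rewrite contour_order.
Qed.

End Contour.

(** * Differences of abscissas along the contour *)

Section Increment.

Variables (V : finType) (T : framed_map V) (X : bicolor_orientation V).
Hypotheses (HT : irreducible_triangulation T) (HX : transversal_pair T X).

Local Notation N := (vN T).
Local Notation E := (vE T).
Local Notation S := (vS T).
Local Notation W := (vW T).
Local Notation cT := (cw (fmap T)).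
Local Notation aT := (adj (fmap T)).
Local Notation o := (red_arc T X).
Local Notation aM := (adj (orient_map T (red_arc T X))).
Local Notation rk := (red_rank T X).

Let plT := triangulation_plane HT.
Let aC := plane_adjC plT.

Variables (so si : V -> seq V).
Hypothesis rot : forall v, red_rotation T X v (so v) (si v).

Local Notation lo := (lo so).
Local Notation ri := (ri si).
Local Notation sinks := (sink_darts T X si).
Local Notation pp := (path_potential T X so si).
Local Notation down_tree := (tree_dart ri S).

Lemma ri_adj v : v != S -> aT v (ri v).
Proof. by move=> vS; rewrite aC (red_arc_adj HT HX (ri_arc rot vS)). Qed.
Lemma ri_rank v : v != S -> rk (ri v) < rk v.
Proof. by move=> vS; apply: (red_rank_lt HT HX (ri_arc rot vS)). Qed.
Lemma lo_adj v : v != N -> aT v (lo v).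
Proof. by move=> vN; rewrite (red_arc_adj HT HX (lo_arc rot vN)). Qed.
Lemma lo_rank v : v != N -> #|V| + 2 - rk (lo v) < #|V| + 2 - rk v.
Proof.
move=> vN; have := red_rank_lt HT HX (lo_arc rot vN).
by have := red_rank_le T X (lo v); lia.
Qed.

Lemma start_SW : (S, W) \in darts T. Proof. by have [[_ _ h _] _] := adj_outer HT; rewrite inE. Qed.
Lemma start_NE : (N, E) \in darts T. Proof. by have [[h _ _ _] _] := adj_outer HT; rewrite inE. Qed.

Definition down_at := contour_at T ri S (S, W).
Definition down_time := contour_time T ri S (S, W).
Definition up_at := contour_at T lo N (N, E).

Definition down_timeK := contour_timeK HT ri_adj ri_rank start_SW erefl.
Definition down_time_lt := contour_time_lt HT ri_adj ri_rank start_SW erefl.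
Definition down_atK := contour_atK HT ri_adj ri_rank start_SW erefl.
Definition down_at_darts := contour_at_darts HT ri S start_SW.
Definition up_timeK := contour_timeK HT lo_adj lo_rank start_NE erefl.
Definition up_time_lt := contour_time_lt HT lo_adj lo_rank start_NE erefl.
Definition up_at_darts := contour_at_darts HT lo N start_NE.

Definition sinks_before (k : nat) : nat := \sum_(0 <= j < k) (down_at j \in sinks).

Lemma sinks_beforeS k : sinks_before k.+1 = sinks_before k + (down_at k \in sinks).
Proof. by rewrite /sinks_before big_nat_recr. Qed.

Lemma sinks_before_le k : sinks_before k <= k.
Proof.
elim: k => [|k IH]; first by rewrite /sinks_before big_geq.
by rewrite sinks_beforeS -addn1 leq_add //; case: (down_at k \in sinks).
Qed.

Lemma tree_in_arc a b : o b a -> down_tree (a, b) = (b == ri a).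
Proof.
move=> oba; rewrite /tree_dart /parent_dart /= (arc_neqS HT HX oba) /=.
case: (b =P ri a) => //= _; apply/negP=> /andP[bS /eqP e].
by have := red_arc_asym HT HX oba; rewrite e (ri_arc rot bS).
Qed.

Lemma tree_out_arc a b : o a b -> down_tree (a, b) = (a == ri b).
Proof. by move=> oab; rewrite -tree_in_arc // -tree_dart_rev. Qed.

Lemma sink_dart_nontree d : (d \in sinks) = o d.2 d.1 && ~~ down_tree d.
Proof.
case: d => a b; rewrite inE /=; case: (boolP (o b a)) => //= oba.
by rewrite tree_in_arc.
Qed.

Section LoArc.

Variable v : V.
Hypothesis vN : v != N.
Let s := lo v.
Let ovs : o v s. Proof. exact: (lo_arc rot vN). Qed.

Variables (gv gs : V -> V -> rat).
Hypotheses (pv : pp v gv) (ps : pp s gs).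
(** Above [s] the paths of [v] and of [s] coincide, so that they differ only by the arc from [v] to
    [s] and by arcs of the tree of [ri]. The contour walk of this tree never crosses tree arcs, and
    hence sees [kap] change only when it passes over the arc from [v] to [s], from either end. *)
Let kap a b := (gs a b - gv a b)%R.

Lemma kap_face a b : aT a b -> kap b (cT b a) = kap a b.
Proof. by move=> ab; rewrite /kap (fp_face (pp_face pv) ab) (fp_face (pp_face ps) ab). Qed.

Lemma kap_blue a b : aT a b -> ~~ aM a b -> kap a b = kap b a.
Proof.
by move=> ab nab; rewrite /kap (fp_blue (pp_face pv) ab) // (fp_blue (pp_face ps) ab).
Qed.

Lemma kap_arc a b : o a b -> ~~ down_tree (a, b) ->
  (kap a b - kap b a = - ((a, b) == (v, s))%:R)%R.
Proof.
move=> oab nt; have j1 := pp_jump pv oab; have j2 := pp_jump ps oab.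
have eL : (kap a b = Lf T gs a b - Lf T gv a b)%R.
  rewrite /kap /Lf; case: ifP => // /leftside_outer out.
  have /= -> := fp_outer (pp_face pv) out; have /= -> := fp_outer (pp_face ps) out.
  by rewrite !subrr.
have -> : (kap a b - kap b a = (Lf T gs a b - gs b a) - (Lf T gv a b - gv b a))%R.
  by rewrite eL /kap; ring.
rewrite j1 j2 /inP /inD (tree_out_arc oab) in nt *; rewrite (negPf nt) !andbF !orbF.
rewrite /inU (fconnect_eqVf lo v) -/s xpair_eqE (eq_sym v a).
have [e|nva] := eqVneq a v; last by rewrite subrr oppr0.
rewrite e vN -/s /=; have -> : fconnect lo s v = false.
  apply/negP=> /(fconnect_lo_rank HT HX rot); rewrite leqNgt.
  by rewrite (red_rank_lt HT HX ovs).
by rewrite /= sub0r.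
Qed.

Lemma kap_at k :
  (kap (down_at k).1 (down_at k).2 =
   if v == ri s then 0 else
   (\sum_(0 <= j < k) (down_at j == (v, s)))%:R - (\sum_(0 <= j < k) (down_at j == (s, v)))%:R)%R.
Proof.
have vs : v != s by apply: contraTneq (red_rank_lt HT HX ovs) => <-; rewrite ltnn.
elim: k => [|k IH].
  rewrite /kap !big_geq // subrr if_same.
  have [_ _ oS _] := outer_dart_mem T.
  have /= -> := fp_outer (pp_face pv) oS; have /= -> := fp_outer (pp_face ps) oS.
  by rewrite subrr.
have -> : down_at k.+1 = contour T ri S (down_at k) by [].
rewrite !big_nat_recr //.
have := contour_at_darts HT ri S start_SW k; rewrite -/down_at.
case ed : (down_at k) IH => [a b]; rewrite inE /= => IH ab; have ba : aT b a by rewrite aC.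
rewrite /contour; case: ifP => tab /=.
  rewrite kap_face // IH; case: (v =P ri s) => // nvr.
  have -> : ((a, b) == (v, s)) = false.
    apply/negP=> /eqP[ea eb]; move: tab; rewrite ea eb tree_out_arc //.
    by move/eqP.
  have -> : ((a, b) == (s, v)) = false; last by rewrite !addn0.
  apply/negP=> /eqP[ea eb]; move: tab; rewrite ea eb tree_in_arc //.
  by move/eqP.
rewrite kap_face //.
have [ab_red|nred] := boolP (aM a b); last first.
  rewrite -(kap_blue ab nred) IH.
  have -> : ((a, b) == (v, s)) = false.
    by apply: contraNF nred => /eqP[-> ->]; rewrite red_mapE ovs.
  have -> : ((a, b) == (s, v)) = false; last by rewrite !addn0.
  by apply: contraNF nred => /eqP[-> ->]; rewrite red_mapE ovs orbT.
move: ab_red; rewrite red_mapE => /orP[oab|oba].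
  have j := kap_arc oab (negbT tab).
  have -> : kap b a = (kap a b + ((a, b) == (v, s))%:R)%R.
    by rewrite -[X in (_ + X)%R]opprK -j; ring.
  rewrite IH; have -> : ((a, b) == (s, v)) = false.
    apply/negP=> /eqP[ea eb]; have := red_arc_asym HT HX ovs.
    by rewrite -ea -eb oab.
  rewrite addn0 natrD; case: (v =P ri s) => [e|_]; last by ring.
  have -> : ((a, b) == (v, s)) = false; last by rewrite addr0.
  apply/negP=> /eqP[ea eb]; move: tab; rewrite ea eb tree_out_arc //.
  by rewrite -e eqxx.
have ntba : ~~ down_tree (b, a) by rewrite -[(b, a)]/(rev_dart (a, b)) tree_dart_rev tab.
have j := kap_arc oba ntba.
have -> : kap b a = (kap a b - ((b, a) == (v, s))%:R)%R.
  by rewrite -j; ring.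
rewrite IH; have -> : ((a, b) == (v, s)) = false.
  apply/negP=> /eqP[ea eb]; have := red_arc_asym HT HX ovs.
  by rewrite -ea -eb oba.
have -> : ((b, a) == (v, s)) = ((a, b) == (s, v)) by rewrite !xpair_eqE andbC.
rewrite addn0 natrD; case: (v =P ri s) => [e|_]; last by ring.
have -> : ((a, b) == (s, v)) = false; last by rewrite subr0.
apply/negP=> /eqP[ea eb]; move: tab; rewrite ea eb tree_in_arc //.
by rewrite -e eqxx.
Qed.

Lemma abscissa_kap :
  ((abscissa T X s)%:R - (abscissa T X v)%:R =
   \sum_(0 <= k < #|darts T|) (if down_at k \in sinks then kap (down_at k).1 (down_at k).2 else 0) :> rat)%R.
Proof.
rewrite (abscissa_sum HT HX rot ps) (abscissa_sum HT HX rot pv) -sumrB.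
rewrite -(sum_contour HT ri_adj ri_rank start_SW erefl (fun d => if d \in sinks then kap d.1 d.2 else 0)%R).
rewrite [RHS](bigID (fun d => d \in sinks)) /= [X in (_ + X)%R]big1 ?addr0; last first.
  by move=> d /andP[_ /negPf ->].
apply: eq_big => [d|d ->] //.
have [dS|_] := boolP (d \in sinks); rewrite ?andbF ?andbT //; apply/esym.
by move: (sink_dart_darts dS); rewrite !inE; apply: (red_map_adj HT HX).
Qed.

End LoArc.

Lemma sum_eq_time d k : d \in darts T -> k <= #|darts T| ->
  \sum_(0 <= j < k) (down_at j == d) = (down_time d < k).
Proof.
move=> dT; elim: k => [|k IH] le; first by rewrite big_geq.
rewrite big_nat_recr //= IH ?(ltnW le) //.
have -> : (down_at k == d) = (down_time d == k).
  apply/eqP/eqP=> [<-|<-]; first by rewrite [LHS]down_atK.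
  exact: down_timeK.
by rewrite [in RHS]ltnS [in RHS]leq_eqVlt; case: (ltngtP (down_time d) k).
Qed.

Lemma increment_tree v : v != N -> v = ri (lo v) ->
  abscissa T X (lo v) = abscissa T X v.
Proof.
move=> vN e; have [gv pv] := path_potential_ex HT HX rot v.
have [gs ps] := path_potential_ex HT HX rot (lo v).
have := abscissa_kap pv ps.
under eq_bigr do rewrite (kap_at vN pv ps) -e eqxx if_same.
rewrite big1; last by [].
by move/eqP; rewrite subr_eq0 eqr_nat => /eqP ->.
Qed.

(** Along the walk [kap] is 1 from just after the time of [(v, s)] up to the time of [(s, v)], and 0
    otherwise: the difference of abscissas counts the sinks met meanwhile. The order of the two
    times follows from the value 1 at [(s, v)], whose face is on the right of the path of [v] and on
    the left of that of [s]. *)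
Lemma increment_nontree v : v != N -> v != ri (lo v) ->
  [/\ down_time (v, lo v) < down_time (lo v, v),
      abscissa T X v <= abscissa T X (lo v)
    & abscissa T X (lo v) - abscissa T X v =
      sinks_before (down_time (lo v, v)).+1 - sinks_before (down_time (v, lo v))].
Proof.
move=> vN ne; set s := lo v in ne *.
have [gv pv] := path_potential_ex HT HX rot v.
have [gs ps] := path_potential_ex HT HX rot s.
have ovs : o v s by apply: (lo_arc rot vN).
have vsT : (v, s) \in darts T by rewrite inE (red_arc_adj HT HX).
have svT : (s, v) \in darts T by rewrite inE /= aC (red_arc_adj HT HX).
have svS : (s, v) \in sinks by rewrite inE /= ovs ne.
set t1 := down_time (v, s); set t2 := down_time (s, v).
have l1 : t1 < #|darts T| by apply: down_time_lt.
have l2 : t2 < #|darts T| by apply: down_time_lt.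
have kapE k : k <= #|darts T| -> (gs (down_at k).1 (down_at k).2 - gv (down_at k).1 (down_at k).2 =
    (t1 < k)%:R - (t2 < k)%:R)%R.
  move=> le; have := kap_at vN pv ps k; rewrite -/s (negPf ne) => ->.
  by rewrite !sum_eq_time.
have lt12 : t1 < t2.
  have := kapE t2 (ltnW l2); rewrite [down_at t2]down_timeK //= ltnn subr0.
  have gv0 : gv s v = 0%R.
    have := g01 HT HX rot pv ovs; rewrite /inP /inU connect0 vN eqxx /=.
    by case.
  have gs1 : gs s v = 1%R.
    have key := key_red HT HX rot pv ovs.
    have := Lf_compare HT HX rot pv ps key ovs.
    have := g01 HT HX rot pv ovs; rewrite /inP /inU connect0 vN eqxx /= => -[-> _].
    have := g01 HT HX rot ps ovs; have -> : inP T so si s v s = false.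
      apply/negP=> /orP[]/and3P[h1 h2 h3].
        have := fconnect_lo_rank HT HX rot h1; rewrite leqNgt.
        by rewrite (red_rank_lt HT HX ovs).
      by move: ne; rewrite (eqP h3) eqxx.
    by case=> -> [->|->] //; rewrite ler10.
  rewrite gv0 gs1 subr0 => e1; rewrite ltnNge; apply/negP=> le.
  by have := oner_neq0 rat; rewrite e1 ltnNge le eqxx.
have eq_sum : abscissa T X s = abscissa T X v +
    (sinks_before t2.+1 - sinks_before t1).
  apply/eqP; rewrite -(eqr_nat rat) natrD -subr_eq0 opprD addrA subr_eq0 addrC; apply/eqP.
  have -> : (- (abscissa T X v)%:R + (abscissa T X s)%:R =
      (abscissa T X s)%:R - (abscissa T X v)%:R :> rat)%R by rewrite addrC.
  rewrite (abscissa_kap pv ps).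
  rewrite (big_cat_nat (n := t1)) //=; last exact: ltnW.
  rewrite big_nat big1 ?add0r; last first.
    move=> k /andP[_ lt]; case: ifP => // _; rewrite kapE ?ltnNge; last exact: ltnW (ltn_trans lt l1).
    by rewrite (ltnW lt) (ltnW (ltn_trans lt lt12)) subrr.
  rewrite (big_cat_nat (n := t2.+1)) //=; last exact: leqW (ltnW lt12).
  rewrite [X in (_ + X)%R]big_nat [X in (_ + X)%R]big1 ?addr0; last first.
    move=> k /andP[lt lek]; case: ifP => // _; rewrite kapE ?(ltnW lek) //.
    by rewrite lt (ltn_trans lt12 lt) subrr.
  have -> : sinks_before t2.+1 - sinks_before t1 = \sum_(t1 <= k < t2.+1) (down_at k \in sinks).
    rewrite /sinks_before (big_cat_nat (n := t1) (p := t2.+1)) //=; last exact: leqW (ltnW lt12).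
    by rewrite addKn.
  rewrite natr_sum; apply: eq_big_nat => k /andP[le lt].
  case: (boolP (_ \in _)) => // ks; rewrite kapE; last by apply: leq_trans l2; apply: leqW.
  (* At the time [t1] itself [kap] is still 0; the count may include it, because [(v, s)] is no sink
     dart. *)
  have kt1 : t1 != k.
    apply: contraTneq ks => <-; rewrite [down_at t1]down_timeK // inE /= negb_and.
    by rewrite (red_arc_asym HT HX ovs).
  by rewrite ltn_neqAle kt1 le /= ltnNge -ltnS lt subr0.
split; [exact: lt12 | by rewrite eq_sum leq_addr | by rewrite eq_sum addKn].
Qed.

(** * Recognizing the tree arcs *)

(** The leftmost outgoing arc is recognized in [T] itself from two consecutive neighbours, without
    searching past blue edges: outgoing arcs are consecutive in [T], so that the first one is
    preceded by a neighbour that is not outgoing, except at [S]. *)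
Lemma lo_flag v a : aT v a ->
  (o v (cT v a) && (cT v a == lo v)) =
  o v (cT v a) && (~~ o v a || ((v == S) && (cT v a == W))).
Proof.
move=> va; case: (boolP (o v (cT v a))) => //= oc.
have [ova|nova] /= := boolP (o v a); last by rewrite -(lo_first HT HX rot va nova oc) eqxx.
have [->|vS] /= := eqVneq v S; first by rewrite (so_S rot).1.
apply/negP=> /eqP e; have := rr_so_path (rot v); have := rr_so (rot v).
have := so_uniq rot v; move: e; rewrite /lo.
case: (so v) => [|x p] /= e un mem; first by have := mem a; rewrite ova.
move=> /(_ x p erefl) pth.
have ax : a \in x :: p by rewrite mem.
(* If the first outgoing arc were preceded by an outgoing one, the outgoing arcs would fill the
   whole rotation; but [ri v] is ingoing. *)
have cyc : fcycle (cT v) (x :: p).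
  rewrite /= rcons_path pth /=; have [/eqP ea|na] := eqVneq a (last x p).
    by rewrite -(eqP ea) e.
  exfalso; have [i lt ei] : exists2 i, i < size p & a = nth v (x :: p) i.
    have := ax; rewrite -index_mem -[size (x :: p)]/(size p).+1 ltnS leq_eqVlt => /orP[/eqP ie|lt].
      by case/eqP: na; rewrite -{1}[a](nth_index v ax) ie (last_nth v).
    by exists (index a (x :: p)) => //; rewrite nth_index.
  have /eqP := (pathP v pth) i lt; rewrite -ei e => xi.
  by move: un; rewrite /= => /andP[/negP[]]; rewrite [x in x \in _]xi mem_nth.
have rv := ri_arc rot vS.
have : ri v \in x :: p.
  have : fconnect (cT v) a (ri v) by rewrite (plane_cwP plT) // aC (red_arc_adj HT HX).
  by rewrite (fconnect_cycle cyc).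
by rewrite mem => /(red_arc_asym HT HX); rewrite rv.
Qed.

Lemma ri_first v a : aT v a -> ~~ o a v -> o (cT v a) v -> ri v = cT v a.
Proof.
move=> va noa; rewrite -(rr_si (rot v)) /ri.
have := rr_si_path (rot v); have := rr_si (rot v).
case: (si v) => // x p mem /(_ x p erefl) pth; rewrite inE => /predU1P[-> //|cp].
have [z zx e] : exists2 z, z \in x :: p & cT v z = cT v a.
  elim: p x pth cp {mem} => //= y p IH x /andP[/eqP xy yp].
  rewrite inE => /predU1P[->|cp]; first by exists x; rewrite ?mem_head.
  by have [z zy e] := IH _ yp cp; exists z => //; rewrite inE zy orbT.
rewrite mem in zx; move: noa.
have vz : aT v z by rewrite aC (red_arc_adj HT HX).
by rewrite -(plane_cw_inj plT vz va e) zx.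
Qed.

Lemma ri_flag v a : aT v a ->
  (o (cT v a) v && (cT v a == ri v)) =
  o (cT v a) v && (~~ o a v || ((v == N) && (cT v a == E))).
Proof.
move=> va; case: (boolP (o (cT v a) v)) => //= oc.
have [ova|nova] /= := boolP (o a v); last by rewrite -(ri_first va nova oc) eqxx.
have [->|vN] /= := eqVneq v N; first by rewrite (si_N rot).1.
apply/negP=> /eqP e; have := rr_si_path (rot v); have := rr_si (rot v).
have := si_uniq rot v; move: e; rewrite /ri.
case: (si v) => [|x p] /= e un mem; first by have := mem a; rewrite ova.
move=> /(_ x p erefl) pth.
have ax : a \in x :: p by rewrite mem.
have cyc : fcycle (cT v) (x :: p).
  rewrite /= rcons_path pth /=; have [/eqP ea|na] := eqVneq a (last x p).
    by rewrite -(eqP ea) e.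
  exfalso; have [i lt ei] : exists2 i, i < size p & a = nth v (x :: p) i.
    have := ax; rewrite -index_mem -[size (x :: p)]/(size p).+1 ltnS leq_eqVlt => /orP[/eqP ie|lt].
      by case/eqP: na; rewrite -{1}[a](nth_index v ax) ie (last_nth v).
    by exists (index a (x :: p)) => //; rewrite nth_index.
  have /eqP := (pathP v pth) i lt; rewrite -ei e => xi.
  by move: un; rewrite /= => /andP[/negP[]]; rewrite [x in x \in _]xi mem_nth.
have rv := lo_arc rot vN.
have : lo v \in x :: p.
  have : fconnect (cT v) a (lo v) by rewrite (plane_cwP plT) // (red_arc_adj HT HX).
  by rewrite (fconnect_cycle cyc).
by rewrite mem => /(red_arc_asym HT HX); rewrite rv.
Qed.

End Increment.

(** * Straight-line programs *)


(* [ISetEq r x y] sets [r] to the truth value of [x = y]; [ISel r b x y] copies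
   [x] or [y] to [r], according to whether [b] is positive.  Both expect 0 in
   register 16. *)
Inductive instr :=
| ICst of nat & nat
| IAdd of nat & nat & nat
| ISub of nat & nat & nat
| IRead of nat & nat & nat
| IWrite of nat & nat & nat
| ISetEq of nat & nat & nat
| ISel of nat & nat & nat & nat.

Definition compile1 (i : instr) : cmd :=
  match i with
  | ICst x c => Const x c
  | IAdd x y z => Add x y z
  | ISub x y z => Defs.Sub x y z
  | IRead x A y => Read x A y
  | IWrite A x y => Write A x y
  | ISetEq r x y =>
      IfLt x y (Const r 0) (IfLt y x (Const r 0) (Const r 1))
  | ISel r b x y => IfLt 16 b (Add r x 16) (Add r y 16)
  end.

Definition step (i : instr) (s : state) : state :=
  match i with
  | ICst x c => set_reg s x c
  | IAdd x y z => set_reg s x (reg s y + reg s z)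
  | ISub x y z => set_reg s x (reg s y - reg s z)
  | IRead x A y => set_reg s x (arr s A (reg s y))
  | IWrite A x y => set_arr s A (reg s x) (reg s y)
  | ISetEq r x y => set_reg s r (reg s x == reg s y)
  | ISel r b x y => set_reg s r (if 0 < reg s b then reg s x else reg s y)
  end.

Definition fits (B : nat) (i : instr) (s : state) : Prop :=
  match i with
  | ICst x c => c <= B
  | IAdd x y z => reg s y + reg s z <= B
  | ISub x y z => reg s y - reg s z <= B
  | IRead x A y => arr s A (reg s y) <= B
  | IWrite A x y => reg s y <= B
  | ISetEq r x y => 0 < B
  | ISel r b x y => [/\ reg s 16 = 0, reg s x <= B & reg s y <= B]
  end.

Fixpoint compile (l : seq instr) : cmd :=
  if l is i :: l' then Seq (compile1 i) (compile l') else Skip.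

(** Weakest precondition with overflow checks. It computes, so that a loop body is verified by
    symbolic execution. *)
Fixpoint wp (B : nat) (l : seq instr) (Q : state -> Prop) (s : state) : Prop :=
  if l is i :: l' then fits B i s /\ wp B l' Q (step i s) else Q s.

Definition runs (B : nat) (c : cmd) (s : state) (t : nat) (Q : state -> Prop) :=
  exists t' s', [/\ exec B c s t' s', t' <= t & Q s'].

Lemma compile1_exec B i s : fits B i s ->
  exists2 t, t <= 3 & exec B (compile1 i) s t (step i s).
Proof.
case: i => [x c|x y z|x y z|x A y|A x y|r x y|r b x y] /=.
- by exists 1 => //; constructor.
- by exists 1 => //; constructor.
- by exists 1 => //; constructor.
- by exists 1 => //; constructor.
- by exists 1 => //; constructor.
- move=> B0; case: (ltngtP (reg s x) (reg s y)) => [lt|gt|e].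
  + by exists 2 => //; apply: exec_if_true => //; constructor.
  + exists 3 => //; apply: exec_if_false; first exact: ltnW.
    by apply: exec_if_true => //; constructor.
  + exists 3 => //; apply: exec_if_false; first by rewrite e.
    by apply: exec_if_false; rewrite ?e //; constructor.
- case=> z0 xB yB; exists 2 => //; case: (posnP (reg s b)) => b0.
  + apply: exec_if_false; first by rewrite b0.
    by have := @exec_add B s r y 16; rewrite z0 addn0; apply.
  + apply: exec_if_true; first by rewrite z0.
    by have := @exec_add B s r x 16; rewrite z0 addn0; apply.
Qed.

Lemma compile_runs B l Q s : wp B l Q s -> runs B (compile l) s (3 * size l + 1) Q.
Proof.
elim: l s => [|i l IH] s /=; first by move=> q; exists 1, s; split=> //; constructor.
case=> fi /IH[t [s' [ex le q]]]; have [t1 le1 ex1] := compile1_exec fi.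
by exists (t1 + t), s'; split=> //; [apply: exec_seq ex1 ex | lia].
Qed.

Lemma runs_seq B c1 c2 s t1 t2 (P Q : state -> Prop) : runs B c1 s t1 P ->
  (forall s', P s' -> runs B c2 s' t2 Q) -> runs B (Seq c1 c2) s (t1 + t2) Q.
Proof.
move=> [t [s1 [e1 l1 p]]] /(_ _ p)[t' [s2 [e2 l2 q]]].
by exists (t + t'), s2; split=> //; [apply: exec_seq e1 e2 | apply: leq_add].
Qed.

(** An instruction costs at most 3 steps; the 2 accounts for the loop test and for the [Skip] that
    closes the body. *)
Lemma runs_while B x y l n (I : nat -> state -> Prop) s :
    (forall k s, k < n -> I k s -> reg s x < reg s y /\ wp B l (I k.+1) s) ->
    (forall s, I n s -> reg s y <= reg s x) -> I 0 s ->
  runs B (WhileLt x y (compile l)) s ((3 * size l + 2) * n + 1) (I n).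
Proof.
move=> body stop I0; suff loop j k s1 : k + j = n -> I k s1 ->
    runs B (WhileLt x y (compile l)) s1 ((3 * size l + 2) * j + 1) (I n) by exact: (loop n 0).
elim: j k s1 => [|j IH] k s1.
  rewrite addn0 => -> i; exists 1, s1; split=> //; first by apply: exec_while_false; apply: stop.
  by rewrite muln0.
move=> e i; have lt : k < n by lia.
have [r1 w] := body _ _ lt i.
have [t1 [s2 [e1 l1 i1]]] := compile_runs w.
have [|t2 [s3 [e2 l2 i2]]] := IH k.+1 s2 _ i1; first by rewrite addSnnS.
exists (t1 + t2).+1, s3; split=> //; first exact: exec_while_true r1 e1 e2.
by move: l1 l2; rewrite mulnS; lia.
Qed.

(** * The drawing program *)

(* Registers: 0 and 1 hold the sizes; 10 to 15 hold N, E, S, W and the labels of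
   the outgoing and ingoing red darts; 6 is the loop counter; 26 and 27 hold the
   darts (S, W) and (N, E); 28 the current dart of a walk, 29 the number of sinks
   met and 30 the current abscissa.  Arrays: 7 holds 1 at the outgoing arcs of
   the red map and 2 at the ingoing ones; 8 and 9 flag the leftmost outgoing and
   rightmost ingoing arcs; 10 and 11 hold the counters and the increments. *)
Definition kind_body : seq instr :=
  [:: IRead 7 3 6; ISetEq 8 7 14; ISetEq 9 7 15; ISetEq 19 7 16;
      IRead 20 0 6; IRead 21 1 6; IRead 21 0 21;
      ISetEq 22 20 12; ISetEq 23 21 10; IAdd 22 22 23;
      ISel 24 22 17 18; ISel 24 19 24 16; ISel 24 9 18 24; ISel 24 8 17 24;
      IWrite 7 6 24; IWrite 10 6 16; IWrite 11 6 16; IAdd 6 6 17].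

Definition flag_body : seq instr :=
  [:: IRead 7 2 6; IRead 8 7 7; IRead 9 7 6; IRead 20 0 7; IRead 21 1 7; IRead 21 0 21;
      ISetEq 22 8 17; ISetEq 23 9 17; ISetEq 24 20 12; ISetEq 25 21 13;
      ISel 24 24 25 16; ISel 23 23 24 17; ISel 22 22 23 16; IWrite 8 7 22; ISel 26 24 7 26;
      ISetEq 22 8 18; ISetEq 23 9 18; ISetEq 24 20 10; ISetEq 25 21 11;
      ISel 24 24 25 16; ISel 23 23 24 17; ISel 22 22 23 16; IWrite 9 7 22; ISel 27 24 7 27;
      IAdd 6 6 17].

Definition down_body : seq instr :=
  [:: IRead 7 1 28; IRead 8 9 28; IRead 9 9 7; IAdd 8 8 9; IRead 20 7 28;
      ISetEq 21 20 17; ISetEq 22 20 18; ISel 21 8 16 21; ISel 22 8 16 22;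
      IRead 23 10 28; ISel 23 21 29 23; IWrite 10 28 23; IAdd 29 29 22;
      IRead 23 10 7; ISub 23 29 23; IRead 24 11 7; ISel 23 22 23 24; IWrite 11 7 23;
      IRead 24 2 7; IRead 25 2 28; ISel 28 8 24 25; IAdd 6 6 17].

Definition up_body (A : nat) : seq instr :=
  [:: IRead 7 1 28; IRead 8 8 7; IRead 9 8 28; IRead 20 11 7; IRead 21 11 28;
      ISub 22 30 20; IAdd 23 30 21; ISel 30 9 23 30; ISel 30 8 22 30; IAdd 8 8 9;
      IRead 24 2 7; IRead 25 2 28; IRead 20 0 7; IRead 21 0 28; ISel 20 8 20 21;
      ISel 28 8 24 25; IWrite A 20 30; IAdd 6 6 17].

Definition core (A : nat) : cmd :=
  Seq (compile [:: ICst 6 0]) (Seq (WhileLt 6 1 (compile kind_body))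
  (Seq (compile [:: ICst 6 0; ICst 26 0; ICst 27 0]) (Seq (WhileLt 6 1 (compile flag_body))
  (Seq (compile [:: ICst 6 0; IAdd 28 26 16; ICst 29 0]) (Seq (WhileLt 6 1 (compile down_body))
  (Seq (compile [:: ICst 6 0; IAdd 28 27 16; IAdd 30 29 16; IWrite A 10 30])
       (WhileLt 6 1 (compile (up_body A))))))))).

Definition constants : seq instr := [:: ICst 16 0; ICst 17 1; ICst 18 2].

Definition draw_program : cmd :=
  Seq (compile (constants ++ [:: IAdd 10 2 16; IAdd 11 3 16; IAdd 12 4 16; IAdd 13 5 16;
                                ICst 14 1; ICst 15 3]))
  (Seq (core 4)
  (Seq (compile [:: IAdd 10 5 16; IAdd 11 2 16; IAdd 12 3 16; IAdd 13 4 16;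
                    ICst 14 4; ICst 15 2])
       (core 5))).

(** * Correctness of one pass, for any labels of the red arcs *)

Section Core.

Variables (V : finType) (T : framed_map V) (X : bicolor_orientation V).
Hypotheses (HT : irreducible_triangulation T) (HX : transversal_pair T X).

Local Notation N := (vN T).
Local Notation E := (vE T).
Local Notation S := (vS T).
Local Notation W := (vW T).
Local Notation cT := (cw (fmap T)).
Local Notation o := (red_arc T X).
Local Notation D := (darts T).
Local Notation m := #|darts T|.

Let plT := triangulation_plane HT.
Let wfT := plane_well_rotated plT.
Let aC := plane_adjC plT.
Let neqs := outer_neqs HT.

Variables (nv : V -> nat) (nd : V * V -> nat) (lab : V * V -> nat) (lOut lIn : nat).
Hypothesis nv_inj : injective nv.
Hypothesis nd_inj : {in D &, injective nd}.
Hypothesis nd_lt : {in D, forall d, nd d < m}.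
Hypothesis lab_out : {in D, forall d, (lab d == lOut) = red X d.1 d.2}.
Hypothesis lab_in : {in D, forall d, (lab d == lIn) = red X d.2 d.1}.
Hypothesis lab_0 : {in D, forall d, (lab d == 0) = outer_edge T d.1 d.2}.
Variable B : nat.
Hypothesis lab_le : {in D, forall d, lab d <= B}.
Hypothesis nv_le : forall v, nv v <= B.
Hypothesis m_le : m + m <= B.
Hypothesis B_gt1 : 1 < B.

Lemma nd_onto i : i < m -> exists2 d, d \in D & nd d = i.
Proof.
move=> lt; have m0 : 0 < m by apply: leq_ltn_trans lt.
pose f (j : 'I_m) : 'I_m := Ordinal (nd_lt (enum_valP j)).
have injf : injective f.
  move=> a b [] /(nd_inj (enum_valP a) (enum_valP b)); exact: enum_val_inj.
have [g fK gK] := injF_bij injf.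
exists (enum_val (g (Ordinal lt))); first exact: enum_valP.
by have := congr1 val (gK (Ordinal lt)).
Qed.

Record core_input (s : state) : Prop := CoreInput {
  ci_m : reg s 1 = m;
  ci_N : reg s 10 = nv N; ci_E : reg s 11 = nv E;
  ci_S : reg s 12 = nv S; ci_W : reg s 13 = nv W;
  ci_out : reg s 14 = lOut; ci_in : reg s 15 = lIn;
  ci_0 : reg s 16 = 0; ci_1 : reg s 17 = 1; ci_2 : reg s 18 = 2;
  ci_org : {in D, forall d, arr s 0 (nd d) = nv d.1};
  ci_opp : {in D, forall d, arr s 1 (nd d) = nd (rev_dart d)};
  ci_cw : {in D, forall d, arr s 2 (nd d) = nd (d.1, cT d.1 d.2)};
  ci_lab : {in D, forall d, arr s 3 (nd d) = lab d} }.

Definition next_cw (d : V * V) := (d.1, cT d.1 d.2).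

Lemma next_cw_darts d : d \in D -> next_cw d \in D.
Proof. by rewrite !inE; apply: plane_cw_adj. Qed.

Lemma next_cw_inj d d' : d \in D -> d' \in D -> next_cw d = next_cw d' -> d = d'.
Proof.
case: d d' => a b [a' b']; rewrite !inE /= => ab ab' [e]; subst a'.
by move/(plane_cw_inj plT ab ab') => ->.
Qed.

Lemma next_cw_onto d : d \in D -> exists2 d', d' \in D & next_cw d' = d.
Proof.
move=> dD; have : d \in [set next_cw d' | d' in D].
  have -> // : [set next_cw d' | d' in D] = D.
  apply/eqP; rewrite eqEcard; apply/andP; split.
    by apply/subsetP=> _ /imsetP[d' d'D ->]; apply: next_cw_darts.
  by rewrite card_in_imset // => a b; apply: next_cw_inj.
by case/imsetP=> d' d'D ->; exists d'.
Qed.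

Lemma rev_darts d : d \in D -> rev_dart d \in D.
Proof. by rewrite (darts_rev wfT). Qed.

Lemma nd_eq d d' : d \in D -> d' \in D -> (nd d == nd d') = (d == d').
Proof. by move=> dD d'D; apply/eqP/eqP=> [/nd_inj->|->]. Qed.

Definition kind (d : V * V) : nat := if o d.1 d.2 then 1 else if o d.2 d.1 then 2 else 0.

Lemma kind_le d : kind d <= 2.
Proof. by rewrite /kind; case: ifP => // _; case: ifP. Qed.

Lemma kind1 d : (kind d == 1) = o d.1 d.2.
Proof. by rewrite /kind; case: ifP => // _; case: ifP. Qed.

Lemma kind2 d : (kind d == 2) = o d.2 d.1.
Proof.
rewrite /kind; case: ifP => [od|_]; last by case: ifP.
by rewrite (negPf (red_arc_asym HT HX od)).
Qed.

(** Outer edges carry the label 0. Such a dart is an arc of the red map exactly when it starts at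
    [S] or ends at [N]. *)
Lemma kind_label d : d \in D ->
  (if lab d == lOut then 1 else if lab d == lIn then 2 else
   if lab d == 0 then if (nv d.1 == nv S) || (nv (rev_dart d).1 == nv N) then 1 else 2 else 0) = kind d.
Proof.
move=> dD; rewrite lab_out // lab_in // lab_0 // !(inj_eq nv_inj).
case: d dD => u v; rewrite inE /= => uv; rewrite /kind /=.
have [oe|ne] := boolP (outer_edge T u v).
  have [r1 _ r3 _] := outer_colorless HT HX oe; rewrite r1 r3.
  rewrite /red_arc /= r1 r3 /=; move: (outer_edgeP oe); rewrite !inE !xpair_eqE.
  by do 7?[case/orP]; move=> /andP[/eqP -> /eqP ->]; rewrite !eqxx !neqs.
have i : inner_edge T u v by rewrite /inner_edge /= uv.
have := ne; rewrite /outer_edge /= /outer_darts !inE !xpair_eqE !negb_or.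
rewrite -!andbA => /and5P[/negPf n1 /negPf n2 /negPf n3 /negPf n4].
move=> /and4P[/negPf n5 /negPf n6 /negPf n7 /negPf n8].
have -> : o u v = red X u v.
  rewrite /red_arc /= !inE !xpair_eqE n3 n4 (andbC (u == S)) n6 (andbC (u == E)) n5.
  by rewrite !orbF.
have -> : o v u = red X v u.
  rewrite /red_arc /= !inE !xpair_eqE n7 n8 (andbC (v == S)) n2 (andbC (v == E)) n1.
  by rewrite !orbF.
by [].
Qed.

Let le_mB k : k <= m -> k <= B.
Proof. by move=> le; apply: leq_trans le _; apply: leq_trans (leq_addr _ _) m_le. Qed.
Let ndS_le d : d \in D -> (nd d).+1 <= B.
Proof. by move=> dD; apply: le_mB; apply: nd_lt. Qed.
Let nd_le d : d \in D -> nd d <= B.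
Proof. by move/ndS_le/ltnW. Qed.
Let bool_le (b : bool) : b <= B.
Proof. by case: b; rewrite // ltnW. Qed.
Let one_le : 1 <= B. Proof. exact: ltnW. Qed.
Let small_le k : k <= 2 -> k <= B. Proof. by move=> h; apply: leq_trans h B_gt1. Qed.

Ltac fits_one := do ?split; rewrite ?addn1 //; do ?[case: ifP => _];
  first [done | exact: bool_le | exact: nv_le | exact: nd_le | exact: lab_le
        | exact: (small_le (kind_le _)) | exact: small_le | by apply: le_mB
        | by apply: le_mB; apply: leq_trans (leq_subr _ _) _ ].
Ltac fits_all := repeat match goal with |- _ /\ _ => split; [by fits_one | ] end.

(** Arrays 10 and 11 are cleared at this stage, since the second pass finds in them what the first
    one left. *)
Definition kind_inv (k : nat) (s : state) : Prop :=
  [/\ core_input s, reg s 6 = k & {in D, forall d, nd d < k ->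
    [/\ arr s 7 (nd d) = kind d, arr s 10 (nd d) = 0 & arr s 11 (nd d) = 0]}].

Lemma kind_step k s : k < m -> kind_inv k s ->
  reg s 6 < reg s 1 /\ wp B kind_body (kind_inv k.+1) s.
Proof.
move=> lt [ci r6 inv]; case: (ci) => c1 c10 c11 c12 c13 c14 c15 c16 c17 c18 a0 a1 a2 a3.
rewrite r6 c1; split=> //; have [d dD ed] := nd_onto lt.
have rD := rev_darts dD; have kl := kind_label dD.
have sel_le (b : bool) x y : x <= B -> y <= B -> (if b then x else y) <= B by case: b.
rewrite /= r6 -ed !a0 ?a1 ?a3 //= !a0 // c16 c17 c18 c14 c15 c12 c10 !addn_gt0 !lt0b.
rewrite kl; have S1 := ndS_le dD.
have b2 (b c : bool) : b + c <= B by case: b; case: c; rewrite // ltnW.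
fits_all.
split; [by split | by rewrite /= addn1 | ].
move=> d' d'D; rewrite ltnS leq_eqVlt nd_eq //=; case: eqVneq => [->|n /= h]; rewrite ?eqxx //=.
by rewrite !nd_eq // (negPf n); apply: inv; rewrite -?ed.
Qed.

Variables (so si : V -> seq V).
Hypothesis rot : forall v, red_rotation T X v (so v) (si v).
Local Notation lo := (lo so).
Local Notation ri := (ri si).

Lemma parent_lo d : parent_dart lo N d = o d.1 d.2 && (d.2 == lo d.1).
Proof.
rewrite /parent_dart; case: (eqVneq d.2) => [->|]; rewrite ?andbF ?andbT //.
apply/idP/idP=> [n|/(arc_neqN HT HX)//]; exact: (lo_arc rot n).
Qed.

Lemma parent_ri d : parent_dart ri S d = o d.2 d.1 && (d.2 == ri d.1).
Proof.
rewrite /parent_dart; case: (eqVneq d.2) => [->|]; rewrite ?andbF ?andbT //.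
apply/idP/idP=> [n|/(arc_neqS HT HX)//]; exact: (ri_arc rot n).
Qed.

(** The flags of [next_cw d] are written while [d] is scanned, which covers all darts because
    [next_cw] permutes them. The darts [(S, W)] and [(N, E)] are found from [(S, E)] and [(N, W)],
    which precede them across the outer corner. *)
Definition flag_inv (k : nat) (s : state) : Prop :=
  [/\ core_input s, reg s 6 = k,
      {in D, forall d, [/\ arr s 7 (nd d) = kind d, arr s 10 (nd d) = 0 & arr s 11 (nd d) = 0]},
      {in D, forall d, nd d < k ->
         arr s 8 (nd (next_cw d)) = parent_dart lo N (next_cw d) /\
         arr s 9 (nd (next_cw d)) = parent_dart ri S (next_cw d)}
    & [/\ reg s 26 <= B, reg s 27 <= B, nd (S, E) < k -> reg s 26 = nd (S, W)
        & nd (N, W) < k -> reg s 27 = nd (N, E)]].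

Lemma flag_step k s : k < m -> flag_inv k s ->
  reg s 6 < reg s 1 /\ wp B flag_body (flag_inv k.+1) s.
Proof.
move=> lt [ci r6 a7 inv [b26 b27 i26 i27]].
case: (ci) => c1 c10 c11 c12 c13 c14 c15 c16 c17 c18 a0 a1 a2 a3.
rewrite r6 c1; split=> //; have [d dD ed] := nd_onto lt.
have nD := next_cw_darts dD; have rD := rev_darts nD.
have sel_le (b : bool) x y : x <= B -> y <= B -> (if b then x else y) <= B by case: b.
have [k1 _ _] := a7 _ nD; have [k2 _ _] := a7 _ dD.
rewrite /= r6 -ed a2 // -/(next_cw d) !k1 !k2 !a0 ?a1 //= !a0 // c16 c17 c18 c10 c11 c12 c13.
rewrite !lt0b !kind1 !kind2 !(inj_eq nv_inj) /=.
have fu : (if o d.1 (cT d.1 d.2) then if o d.1 d.2 then if d.1 == S then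
      ((cT d.1 d.2 == W) : nat) else 0 else 1 else 0) = parent_dart lo N (next_cw d).
  rewrite parent_lo /= (lo_flag HT HX rot); last by move: dD; rewrite inE.
  by case: (o d.1 (cT _ _)); case: (o d.1 d.2); case: (d.1 == S); case: (_ == W).
have fd : (if o (cT d.1 d.2) d.1 then if o d.2 d.1 then if d.1 == N then
      ((cT d.1 d.2 == E) : nat) else 0 else 1 else 0) = parent_dart ri S (next_cw d).
  rewrite parent_ri /= (ri_flag HT HX rot); last by move: dD; rewrite inE.
  by case: (o (cT _ _) d.1); case: (o d.2 d.1); case: (d.1 == N); case: (_ == E).
rewrite fu fd.
have [_ cS _ cN] := outer_cw HT.
have S1 := ndS_le dD.
fits_all.
split; [by split | by rewrite /= addn1 | by move=> d' /a7 | | split].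
- move=> d' d'D; rewrite /= ltnS leq_eqVlt !nd_eq ?next_cw_darts //.
  case: (eqVneq d' d) => [->|n] /=; first by rewrite eqxx.
  move=> h; rewrite (_ : (next_cw d' == next_cw d) = false); first by apply: inv; rewrite -?ed.
  by apply/negP=> /eqP/(next_cw_inj d'D dD)/eqP; rewrite (negPf n).
- by rewrite /=; do ?[apply: sel_le => //]; rewrite ?nd_le.
- by rewrite /=; do ?[apply: sel_le => //]; rewrite ?nd_le.
- rewrite /= ltnS leq_eqVlt nd_eq //; last by have [[_ h _ _] _] := adj_outer HT; rewrite inE /= aC.
  case: (eqVneq d.1 S) => [eS|n]; last first.
    case: eqVneq => [e|_] /=; first by rewrite -e /= eqxx in n.
    by move=> h; apply: i26; rewrite -ed.
  case: (eqVneq (cT d.1 d.2) W) => [eW|n] /=; first by rewrite /next_cw eW eS.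
  case: eqVneq => [e|_] /=; first by rewrite -e /= cS eqxx in n.
  by move=> h; apply: i26; rewrite -ed.
- rewrite /= ltnS leq_eqVlt nd_eq //; last by have [[_ _ _ h] _] := adj_outer HT; rewrite inE /= aC.
  case: (eqVneq d.1 N) => [eS|n]; last first.
    case: eqVneq => [e|_] /=; first by rewrite -e /= eqxx in n.
    by move=> h; apply: i27; rewrite -ed.
  case: (eqVneq (cT d.1 d.2) E) => [eW|n] /=; first by rewrite /next_cw eW eS.
  case: eqVneq => [e|_] /=; first by rewrite -e /= cN eqxx in n.
  by move=> h; apply: i27; rewrite -ed.
Qed.

Local Notation dt := (down_time T si).
Local Notation da := (down_at T si).
Local Notation sb := (sinks_before T X si).
Local Notation sinks := (sink_darts T X si).
Local Notation down_tree := (tree_dart ri S).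
Local Notation up_tree := (tree_dart lo N).

(** Content of array 10 after [k] steps: the number of sinks met before the walk passes over the arc
    from its tail. *)
Definition counter (k : nat) (d : V * V) : nat :=
  if [&& dt d < k, o d.1 d.2 & ~~ down_tree d] then sb (dt d) else 0.

(** Content of array 11 after [k] steps, written when the walk passes over the arc from its head.
    The final value is a difference of abscissas on leftmost outgoing arcs, the only ones for which
    the second walk uses it. *)
Definition increment (k : nat) (d : V * V) : nat :=
  if (dt (rev_dart d) < k) && (rev_dart d \in sinks)
  then sb (dt (rev_dart d)).+1 - counter (dt (rev_dart d)) d else 0.

Lemma down_time_ltS k d : k < m -> d \in D -> (dt d < k.+1) = (d == da k) || (dt d < k).
Proof.
move=> lt dD; rewrite ltnS leq_eqVlt; congr (_ || _); apply/eqP/eqP=> [<-|->].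
  by rewrite /da (down_timeK HT HX rot).
exact: (down_atK HT HX rot).
Qed.

Lemma sb_le k : k <= m -> sb k <= m.
Proof. by move=> le; apply: leq_trans le; apply: sinks_before_le. Qed.

Lemma counter_le k d : d \in D -> counter k d <= m.
Proof.
move=> dD; rewrite /counter; case: ifP => // _.
by apply: sb_le; apply: ltnW; apply: (down_time_lt HT HX rot dD).
Qed.

Lemma increment_le k d : d \in D -> increment k d <= m.
Proof.
move=> dD; rewrite /increment; case: ifP => // _; apply: leq_trans (leq_subr _ _) _.
by apply: sb_le; apply: (down_time_lt HT HX rot); apply: rev_darts.
Qed.

Definition flags (s : state) : Prop :=
  {in D, forall d, [/\ arr s 7 (nd d) = kind d, arr s 8 (nd d) = parent_dart lo N d
                     & arr s 9 (nd d) = parent_dart ri S d]}.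

Definition down_inv (k : nat) (s : state) : Prop :=
  [/\ core_input s, reg s 6 = k, flags s,
      [/\ reg s 27 = nd (N, E), reg s 28 = nd (da k) & reg s 29 = sb k]
    & {in D, forall d, arr s 10 (nd d) = counter k d /\ arr s 11 (nd d) = increment k d}].

Lemma rev_dart_neq d : d \in D -> (rev_dart d == d) = false.
Proof.
case: d => a b; rewrite inE /= => ab; apply/negP; rewrite /rev_dart xpair_eqE /=.
by case/andP=> /eqP e _; rewrite e (plane_adjI plT) in ab.
Qed.

Lemma down_step k s : k < m -> down_inv k s ->
  reg s 6 < reg s 1 /\ wp B down_body (down_inv k.+1) s.
Proof.
move=> lt [ci r6 fl [r27 r28 r29] inv].
case: (ci) => c1 c10 c11 c12 c13 c14 c15 c16 c17 c18 a0 a1 a2 a3.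
rewrite r6 c1; split=> //; set d := da k.
have dD : d \in D by apply: down_at_darts.
have rD := rev_darts dD; have dk : dt d = k by apply: (down_atK HT HX rot).
have [d7 d8 d9] := fl _ dD; have [e7 e8 e9] := fl _ rD.
have [d10 d11] := inv _ dD; have [e10 e11] := inv _ rD.
have nr : (nd (rev_dart d) == nd d) = false by rewrite nd_eq ?rev_dart_neq.
have tr : (0 < parent_dart ri S d + parent_dart ri S (rev_dart d)) = down_tree d.
  by rewrite addn_gt0 !lt0b.
have sk : (if down_tree d then 0 else ((o d.2 d.1) : nat)) = (d \in sinks).
  by rewrite (sink_dart_nontree HT HX rot); case: down_tree; rewrite ?andbF ?andbT.
have ok : (0 < (if down_tree d then 0 else ((o d.1 d.2) : nat))) = o d.1 d.2 && ~~ down_tree d.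
  by case: down_tree; rewrite ?andbF ?andbT ?lt0b.
have sbk : sb k <= m by apply: sb_le; apply: ltnW.
have sbS : sb k + (d \in sinks) = sb k.+1 by rewrite sinks_beforeS.
have sbk1 : sb k.+1 <= m by apply: sb_le.
have cl := counter_le k; have il := increment_le k.
rewrite /= r28 -/d a1 // d9 e9 d7 r29 c16 c17 c18 r6 /= tr !kind1 !kind2 d10.
rewrite nr e10 e11 sk ok sbS !a2 // lt0b.
have := cl _ dD; have := cl _ rD; have := il _ dD; have := il _ rD => h1 h2 h3 h4.
have b2 (b c : bool) : b + c <= B by case: b; case: c; rewrite // ltnW.
have nn d' : d' \in D -> nd (d'.1, cT d'.1 d'.2) <= B.
  by move=> d'D; apply: nd_le; apply: (next_cw_darts d'D).
have nd1 := nn _ dD; have nd2 := nn _ rD; rewrite /= in nd2.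
repeat match goal with |- _ /\ _ => split; [by first [exact: b2 | fits_one] | ] end.
split; [by split | by rewrite /= addn1 | by move=> d' /fl | split=> //= | ].
  by rewrite /da /= /contour -/d; case: down_tree.
move=> d' d'D; rewrite /= !nd_eq //; split.
  rewrite [in RHS]/counter down_time_ltS // -/d; case: (eqVneq d' d) => [->|n] /=.
    by rewrite dk; case: ifP => // h; rewrite /counter dk ltnn.
  by have [-> _] := inv _ d'D.
rewrite [in RHS]/increment down_time_ltS ?rev_darts // -/d.
have -> : (rev_dart d' == d) = (d' == rev_dart d).
  by apply/eqP/eqP=> [<-|->]; case: (d') => //; case: (d).
case: (eqVneq d' (rev_dart d)) => [->|n] /=.
  have rr : rev_dart (rev_dart d) = d by case: (d).
  by rewrite rr ?dk /increment rr dk ltnn.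
by have [_ ->] := inv _ d'D.
Qed.

(** All inner faces are on the left of the path of [N], so that the final count of the first walk is
    the abscissa with which the second one starts. *)
Lemma sinks_beforeT : sb m = abscissa T X N.
Proof.
have [_ _ -> _] := abscissa_corners HT HX rot.
transitivity (\sum_(d in D) (d \in sinks))%N.
  symmetry; exact: (sum_contour HT (ri_adj HT HX rot) (ri_rank HT HX rot) (start_SW HT)
                      erefl (fun d => (d \in sinks) : nat)).
rewrite -sum1_card big_mkcond [RHS]big_mkcond; apply: eq_bigr => d _.
case: (boolP (d \in sinks)) => [|_]; last by case: ifP.
by rewrite !inE => /andP[/(red_arc_adj HT HX)]; rewrite aC => ->.
Qed.

Lemma abscissa_le_darts v : abscissa T X v <= m.
Proof.
apply: leq_trans (abscissa_le HT HX rot v) _.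
by have [_ _ <- _] := abscissa_corners HT HX rot; rewrite -sinks_beforeT sb_le.
Qed.

Lemma increment_lo v : v != N ->
  abscissa T X v + increment m (v, lo v) = abscissa T X (lo v).
Proof.
move=> vN; have ov := lo_arc rot vN; rewrite /increment /=.
have lD : (lo v, v) \in D by rewrite inE aC; apply: (lo_adj HT HX rot).
rewrite /rev_dart /= (down_time_lt HT HX rot lD) inE /= ov /=.
case: (eqVneq v (ri (lo v))) => [e|n] /=.
  by rewrite addn0; symmetry; apply: (increment_tree HT HX rot).
have [lt le e] := increment_nontree HT HX rot vN n.
rewrite /counter lt ov (tree_out_arc HT HX rot ov) n /= -e; exact: subnKC.
Qed.

Definition up_inv (A k : nat) (s : state) : Prop :=
  [/\ core_input s, reg s 6 = k, flags s,
      [/\ reg s 28 = nd (up_at T so k), reg s 30 = abscissa T X (up_at T so k).1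
        & {in D, forall d, arr s 11 (nd d) = increment m d}]
    & forall j, j <= k ->
        arr s A (nv (up_at T so j).1) = abscissa T X (up_at T so j).1].

Lemma up_step A k s : (A == 4) || (A == 5) -> k < m -> up_inv A k s ->
  reg s 6 < reg s 1 /\ wp B (up_body A) (up_inv A k.+1) s.
Proof.
move=> HA lt [ci r6 fl [r28 r30 inc] inv].
case: (ci) => c1 c10 c11 c12 c13 c14 c15 c16 c17 c18 a0 a1 a2 a3.
rewrite r6 c1; split; first exact: lt.
have [d dE] : {d | up_at T so k = d} by exists (up_at T so k).
rewrite dE in r28 r30.
have dD : d \in D by rewrite -dE; apply: up_at_darts.
have rD := rev_darts dD.
have [d7 d8 d9] := fl _ dD; have [e7 e8 e9] := fl _ rD.
have d11 := inc _ dD; have e11 := inc _ rD.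
have tr : (0 < parent_dart lo N (rev_dart d) + parent_dart lo N d) = up_tree d.
  by rewrite addn_gt0 !lt0b orbC.
have [e eE] : {e | up_at T so k.+1 = e} by exists (up_at T so k.+1).
have upS : e = if up_tree d then (d.2, cT d.2 d.1) else (d.1, cT d.1 d.2).
  by rewrite -eE -dE.
have [a aD] : {a | (if parent_dart lo N (rev_dart d) then abscissa T X d.1 - increment m (rev_dart d)
          else if parent_dart lo N d then abscissa T X d.1 + increment m d else abscissa T X d.1) = a}
  by eexists.
have aE : a = abscissa T X (e).1.
  rewrite upS -aD /tree_dart orbC; case: ifP => [/andP[/= n /eqP ee]|_].
    by have := increment_lo n; rewrite -ee => <-; apply: addnK.
  case: ifP => [/andP[/= n /eqP ee]|_]; last by [].
  rewrite /=.
  by have := increment_lo n; rewrite -ee -surjective_pairing.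
have vE : (if up_tree d then nv (rev_dart d).1 else nv d.1) = nv (e).1.
  by rewrite upS; case: up_tree.
have nE : (if up_tree d then nd (d.2, cT d.2 d.1) else nd (d.1, cT d.1 d.2))
            = nd (e) by rewrite upS; case: up_tree.
have b2 (b c : bool) : b + c <= B by case: b; case: c; rewrite // ltnW.
have nn d' : d' \in D -> nd (d'.1, cT d'.1 d'.2) <= B.
  by move=> d'D; apply: nd_le; apply: (next_cw_darts d'D).
have nd1 := nn _ dD; have nd2 := nn _ rD; rewrite /= in nd2.
have ab v := le_mB (abscissa_le_darts v).
have il1 := increment_le m dD; have il2 := increment_le m rD.
have sB : abscissa T X d.1 + increment m d <= B.
  by apply: leq_trans m_le; apply: leq_add => //; apply: abscissa_le_darts.
have sb1 : abscissa T X d.1 - increment m (rev_dart d) <= B.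
  by apply: leq_trans (leq_subr _ _) (ab _).
have aB : a <= B by rewrite aE.
have k1 : k + 1 <= B by rewrite addn1; apply: le_mB.
have xB := ab d.1; have vB1 := nv_le d.1; have vB2 := nv_le (rev_dart d).1.
have vB3 := nv_le e.1; have nB1 := nd_le dD; have nB2 := nd_le rD.
have i1B := le_mB il1; have i2B := le_mB il2; have neB : nd e <= B by rewrite -nE; case: ifP.
move: (abscissa T X d.1) (increment m d) (increment m (rev_dart d))
  r30 d11 e11 aD sB sb1 xB i1B i2B {ab il1 il2} => x i1 i2 r30 d11 e11 aD sB sb1 xB i1B i2B.
have x1 : (if parent_dart lo N d then x + i1 else x) <= B by case: ifP.
move: HA inv => /orP[]/eqP-> inv.
all: rewrite /= r28 (a1 _ dD) r6 r30 d8 e8 d11 e11 c16 c17 /= !lt0b aD tr.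
all: rewrite (a2 _ dD) (a2 _ rD) (a0 _ dD) (a0 _ rD) vE nE.
all: repeat match goal with |- _ /\ _ => split; [
       repeat match goal with |- _ /\ _ => split | |- and3 _ _ _ => split end;
       first [exact: b2 | exact: bool_le | assumption | reflexivity] | ] end.
all: split; [by split | by rewrite /= addn1 | by move=> d' /fl | by split; rewrite ?eE | ].
all: move=> j; rewrite leq_eqVlt ltnS => /orP[/eqP->|le]; rewrite ?eE /=.
1, 3: by rewrite eqxx; apply: aE.
all: by rewrite (inj_eq nv_inj); case: eqP => [->|_]; [apply: aE | apply: (inv _ le)].
Qed.

Lemma core_runs A s : (A == 4) || (A == 5) -> core_input s ->
  runs B (core A) s (257 * m + 41) (fun s' => forall v, arr s' A (nv v) = abscissa T X v).
Proof.
move=> HA ci.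
have stop s1 : core_input s1 -> reg s1 6 = m -> reg s1 1 <= reg s1 6.
  by move=> c ->; rewrite (ci_m c).
have start6 r (s1 : state) : core_input s1 -> core_input (set_reg s1 6 r) by case=> *; split.
have kind_phase : kind_inv 0 (set_reg s 6 0) by split=> //; apply: start6.
(* One summand for each of the four initializations and the four loops of [core]. *)
have -> : 257 * m + 41 = (3 * 1 + 1) + (((3 * 18 + 2) * m + 1) + ((3 * 3 + 1) +
  (((3 * 25 + 2) * m + 1) + ((3 * 3 + 1) + (((3 * 22 + 2) * m + 1) +
  ((3 * 4 + 1) + ((3 * 18 + 2) * m + 1))))))) by lia.
apply: (runs_seq (P := kind_inv 0)); first by apply: (@compile_runs _ [:: ICst 6 0]).
move=> {kind_phase ci} {}s i0; apply: (runs_seq (P := kind_inv m)).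
  by apply: (runs_while (l := kind_body) kind_step) i0 => s1 [c r _]; apply: stop.
move=> {i0} {}s [ci r6 k0].
apply: (runs_seq (P := flag_inv 0)).
  apply: (@compile_runs _ [:: ICst 6 0; ICst 26 0; ICst 27 0]); do 3!split=> //.
  split=> //=; first by case: ci => *; split.
  by move=> d dD /=; apply: k0 => //; apply: nd_lt.
move=> {ci r6 k0} {}s i0; apply: (runs_seq (P := flag_inv m)).
  by apply: (runs_while (l := flag_body) flag_step) i0 => s1 [c r _ _ _]; apply: stop.
move=> {i0} {}s [ci r6 a7 fl [r26 r27 i26 i27]].
have fl' : flags s.
  move=> d dD; have [? _ _] := a7 _ dD; have [d' d'D e] := next_cw_onto dD.
  by have [] := fl _ d'D (nd_lt d'D); rewrite e.
have dSE : (S, E) \in D by have [[_ h _ _] _] := adj_outer HT; rewrite inE /= aC.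
have dNW : (N, W) \in D by have [[_ _ _ h] _] := adj_outer HT; rewrite inE /= aC.
move: (i26 (nd_lt dSE)) (i27 (nd_lt dNW)) => {r26 r27 i26 i27 fl r6} r26 r27.
have [c16 c10] : reg s 16 = 0 /\ reg s 10 = nv N by case: ci.
apply: (runs_seq (P := down_inv 0)).
  apply: (@compile_runs _ [:: ICst 6 0; IAdd 28 26 16; ICst 29 0]) => /=.
  rewrite r26 c16 addn0 (nd_le (start_SW HT)); do 3!split=> //.
  split=> //=; first by case: ci => *; split.
    by split=> //; rewrite /sinks_before big_nil.
  by move=> d dD; have [_ -> ->] := a7 _ dD.
move=> {ci a7 fl' r26 r27 c16 c10} {}s i0; apply: (runs_seq (P := down_inv m)).
  by apply: (runs_while (l := down_body) down_step) i0 => s1 [c r _ _ _]; apply: stop.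
move=> {i0} {}s [ci r6 fl [r27 _ r29] inv].
have [c16 c10] : reg s 16 = 0 /\ reg s 10 = nv N by case: ci.
apply: (runs_seq (P := up_inv A 0)).
  apply: (@compile_runs _ [:: ICst 6 0; IAdd 28 27 16; IAdd 30 29 16; IWrite A 10 30]) => /=.
  rewrite r27 r29 c16 c10 !addn0 (nd_le (start_NE HT)) sinks_beforeT.
  rewrite (le_mB (abscissa_le_darts _)); do 4!split=> //.
  split=> //=.
  - by case: ci => *; split=> //=; case/orP: HA => /eqP->.
  - by case/orP: HA => /eqP-> d /fl.
  - by split=> // d /inv[_ <-] /=; case/orP: HA => /eqP->.
  - by move=> j; rewrite leqn0 => /eqP->; rewrite /= !eqxx.
move=> {ci r6 fl r27 r29 inv c16 c10} {}s i0.
have up k s1 := @up_step A k s1 HA.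
have [t' [s' [ex le i]]] : runs B (WhileLt 6 1 (compile (up_body A))) s
    ((3 * 18 + 2) * m + 1) (up_inv A m).
  by apply: (runs_while (l := up_body A) up) i0 => s1 [c r _ _ _]; apply: stop.
exists t', s'; split=> // v; case: i => _ _ _ _ i.
have [d dD <-] : exists2 d, d \in D & d.1 = v.
  case: (eqVneq v N) => [->|n]; first by exists (N, E) => //; apply: start_NE.
  by exists (v, lo v); rewrite // inE; apply: (lo_adj HT HX rot).
have := i _ (ltnW (up_time_lt HT HX rot dD)).
by rewrite /up_at (up_timeK HT HX rot dD).
Qed.

End Core.

(** * Memory preserved by a program, and the total running time *)

Fixpoint written_regs (c : cmd) : seq nat :=
  match c with
  | Const x _ | Add x _ _ | Defs.Sub x _ _ | Read x _ _ => [:: x]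
  | Seq c1 c2 | IfLt _ _ c1 c2 => written_regs c1 ++ written_regs c2
  | WhileLt _ _ c1 => written_regs c1
  | _ => [::]
  end.

Fixpoint written_arrs (c : cmd) : seq nat :=
  match c with
  | Write A _ _ => [:: A]
  | Seq c1 c2 | IfLt _ _ c1 c2 => written_arrs c1 ++ written_arrs c2
  | WhileLt _ _ c1 => written_arrs c1
  | _ => [::]
  end.

(** Serves between the two passes: the first one leaves the input intact, and the second one leaves
    the abscissas in array 4. *)
Lemma exec_frame B c s t s' : exec B c s t s' ->
  (forall x, x \notin written_regs c -> reg s' x = reg s x) /\
  (forall A i, A \notin written_arrs c -> arr s' A i = arr s A i).
Proof.
elim=> {c s t s'} //=.
- by move=> s x c _; split=> // y; rewrite inE => /negPf->.
- by move=> s x y z _; split=> // w; rewrite inE => /negPf->.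
- by move=> s x y z _; split=> // w; rewrite inE => /negPf->.
- by move=> s x A y _; split=> // w; rewrite inE => /negPf->.
- by move=> s A x y _; split=> // w i; rewrite inE => /negPf->.
- move=> c1 c2 s s1 s2 t1 t2 _ [r1 a1] _ [r2 a2].
  by split=> [x|A i]; rewrite mem_cat negb_or => /andP[h1 h2]; rewrite (r2, a2) // (r1, a1).
- move=> x y c1 c2 s t s' _ _ [r1 a1].
  by split=> [z|A i]; rewrite mem_cat negb_or => /andP[h1 h2]; rewrite (r1, a1).
- move=> x y c1 c2 s t s' _ _ [r1 a1].
  by split=> [z|A i]; rewrite mem_cat negb_or => /andP[h1 h2]; rewrite (r1, a1).
- move=> x y c s s1 s2 t1 t2 _ _ [r1 a1] _ [r2 a2].
  by split=> [z|A i] h; rewrite (r2, a2) // (r1, a1).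
Qed.

Lemma dart_labelE (V : finType) (T : framed_map V) (X : bicolor_orientation V) d :
    irreducible_triangulation T -> transversal_pair T X -> d \in darts T ->
  [/\ (dart_label X d == 1) = red X d.1 d.2, (dart_label X d == 2) = blue X d.1 d.2,
      (dart_label X d == 3) = red X d.2 d.1, (dart_label X d == 4) = blue X d.2 d.1
    & (dart_label X d == 0) = outer_edge T d.1 d.2].
Proof.
move=> HT HX; rewrite inE => uv; rewrite /dart_label.
case: (boolP (outer_edge T d.1 d.2)) => [oe|ne].
  by have [-> -> -> ->] := outer_colorless HT HX oe.
have i : inner_edge T d.1 d.2 by rewrite /inner_edge /= uv.
case: HX => _ /(_ _ _ i) + _ _.
by case: red => //; case: (red X d.2 d.1) => //; case: blue => //; case: blue.
Qed.

Lemma draw_program_linear : transversal_draw_in_linear_time draw_program.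
Proof.
(* The two passes and their initializations take at most [514 * m + 129] steps, and [m] is less than
   [6 * n]. The resulting bound is also a sufficient word size, in particular for [m + m]. *)
exists (40 * 100) => V T X nv nd s HT HX [[ni nlt di dlt] regs arrs _].
have cd := card_darts HT; set m := #|darts T| in cd; set n := #|V| in cd.
have [B BE] : {B | B = 40 * 100 * n} by eexists.
have [B1 mB nB B4] : [/\ 1 < B, m + m <= B, n <= B & 4 <= B] by rewrite BE; split; lia.
have lB : {in darts T, forall d, dart_label X d <= B}.
  move=> d _; apply: leq_trans B4; rewrite /dart_label.
  by do ?[case: ifP => // _].
have nvB v : nv v <= B by apply: leq_trans (ltnW (nlt v)) nB.
have LE d := @dart_labelE _ _ _ d HT HX.
have HT' := turn_irreducible HT; have HX' := turn_transversal HT HX.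
have [so [si rot]] := red_rotation_ex HT HX.
have [so' [si' rot']] := red_rotation_ex HT' HX'.
have core1 := @core_runs V T X HT HX nv nd (dart_label X) 1 3 ni di dlt
  (fun d dD => let: And5 h _ _ _ _ := LE d dD in h)
  (fun d dD => let: And5 _ _ h _ _ := LE d dD in h)
  (fun d dD => let: And5 _ _ _ _ h := LE d dD in h) B lB nvB mB B1 so si rot 4.
(* After the quarter turn, outgoing red darts are the ingoing blue darts of [T], with label 4, and
   ingoing red darts are the outgoing blue ones, with label 2. *)
have core2 := @core_runs V (turn_map T) (turn_pair X) HT' HX' nv nd (dart_label X) 4 2 ni di dlt
  (fun d dD => let: And5 _ _ _ h _ := LE d dD in h)
  (fun d dD => let: And5 _ h _ _ _ := LE d dD in h)
  (fun d dD => let: And5 _ _ _ _ h := LE d dD in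
     etrans h (esym (turn_outer_edge T d.1 d.2))) B lB nvB mB B1 so' si' rot' 5.
rewrite -BE.
have [t1 [s1 [ex1 le1 [ci1 [f0 f1]]]]] : runs B (compile (constants ++
    [:: IAdd 10 2 16; IAdd 11 3 16; IAdd 12 4 16; IAdd 13 5 16; ICst 14 1; ICst 15 3])) s 28
    (fun s' => core_input T nv nd (dart_label X) 1 3 s' /\
       (forall x, x < 6 -> reg s' x = reg s x) /\ (forall A i, arr s' A i = arr s A i)).
  apply: compile_runs; rewrite /= !regs /= !addn0 !nvB.
  have B0 : 0 < B by apply: ltnW.
  do 9!split=> //; first by apply: leq_trans B4.
  split; first by split=> //=; rewrite ?regs // => d dD; have [] := arrs d dD.
  by split=> // x; do 6?[case: x => // x].
have [t2 [s2 [ex2 le2 out1]]] := core1 s1 isT ci1.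
have [g0 g1] := exec_frame ex2.
have r2 x : x < 6 -> reg s2 x = reg s x.
  by move=> lt; rewrite g0 ?f0 //; do 6?[case: x lt => // x lt].
have a2 A i : A < 4 -> arr s2 A i = arr s A i.
  by move=> lt; rewrite g1 ?f1 //; do 4?[case: A lt => // A lt].
have c16 x : x \in [:: 16; 17; 18] -> reg s2 x = x - 16.
  rewrite !inE => /or3P[]/eqP->; rewrite g0 //; by case: ci1.
have [t3 [s3 [ex3 le3 [ci3 o3]]]] : runs B (compile
    [:: IAdd 10 5 16; IAdd 11 2 16; IAdd 12 3 16; IAdd 13 4 16; ICst 14 4; ICst 15 2]) s2 19
    (fun s' => core_input (turn_map T) nv nd (dart_label X) 4 2 s' /\
       forall i, arr s' 4 i = arr s2 4 i).
  apply: compile_runs; rewrite /= (c16 16) // !r2 // !regs /= !addn0 !nvB.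
  do 6!split=> //; split=> //; split=> //=; rewrite ?(c16 16) ?(c16 17) ?(c16 18) ?(r2 1) ?regs // => d dD;
    by rewrite a2 //; have [] := arrs d dD.
have [t4 [s4 [ex4 le4 out2]]] := core2 s3 isT ci3.
have [_ h1] := exec_frame ex4.
exists (t1 + (t2 + (t3 + t4))), s4; split.
- by apply: exec_seq ex1 _; apply: exec_seq ex2 _; apply: exec_seq ex3 ex4.
- move: le1 le2 le3 le4; rewrite /= -/m.
  by rewrite BE; lia.
- move=> v; split; last by rewrite turn_ordinate; apply: out2.
  by rewrite h1 // o3.
Qed.

Theorem theorem22 :
  (forall (R : realFieldType) (V : finType) (T : framed_map V)
          (X : bicolor_orientation V),
     irreducible_triangulation T -> transversal_pair T X ->
     [/\ straight_line_drawing R T (abscissa T X) (ordinate T X),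
         exists w h : nat,
           grid_size (abscissa T X) (ordinate T X) w h /\ w + h = #|V| - 1,
         forall u v : V, red X u v ->
           ordinate T X u < ordinate T X v /\ abscissa T X u <= abscissa T X v
       & forall u v : V, blue X u v ->
           abscissa T X u < abscissa T X v /\ ordinate T X v <= ordinate T X u])
  /\ (exists c : cmd, transversal_draw_in_linear_time c).
Proof.
split; last by exists draw_program; apply: draw_program_linear.
move=> R V T X HT HX; split; first exact: drawing_straight_line.
- by exists (box_width T X), (box_height T X); split; [apply: drawing_grid_size | apply: box_size].
- move=> u v r; have uv : rd T X u v by rewrite /rd r.
  by split; [apply: ordinate_rd | apply: abscissa_rd].
- move=> u v b; have uv : bl T X u v by rewrite /bl b.
  by split; [apply: abscissa_bl | apply: ordinate_bl].
Qed.
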